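(* Let $\lambda\in[-1,4.603338849)$ be a real parameter and consider the planar potential system $$\frac{dx}{dt}=-y,\qquad \frac{dy}{dt}=x+\lambda\sin(x).$$ Then the center at the origin of this system has infinitely many critical periods, and they appear alternately as maximum and minimum of the period function $T$.
   Context: The system is Hamiltonian with $H(x,y)=\frac{y^2}{2}+G(x)$, where $G(x)=\int_0^x (s+\lambda\sin s)\,ds=\frac{x^2}{2}+\lambda(1-\cos x)$. For the stated range of $\lambda$, the paper regards the origin as a global center, i.e. the period annulus (the largest punctured neighborhood of the origin foliated by periodic orbits) is the whole plane minus the origin; the periodic orbits are the level curves $\Gamma_h=\{(x,y)\in\mathbb{R}^2 : \frac{y^2}{2}+G(x)=h\}$, $h\in(0,+\infty)$. The period function $T$ assigns to each energy level $h$ the minimal period $T(h)$ of the motion along $\Gamma_h$. Critical periods are the isolated zeros $\hat h$ of the first derivative $T'$ of the period function, and the corresponding orbit $\Gamma_{\hat h}$ is called a critical periodic orbit.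
   Formalization: Assumes λ ≠ 0 (at λ = 0 the system is linear, T is constant and there are no critical periods) and that the origin is the only equilibrium, which excludes only λ in [4.60333884875…, 4.603338849), where the origin is not a global center. *)

(* Defs.v *)
From Stdlib Require Import Reals Lra Finite_sets.
From Coquelicot Require Import Coquelicot.
Open Scope R_scope.

Definition G (lam x : R) : R := RInt (fun s => s + lam * sin s) 0 x.

Lemma G_closed_form (lam x : R) : G lam x = x ^ 2 / 2 + lam * (1 - cos x).
Proof.
  unfold G; apply is_RInt_unique.
  replace (x ^ 2 / 2 + lam * (1 - cos x))
    with (minus (x ^ 2 / 2 + lam * (1 - cos x)) (0 ^ 2 / 2 + lam * (1 - cos 0)))
    by (rewrite cos_0; unfold minus, plus, opp; simpl; field).
  apply (is_RInt_derive (fun t => t ^ 2 / 2 + lam * (1 - cos t))).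
  - intros t _; auto_derive; [exact I | field].
  - intros t _; apply (ex_derive_continuous (fun s => s + lam * sin s)); auto_derive; exact I.
Qed.

Definition H (lam x y : R) : R := y ^ 2 / 2 + G lam x.

Definition solution (lam : R) (x y : R -> R) : Prop :=
  forall t, is_derive x t (- y t) /\ is_derive y t (x t + lam * sin (x t)).

Definition is_period (x y : R -> R) (P : R) : Prop :=
  forall t, x (t + P) = x t /\ y (t + P) = y t.

Definition minimal_period (x y : R -> R) (P : R) : Prop :=
  0 < P /\ is_period x y P /\ forall Q, 0 < Q < P -> ~ is_period x y Q.

(* The whole level curve {H = h} is one periodic orbit, of minimal period P. *)
Definition level_period (lam h P : R) : Prop :=
  exists x y : R -> R,
    solution lam x y /\
    (forall p q, H lam p q = h <-> exists t, x t = p /\ y t = q) /\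
    minimal_period x y P.

(* Determines T on (0, +oo); the values of T elsewhere are irrelevant below. *)
Definition is_period_function (lam : R) (T : R -> R) : Prop :=
  forall h, 0 < h -> level_period lam h (T h).

Definition isolated_zero (f : R -> R) (z : R) : Prop :=
  f z = 0 /\ locally' z (fun w => f w <> 0).

(* Critical periods are recorded by their energy levels.
   [Derive] is total, so this is meaningful for T differentiable on (0, +oo). *)
Definition critical_period (T : R -> R) (h : R) : Prop :=
  0 < h /\ isolated_zero (Derive T) h.

Definition local_max (T : R -> R) (h : R) : Prop := locally h (fun k => T k <= T h).
Definition local_min (T : R -> R) (h : R) : Prop := locally h (fun k => T h <= T k).

Definition alternate_max_min (T : R -> R) : Prop :=
  (forall h, critical_period T h -> local_max T h \/ local_min T h) /\
  (forall h1 h2, critical_period T h1 -> critical_period T h2 -> h1 < h2 ->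
     (forall h, h1 < h < h2 -> ~ critical_period T h) ->
     (local_max T h1 /\ local_min T h2) \/ (local_min T h1 /\ local_max T h2)).

(* Main.v *)
Require Import Defs.
From Stdlib Require Import Reals Lra Psatz Finite_sets ClassicalEpsilon.
From Coquelicot Require Import Coquelicot.
Open Scope R_scope.

(* Let G(x) = x^2/2 + lam (1 - cos x), let A > 0 be the amplitude of an orbit (so h = G(A)) and D = G(A) - G(x).  Up to
   a constant the period is the integral of D^(-1/2) over [0, A].  It suffices to show that T'(A) = 0 implies T''(A) <> 0
   and that T' has arbitrarily large zeros: the zeros of T' are then isolated, infinitely many, and T'' changes sign from one
   to the next.

   Scaling x = A X turns T' into lam times the integral of K D^(-3/2) with K = k(A) - k(x), k(x) = 2 (1 - cos x) - x sin x,
   and T'' into lam times the integral of (dQ - c K + 3/2 lam K^2 / D) D^(-3/2), where c is arbitrary if T' = 0.  The curve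
   (k, q) is a spiral winding outwards with k' = j = sin x - x cos x, q' = x^2 sin x, so it lies on one side of its tangent
   at A: j(A) dQ - A^2 sin A K > 0.  At the zeros of j this shows that T' has the sign of - lam sin A, which alternates from
   one zero to the next.  If lam j(A) > 0 it gives the sign of T'' at once.  If lam j(A) < 0 the quadratic term has
   the wrong sign; it is absorbed by tilting the tangent, using |K| <= const * D, except in the first window
   z < A < 2 pi (with tan z = z, lam > 0), where D degenerates as lam tends to 1 / |cos z| and A to z.  There one either
   bounds K by D quantitatively, or keeps [0, c] fixed and dilates only [c, A], c = A - G'(A)/G''(A) being the Newton point. *)

(** The integrand is singular at x = A, so A cannot simply be varied at fixed x. Substituting x = A
    - (A - c) u^2 turns the integral over [c, A] into that of a smooth density over u in [0, 1], for
    any centre c in [0, A). Fixing u dilates [c, A] about c: c = 0 yields the formulas in K and Q,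
    and another c yields different integrands for the same T' and T''. That freedom is what saves
    the borderline case, where G' almost vanishes at z and K cannot be bounded by D with a usable
    constant.

    No integral is ever estimated: a multiple of T' is added to T'', which changes nothing where T'
    = 0, until the integrand has a constant sign. In the dilation about 0 the right multiple turns Q
    into its deviation from the tangent of the spiral.

    The recurring thresholds 4.49, 7.7 and 10.9 lie just below the first three positive zeros
    4.4934..., 7.7252... and 10.9041... of j. For lam > 0 the adverse amplitudes are those where j <
    0: they start at the first zero, stop at the second and resume at the third. *)

Lemma PI_bounds : 3.14159 < PI < 3.1416.
Proof.
  (* Consecutive partial sums of the alternating series for [PI / 4 = 2 atan (1/3) + atan (1/7)]. *)
  destruct (PI_2_3_7_ineq 3) as [H1 H2].
  unfold sum_f_R0, tg_alt, PI_2_3_7_tg, Ratan_seq in H1, H2. cbn [Nat.mul Nat.add] in H1, H2.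
  simpl INR in H1, H2. simpl pow in H1, H2.
  split; lra.
Qed.

(** * The functions j, k and q *)

(* With G(x) = x^2/2 + lam (1 - cos x): 2 G - x G' = lam kf and x^2 G'' = 2 G - 2 lam kf - lam qf,
   while kf' = jf and qf' = x jf' = x^2 sin x. *)
Definition jf (x : R) : R := sin x - x * cos x.
Definition kf (x : R) : R := 2 * (1 - cos x) - x * sin x.
Definition qf (x : R) : R := (2 - x ^ 2) * cos x + 2 * x * sin x - 2.

Lemma is_derive_jf x : is_derive jf x (x * sin x).
Proof. unfold jf; auto_derive; [exact I | ring]. Qed.
Lemma is_derive_kf x : is_derive kf x (jf x).
Proof. unfold kf, jf; auto_derive; [exact I | ring]. Qed.

Lemma sin2_cos2' x : sin x ^ 2 + cos x ^ 2 = 1.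
Proof. generalize (sin2_cos2 x); unfold Rsqr; lra. Qed.

Lemma derive_nonneg_le (f df : R -> R) (a b : R) :
  a <= b -> (forall x, a <= x <= b -> is_derive f x (df x)) ->
  (forall x, a <= x <= b -> 0 <= df x) -> f a <= f b.
Proof.
  intros [Hab | ->] Hd Hp; [| lra].
  destruct (MVT_gen f a b df) as [c [Hc E]].
  - intros x Hx; rewrite Rmin_left, Rmax_right in Hx by lra; apply Hd; lra.
  - intros x Hx; rewrite Rmin_left, Rmax_right in Hx by lra.
    apply derivable_continuous_pt. exists (df x). apply is_derive_Reals, Hd; lra.
  - rewrite Rmin_left, Rmax_right in Hc by lra.
    assert (0 <= df c) by (apply Hp; lra). nra.
Qed.

(** Positivity is asked only in the open interval, because the derivatives in question often vanish
    at an end, at 0 or at a zero of [jf]. *)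
Lemma derive_pos_lt (f df : R -> R) (a b : R) :
  a < b -> (forall x, a <= x <= b -> is_derive f x (df x)) ->
  (forall x, a < x < b -> 0 < df x) -> f a < f b.
Proof.
  intros Hab Hd Hp.
  assert (forall u v, a < u -> u < v -> v < b -> f u < f v).
  { intros u v Hu Huv Hv.
    destruct (MVT_gen f u v df) as [c [Hc E]].
    - intros x Hx; rewrite Rmin_left, Rmax_right in Hx by lra; apply Hd; lra.
    - intros x Hx; rewrite Rmin_left, Rmax_right in Hx by lra.
      apply derivable_continuous_pt. exists (df x). apply is_derive_Reals, Hd; lra.
    - rewrite Rmin_left, Rmax_right in Hc by lra.
      assert (0 < df c) by (apply Hp; lra). nra. }
  set (u := (3 * a + b) / 4). set (v := (a + b) / 2). set (w := (a + 3 * b) / 4).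
  assert (f u < f v) by (apply H; unfold u, v; lra).
  assert (f v < f w) by (apply H; unfold v, w; lra).
  assert (Haux : forall p q, a <= p -> p < q -> q <= b ->
    exists c, p < c < q /\ f q - f p = df c * (q - p)).
  { intros p q Hp' Hpq Hq.
    destruct (MVT_cor2 f df p q Hpq) as [c [E Hc]].
    - intros x Hx. apply is_derive_Reals, Hd; lra.
    - exists c; split; [lra | exact E]. }
  destruct (Haux a b (Rle_refl _) Hab (Rle_refl _)) as [c [Hc E]].
  assert (0 < df c) by (apply Hp; lra). nra.
Qed.

(** * Taylor bounds for sine and cosine *)

Lemma cos_lower t : 1 - t ^ 2 / 2 <= cos t.
Proof.
  assert (H1 : forall t, 0 <= t -> 1 - t ^ 2 / 2 <= cos t).
  { clear t; intros t Ht.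
    assert (0 ^ 2 / 2 + cos 0 <= t ^ 2 / 2 + cos t).
    { apply derive_nonneg_le with (f := fun t => t ^ 2 / 2 + cos t) (df := fun t => t - sin t); auto.
      - intros; auto_derive; [exact I | field].
      - intros y [[Hy | <-] _]; [generalize (sin_lt_x y Hy); lra | rewrite sin_0; lra]. }
    rewrite cos_0 in H. lra. }
  destruct (Rle_lt_dec 0 t); [auto |].
  replace (t ^ 2) with ((- t) ^ 2) by ring. rewrite <- cos_neg. apply H1; lra.
Qed.

Lemma sin_lower x : 0 <= x -> x - x ^ 3 / 6 <= sin x.
Proof.
  intros Hx. assert (sin 0 - 0 + 0 ^ 3 / 6 <= sin x - x + x ^ 3 / 6).
  { apply derive_nonneg_le with (f := fun t => sin t - t + t ^ 3 / 6) (df := fun t => cos t - 1 + t ^ 2 / 2); auto.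
    - intros; auto_derive; [exact I | field].
    - intros y _. generalize (cos_lower y); lra. }
  rewrite sin_0 in H. lra.
Qed.

Lemma cos_upper t : cos t <= 1 - t ^ 2 / 2 + t ^ 4 / 24.
Proof.
  assert (H1 : forall t, 0 <= t -> cos t <= 1 - t ^ 2 / 2 + t ^ 4 / 24).
  { clear t; intros t Ht.
    assert (1 - 0 ^ 2 / 2 + 0 ^ 4 / 24 - cos 0 <= 1 - t ^ 2 / 2 + t ^ 4 / 24 - cos t).
    { apply derive_nonneg_le with (f := fun t => 1 - t ^ 2 / 2 + t ^ 4 / 24 - cos t) (df := fun t => - t + t ^ 3 / 6 + sin t); auto.
      - intros; auto_derive; [exact I | field].
      - intros y [Hy _]. generalize (sin_lower y Hy); lra. }
    rewrite cos_0 in H. lra. }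
  destruct (Rle_lt_dec 0 t); [auto |].
  replace (t ^ 2) with ((- t) ^ 2) by ring. replace (t ^ 4) with ((- t) ^ 4) by ring. rewrite <- cos_neg. apply H1; lra.
Qed.

Lemma sin_upper t : 0 <= t -> sin t <= t - t ^ 3 / 6 + t ^ 5 / 120.
Proof.
  intros Ht.
  assert (0 - 0 ^ 3 / 6 + 0 ^ 5 / 120 - sin 0 <= t - t ^ 3 / 6 + t ^ 5 / 120 - sin t).
  { apply derive_nonneg_le with (f := fun t => t - t ^ 3 / 6 + t ^ 5 / 120 - sin t) (df := fun t => 1 - t ^ 2 / 2 + t ^ 4 / 24 - cos t); auto.
    - intros; auto_derive; [exact I | field].
    - intros y _. generalize (cos_upper y); lra. }
  rewrite sin_0 in H. lra.
Qed.

(** * Signs and zeros of j *)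

Lemma jf_pos x : 0 < x <= PI -> 0 < jf x.
Proof.
  intros Hx. replace 0 with (jf 0) by (unfold jf; rewrite sin_0; ring).
  apply derive_pos_lt with (df := fun x => x * sin x); [lra | |].
  - intros y _; apply is_derive_jf.
  - intros y Hy. apply Rmult_lt_0_compat; [lra | apply sin_gt_0; lra].
Qed.

(** At a zero [sin z = z * cos z], so the addition formulas leave a multiple of [cos z]. For
    positive z the other factor is positive over the next half turn, which gives the sign of [jf] on
    either side of z. *)
Lemma jf_shift z d : jf z = 0 -> jf (z + d) = cos z * (jf d + z * (z + d) * sin d).
Proof.
  unfold jf; intros Hz. rewrite sin_plus, cos_plus.
  replace (sin z) with (z * cos z) by lra. ring.
Qed.

Lemma jf_zero_cos z : jf z = 0 -> cos z <> 0.
Proof.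
  unfold jf; intros Hz Hc. generalize (sin2_cos2' z). rewrite Hc in Hz |- *.
  assert (sin z = 0) by lra. rewrite H; lra.
Qed.

Lemma jf_odd x : jf (- x) = - jf x.
Proof. unfold jf; rewrite sin_neg, cos_neg; ring. Qed.

Lemma jf_after_zero z d : 0 < z -> jf z = 0 -> 0 < d <= PI -> 0 < jf (z + d) * cos z.
Proof.
  intros Hz0 Hz Hd. rewrite jf_shift by assumption.
  assert (cos z <> 0) by (apply jf_zero_cos; auto).
  assert (0 < jf d) by (apply jf_pos; lra).
  assert (0 <= sin d) by (apply sin_ge_0; lra).
  assert (0 <= z * (z + d) * sin d) by (repeat apply Rmult_le_pos; lra).
  assert (0 < cos z * cos z) by nra. nra.
Qed.

Lemma jf_before_zero z d : jf z = 0 -> 0 < d <= PI -> d <= z -> jf (z - d) * cos z < 0.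
Proof.
  intros Hz Hd Hdz. unfold Rminus. rewrite jf_shift by assumption. rewrite jf_odd, sin_neg.
  assert (cos z <> 0) by (apply jf_zero_cos; auto).
  assert (0 < jf d) by (apply jf_pos; lra).
  assert (0 <= sin d) by (apply sin_ge_0; lra).
  assert (0 <= z * (z + - d) * sin d) by (repeat apply Rmult_le_pos; lra).
  assert (0 < cos z * cos z) by nra. nra.
Qed.

Lemma jf_zeros_apart z z' : 0 < z' -> z' < z -> jf z' = 0 -> jf z = 0 -> PI < z - z'.
Proof.
  intros H0 Hl Hz' Hz. destruct (Rlt_le_dec PI (z - z')); auto. exfalso.
  generalize (jf_after_zero z' (z - z') H0 Hz'). replace (z' + (z - z')) with z by ring.
  rewrite Hz; lra.
Qed.

Lemma continuity_jf : continuity jf.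
Proof. intros x. apply derivable_continuous_pt. exists (x * sin x). apply is_derive_Reals, is_derive_jf. Qed.

Lemma jf_ivt a b : a < b -> jf a * jf b < 0 -> exists z, a < z < b /\ jf z = 0.
Proof.
  intros Hab Hs.
  destruct (IVT_cor jf a b continuity_jf (Rlt_le _ _ Hab)) as [z [Hz E]]; [lra |].
  exists z; split; auto.
  assert (z <> a) by (intros ->; rewrite E in Hs; lra).
  assert (z <> b) by (intros ->; rewrite E in Hs; lra). lra.
Qed.

Lemma jf_lipschitz z A : 0 <= z <= A -> Rabs (jf A - jf z) <= A * (A - z).
Proof.
  intros H. destruct (Req_dec z A) as [-> | Hn].
  { rewrite Rminus_diag, Rabs_R0; lra. }
  destruct (MVT_cor2 jf (fun x => x * sin x) z A) as [c [E Hc]]; [lra | |].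
  - intros x _; apply is_derive_Reals, is_derive_jf.
  - rewrite E, Rabs_mult, (Rabs_right (A - z)) by lra.
    apply Rmult_le_compat_r; [lra |]. rewrite Rabs_mult, (Rabs_right c) by lra.
    assert (Rabs (sin c) <= 1) by (apply Rabs_le, SIN_bound).
    assert (0 <= Rabs (sin c)) by apply Rabs_pos. nra.
Qed.

(** At [y = 2 x] this is the numerator of the derivative in [slope_decr]. Two differentiations
    reduce it to the positivity of [jf] at the half angle. *)
Lemma slope_aux y : 0 < y -> 0 < y ^ 2 / 4 + y * sin y / 4 - 1 + cos y.
Proof.
  intros Hy.
  assert (H3 : forall t, 0 < t -> 0 < t + t * cos t / 2 - 3 * sin t / 2).
  { intros t Ht. destruct (Rle_lt_dec PI t) as [HP | HP].
    - generalize (SIN_bound t) (COS_bound t) PI2_3_2; intros.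
      assert (3 < PI) by lra. nra.
    - replace 0 with (0 + 0 * cos 0 / 2 - 3 * sin 0 / 2) by (rewrite sin_0; field).
      apply derive_pos_lt with (f := fun t => t + t * cos t / 2 - 3 * sin t / 2)
        (df := fun t => 1 - cos t - t * sin t / 2); auto.
      + intros; auto_derive; [exact I | field].
      + intros u Hu.
        (* half angles give 2 sin(u/2) (sin(u/2) - (u/2) cos(u/2)) *)
        replace u with (2 * (u / 2)) by field.
        rewrite cos_2a_sin, sin_2a.
        assert (0 < sin (u / 2)) by (apply sin_gt_0; lra).
        assert (0 < jf (u / 2)) by (apply jf_pos; lra). unfold jf in *.
        replace (_ - _ - _) with (2 * sin (u/2) * (sin (u/2) - u/2 * cos (u/2))) by field.
        apply Rmult_lt_0_compat; lra. }
  replace 0 with (0 ^ 2 / 4 + 0 * sin 0 / 4 - 1 + cos 0) by (rewrite sin_0, cos_0; field).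
  apply derive_pos_lt with (f := fun y => y ^ 2 / 4 + y * sin y / 4 - 1 + cos y)
    (df := fun y => (y + y * cos y / 2 - 3 * sin y / 2) / 2); auto.
  - intros; auto_derive; [exact I | field].
  - intros u Hu. specialize (H3 u ltac:(lra)). lra.
Qed.

Lemma slope_aux' x : 0 < x -> 0 < x ^ 2 + x * sin x * cos x - 2 * sin x ^ 2.
Proof.
  intros Hx. generalize (slope_aux (2 * x) ltac:(lra)).
  rewrite sin_2a, cos_2a_sin. intros H.
  replace (x ^ 2 + x * sin x * cos x - 2 * sin x ^ 2) with
   ((2 * x) ^ 2 / 4 + 2 * x * (2 * sin x * cos x) / 4 - 1 + (1 - 2 * sin x * sin x)) by field.
  exact H.
Qed.

(* [x ^ 2 * sin x / jf x] is the slope of the curve (kf, qf). *)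
Lemma slope_decr x A : 0 < x < A -> (forall y, x <= y <= A -> jf y <> 0) ->
  A ^ 2 * sin A / jf A < x ^ 2 * sin x / jf x.
Proof.
  intros Hx Hn. apply Ropp_lt_cancel.
  apply derive_pos_lt with (f := fun x => - (x ^ 2 * sin x / jf x))
    (df := fun x => x * (x ^ 2 + x * sin x * cos x - 2 * sin x ^ 2) / jf x ^ 2); [lra | |].
  - intros y Hy. generalize (Hn y Hy); unfold jf; intros Hne.
    auto_derive; [auto |].
    assert (E : sin y ^ 2 = 1 - cos y ^ 2) by (generalize (sin2_cos2' y); lra).
    field_simplify_eq; [ring [E] | auto].
  - intros y Hy. assert (jf y <> 0) by (apply Hn; lra).
    apply Rdiv_lt_0_compat; [| nra].
    apply Rmult_lt_0_compat; [lra | apply slope_aux'; lra].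
Qed.

(** * The spiral (k, q) *)

(* Support function of the curve (kf, qf) in the direction (- e, j0), up to a constant ([supp_eq]);
   [supp_amp] is its squared amplitude when x is frozen in the coefficients. *)
Definition supp (j0 e x : R) : R :=
  (j0 * (2 - x ^ 2) + 2 * e) * cos x + x * (2 * j0 + e) * sin x.
Definition supp_amp (j0 e x : R) : R := x ^ 4 * j0 ^ 2 + x ^ 2 * e ^ 2 + 4 * (j0 + e) ^ 2.

Lemma supp_eq j0 e x : supp j0 e x = j0 * (qf x + 2) - e * (kf x - 2).
Proof. unfold supp, qf, kf; ring. Qed.

Lemma supp_le_amp j0 e x : supp j0 e x ^ 2 <= supp_amp j0 e x.
Proof.
  unfold supp, supp_amp.
  set (a := j0 * (2 - x ^ 2) + 2 * e). set (b := x * (2 * j0 + e)).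
  replace (x ^ 4 * j0 ^ 2 + x ^ 2 * e ^ 2 + 4 * (j0 + e) ^ 2) with (a ^ 2 + b ^ 2)
    by (unfold a, b; ring).
  generalize (sin2_cos2' x); intros E.
  replace (a ^ 2 + b ^ 2) with ((a ^ 2 + b ^ 2) * (sin x ^ 2 + cos x ^ 2)) by (rewrite E; ring).
  assert (0 <= (a * sin x - b * cos x) ^ 2) by apply pow2_ge_0. nra.
Qed.

Lemma supp_amp_mono j0 e x y : 0 <= x <= y -> supp_amp j0 e x <= supp_amp j0 e y.
Proof.
  intros H. unfold supp_amp.
  assert (x ^ 2 <= y ^ 2) by (apply pow_incr; lra).
  assert (x ^ 4 <= y ^ 4) by (apply pow_incr; lra).
  assert (0 <= j0 ^ 2) by apply pow2_ge_0. assert (0 <= e ^ 2) by apply pow2_ge_0. nra.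
Qed.

(** The amplitude grows with x, so one inequality at y settles all of [0, y], whatever the phase. *)
Lemma supp_lt j0 e x y N : 0 <= x <= y -> 0 < N -> supp_amp j0 e y < N ^ 2 -> supp j0 e x < N.
Proof.
  intros Hx HN Ha. apply Rnot_le_lt; intros Hc.
  generalize (supp_le_amp j0 e x) (supp_amp_mono j0 e x y Hx); intros.
  assert (N ^ 2 <= supp j0 e x ^ 2) by (apply pow_incr; lra). lra.
Qed.

Lemma is_derive_supp j0 e x :
  is_derive (supp j0 e) x (j0 * (x ^ 2 * sin x) - e * jf x).
Proof.
  apply is_derive_ext with (fun x => j0 * (qf x + 2) - e * (kf x - 2)).
  { intros t; symmetry; apply supp_eq. }
  unfold qf, kf, jf. auto_derive; [exact I | ring].
Qed.

(** Up to the factor [j0 / jf x] this is the value of [supp] at a critical point ([supp_crit]). Its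
    positivity means that the curve (k, q) turns about the point (2, -2) always in the same
    sense. *)
Lemma crit_poly_pos x : 0 < x ->
  0 < x ^ 3 + 2 * x * (sin x ^ 2 - cos x ^ 2) + (2 - x ^ 2) * (sin x * cos x).
Proof.
  intros Hx. destruct (Rle_lt_dec x (PI / 2)) as [Hp | Hp].
  - replace (_ + _ + _) with (jf (2 * x) + x ^ 2 / 2 * (2 * x - sin (2 * x))).
    + assert (0 < jf (2 * x)) by (apply jf_pos; lra).
      generalize (sin_lt_x (2 * x) ltac:(lra)); intros.
      assert (0 < x ^ 2) by (apply pow_lt; lra). nra.
    + unfold jf; rewrite sin_2a, cos_2a; field.
  - generalize (sin2_cos2' x) PI2_3_2; intros E HP.
    set (s := sin x) in *. set (c := cos x) in *.
    assert (Hx2 : 9 / 4 < x ^ 2) by nra.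
    replace (x ^ 3) with (x * x ^ 2 * (s ^ 2 + c ^ 2)) by (rewrite E; ring).
    set (X := x ^ 2) in *.
    replace (x * X * (s ^ 2 + c ^ 2) + 2 * x * (s ^ 2 - c ^ 2) + (2 - X) * (s * c))
      with (x * (X + 2) * s ^ 2 + x * (X - 2) * c ^ 2 - (X - 2) * (s * c)) by ring.
    assert (Hbig : X - 2 <= (X + 2) * s ^ 2 + (X - 2) * c ^ 2).
    { replace ((X + 2) * s ^ 2 + (X - 2) * c ^ 2) with ((X - 2) * (s ^ 2 + c ^ 2) + 4 * s ^ 2) by ring.
      rewrite E. generalize (pow2_ge_0 s); lra. }
    assert (Hsc : s * c <= 1 / 2) by (generalize (pow2_ge_0 (s - c)); nra).
    assert ((X - 2) * (s * c) <= (X - 2) * (1 / 2)) by (apply Rmult_le_compat_l; lra).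
    assert ((3 / 2) * (X - 2) <= x * ((X + 2) * s ^ 2 + (X - 2) * c ^ 2))
      by (apply Rmult_le_compat; lra).
    lra.
Qed.

Lemma supp_crit j0 e x : 0 < x -> j0 * (x ^ 2 * sin x) = e * jf x ->
  supp j0 e x * jf x =
    j0 * (x ^ 3 + 2 * x * (sin x ^ 2 - cos x ^ 2) + (2 - x ^ 2) * (sin x * cos x)).
Proof.
  intros Hx E. unfold supp.
  replace (((j0 * (2 - x ^ 2) + 2 * e) * cos x + x * (2 * j0 + e) * sin x) * jf x)
   with ((j0 * (2 - x ^ 2) * cos x + 2 * x * j0 * sin x) * jf x + (e * jf x) * (2 * cos x + x * sin x)) by ring.
  rewrite <- E. unfold jf. generalize (sin2_cos2' x); intros E2.
  replace (x ^ 3) with (x ^ 3 * (sin x ^ 2 + cos x ^ 2)) by (rewrite E2; ring). ring.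
Qed.

(** At a critical point whose tangent is antiparallel to the direction (j0, e), the curve is on the
    opposite side of its centre (2, -2); such a point cannot carry a positive maximum. *)
Lemma supp_crit_neg j0 e x : 0 < x -> j0 * (x ^ 2 * sin x) = e * jf x ->
  j0 * jf x < 0 -> supp j0 e x < 0.
Proof.
  intros Hx E Hs. generalize (supp_crit j0 e x Hx E) (crit_poly_pos x Hx).
  set (P := x ^ 3 + _ + _). intros E1 HP.
  assert (supp j0 e x * (jf x * jf x) = (j0 * jf x) * P) by (rewrite <- Rmult_assoc, E1; ring).
  assert (jf x <> 0) by (intros H0; rewrite H0 in Hs; lra).
  assert (0 < jf x * jf x) by nra. nra.
Qed.

(* The tangent at x is parallel to the one at A and points the same way, so the curve has turned at least once around. *)
Lemma crit_far A c x : 0 < x < A -> 0 <= c -> jf A <> 0 -> 0 < jf A * jf x ->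
  jf A * (x ^ 2 * sin x) = (A ^ 2 * sin A - c * jf A) * jf x ->
  x < A - PI - Rabs (jf A) / A.
Proof.
  intros Hx Hc HA Hs E.
  assert (Hjx : jf x <> 0) by (intros H0; rewrite H0 in Hs; lra).
  (* Without a zero of [jf] in between, the slope would decrease strictly from x to A, whereas the
     equation puts the slope at x exactly c >= 0 below the one at A. *)
  assert (Hz : exists z, x < z < A /\ jf z = 0).
  { destruct (Classical_Prop.classic (exists z, x < z < A /\ jf z = 0)) as [? | Hno]; auto.
    exfalso. assert (Hlt : A ^ 2 * sin A / jf A < x ^ 2 * sin x / jf x).
    { apply slope_decr; auto. intros y Hy Hy0.
      destruct (Req_dec y x) as [-> | ]; [auto |]. destruct (Req_dec y A) as [-> | ]; [auto |].
      apply Hno; exists y; split; auto; lra. }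
    assert (x ^ 2 * sin x / jf x = A ^ 2 * sin A / jf A - c); [| lra].
    field_simplify_eq; [lra | auto]. }
  (* As [jf] varies at rate at most A, it takes at least this long to climb from 0 to [jf A]. *)
  assert (Hdist : forall z, 0 < z < A -> jf z = 0 -> Rabs (jf A) / A <= A - z).
  { intros z Hz1 Hz2. generalize (jf_lipschitz z A ltac:(lra)). rewrite Hz2, Rminus_0_r.
    intros H. apply Rmult_le_reg_r with A; [lra |]. unfold Rdiv. rewrite Rmult_assoc, Rinv_l by lra. lra. }
  destruct Hz as [z [Hz1 Hz2]].
  assert (HP := PI_RGT_0).
  assert (Hcz := jf_zero_cos z Hz2).
  (* [jf] changes sign across z but has equal signs at x and A, so it vanishes a second time; two
     zeros are more than PI apart. *)
  assert (Htwo : exists z1 z2, x < z1 < z2 /\ z2 < A /\ jf z1 = 0 /\ jf z2 = 0).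
  { destruct (Rlt_le_dec (jf A * cos z) 0) as [Hn | Hn].
    - set (d := Rmin PI ((A - z) / 2)).
      assert (0 < d <= PI) by (unfold d; split; [apply Rmin_glb_lt; lra | apply Rmin_l]).
      assert (d <= (A - z) / 2) by apply Rmin_r.
      generalize (jf_after_zero z d ltac:(lra) Hz2 H); intros Hp.
      destruct (jf_ivt (z + d) A) as [z2 [Hz3 Hz4]]; [lra | |].
      + assert (0 < cos z * cos z) by nra. nra.
      + exists z, z2; repeat split; auto; lra.
    - assert (0 < jf A * cos z) by (destruct Hn as [|Hn]; auto; symmetry in Hn; apply Rmult_integral in Hn; tauto).
      set (d := Rmin PI ((z - x) / 2)).
      assert (0 < d <= PI) by (unfold d; split; [apply Rmin_glb_lt; lra | apply Rmin_l]).
      assert (d <= (z - x) / 2) by apply Rmin_r.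
      generalize (jf_before_zero z d Hz2 H0 ltac:(lra)); intros Hp.
      destruct (jf_ivt x (z - d)) as [z2 [Hz3 Hz4]]; [lra | |].
      + assert (0 < cos z * cos z) by nra. assert (0 < jf A * jf A) by nra.
        assert (0 < jf x * cos z) by nra. nra.
      + exists z2, z; repeat split; auto; lra. }
  destruct Htwo as [z1 [z2 [H1 [H2 [H3 H4]]]]].
  generalize (jf_zeros_apart z2 z1 ltac:(lra) ltac:(lra) H3 H4) (Hdist z2 ltac:(lra) H4). lra.
Qed.

Lemma interior_max_derive (f df : R -> R) a b x : a < x < b -> is_derive f x (df x) ->
  (forall y, a < y < b -> f y <= f x) -> is_derive f x 0.
Proof.
  intros Hx Hd Hm.
  assert (pr : derivable_pt f x) by (exists (df x); apply is_derive_Reals; auto).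
  assert (E : derive_pt f x pr = 0) by (apply (deriv_maximum f a b x pr); try lra; intros; apply Hm; lra).
  apply is_derive_Reals. rewrite <- E. apply derive_pt_eq_1 with pr; reflexivity.
Qed.

(* The interior critical points are harmless, so only the end points of [x1, A] matter. *)
Lemma supp_max A c x1 : 0 < x1 < A -> 0 <= c -> jf A <> 0 ->
  A - PI - Rabs (jf A) / A <= x1 ->
  let e := A ^ 2 * sin A - c * jf A in
  supp (jf A) e x1 < supp (jf A) e A -> 0 < supp (jf A) e A ->
  forall x, x1 <= x < A -> supp (jf A) e x < supp (jf A) e A.
Proof.
  intros Hx1 Hc HA Hfar e Hend HN.
  assert (Hcrit : forall x, x1 < x < A -> is_derive (supp (jf A) e) x 0 -> supp (jf A) e x < 0).
  { intros x Hx Hd.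
    assert (E : jf A * (x ^ 2 * sin x) = e * jf x).
    { generalize (is_derive_unique _ _ _ Hd) (is_derive_unique _ _ _ (is_derive_supp (jf A) e x)); lra. }
    (* Parallel tangents occur only before x1, by [crit_far]; antiparallel ones give a negative
       value; and [jf x = 0] would force [sin x = cos x = 0]. *)
    apply supp_crit_neg; [lra | exact E |].
    apply Rnot_le_lt; intros Hge. destruct Hge as [Hgt | H0].
    - generalize (crit_far A c x ltac:(lra) Hc HA Hgt E); lra.
    - assert (Hj : jf x = 0) by (symmetry in H0; apply Rmult_integral in H0; tauto).
      rewrite Hj, Rmult_0_r in E.
      apply Rmult_integral in E; destruct E as [E | E]; [auto |].
      apply Rmult_integral in E; destruct E as [E | E].
      + assert (0 < x ^ 2) by (apply pow_lt; lra). lra.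
      + unfold jf in Hj. rewrite E in Hj. generalize (sin2_cos2' x). rewrite E.
        assert (cos x = 0) by (assert (x * cos x = 0) by lra; apply Rmult_integral in H; destruct H; lra).
        rewrite H; lra. }
  assert (Hcont : forall x, continuity_pt (supp (jf A) e) x).
  { intros x. apply derivable_continuous_pt. eexists. apply is_derive_Reals, is_derive_supp. }
  destruct (continuity_ab_maj (supp (jf A) e) x1 A ltac:(lra) ltac:(auto)) as [xm [Hm Hxm]].
  assert (Hint : x1 < xm < A -> supp (jf A) e xm < 0).
  { intros Hi. apply Hcrit; auto. apply interior_max_derive with (df := fun x => jf A * (x ^ 2 * sin x) - e * jf x) (a := x1) (b := A); auto.
    - apply is_derive_supp.
    - intros y Hy; apply Hm; lra. }
  assert (Hle : forall x, x1 <= x <= A -> supp (jf A) e x <= supp (jf A) e A).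
  { intros x Hx. generalize (Hm x Hx) (Hm A ltac:(lra)); intros.
    destruct (Req_dec xm A) as [-> | HnA]; auto.
    destruct (Req_dec xm x1) as [-> | Hn1]; [lra |].
    assert (supp (jf A) e xm < 0) by (apply Hint; lra). lra. }
  intros x Hx. destruct (Hle x ltac:(lra)) as [? | Heq]; auto. exfalso.
  destruct (Req_dec x x1) as [-> | Hn1]; [lra |].
  assert (supp (jf A) e x < 0); [| lra].
  apply Hcrit; [lra |]. apply interior_max_derive with (df := fun x => jf A * (x ^ 2 * sin x) - e * jf x) (a := x1) (b := A); [lra | |].
  - apply is_derive_supp.
  - intros y Hy; rewrite Heq; apply Hle; lra.
Qed.

Lemma supp_at A c : let j0 := jf A in let e := A ^ 2 * sin A - c * j0 in
  supp j0 e A = A ^ 3 + 2 * A * (sin A ^ 2 - cos A ^ 2) + (2 - A ^ 2) * (sin A * cos A)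
    - c * j0 * (2 * cos A + A * sin A).
Proof.
  intros j0 e. unfold supp, e, j0, jf.
  generalize (sin2_cos2' A); intros E.
  replace (A ^ 3) with (A ^ 3 * (sin A ^ 2 + cos A ^ 2)) by (rewrite E; ring). ring.
Qed.

Lemma supp_at_pos A : 2 < A -> 0 < supp (jf A) (A ^ 2 * sin A) A.
Proof.
  intros HA. generalize (supp_at A 0). cbv zeta. rewrite Rmult_0_l, Rminus_0_r. intros ->.
  generalize (crit_poly_pos A ltac:(lra)); lra.
Qed.

(** The square of [supp] at A falls short of its amplitude by at most 4 (A^2 + A + 1) W, while over
    a half turn the amplitude gains about 2 PI A * A^2 W. The common factor W = A^2 sin^2 A + j^2 is
    kept on both sides, so no phase of A is exceptional. *)
Lemma spiral_amp A : 44 / 10 <= A ->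
  supp_amp (jf A) (A ^ 2 * sin A) (A - PI) < supp (jf A) (A ^ 2 * sin A) A ^ 2.
Proof.
  intros HA. generalize PI_bounds; intros HP.
  set (S := sin A). set (C := cos A).
  assert (E : S ^ 2 + C ^ 2 = 1) by apply sin2_cos2'.
  assert (Ej : jf A = S - A * C) by reflexivity. set (j := jf A) in *.
  assert (EN : supp j (A ^ 2 * S) A ^ 2 = supp_amp j (A ^ 2 * S) A - (A ^ 2 * S ^ 2 + 2 * j ^ 2) ^ 2).
  { unfold supp, supp_amp. fold S C.
    replace (A ^ 4 * j ^ 2 + A ^ 2 * (A ^ 2 * S) ^ 2 + 4 * (j + A ^ 2 * S) ^ 2)
      with ((A ^ 4 * j ^ 2 + A ^ 2 * (A ^ 2 * S) ^ 2 + 4 * (j + A ^ 2 * S) ^ 2) * (S ^ 2 + C ^ 2))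
      by (rewrite E; ring).
    rewrite Ej. ring. }
  rewrite EN. unfold supp_amp.
  set (x := A - PI). assert (Hx : 1 < x) by (unfold x; lra).
  set (W := A ^ 2 * S ^ 2 + j ^ 2).
  assert (HW : W <= A ^ 2 + A + 1).
  { unfold W. rewrite Ej. replace (A ^ 2 * S ^ 2 + (S - A * C) ^ 2) with
     (A ^ 2 * (S ^ 2 + C ^ 2) - 2 * A * (S * C) + S ^ 2) by ring. rewrite E.
    assert (- (S * C) <= 1 / 2) by (generalize (pow2_ge_0 (S + C)); lra).
    assert (S ^ 2 <= 1) by (generalize (pow2_ge_0 C); lra).
    assert (A * - (S * C) <= A * (1 / 2)) by (apply Rmult_le_compat_l; lra). lra. }
  assert (HW0 : 0 < W).
  { unfold W. destruct (Req_dec S 0) as [H0 | H0].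
    - assert (C ^ 2 = 1) by (rewrite H0 in E; lra). rewrite Ej, H0.
      replace (A ^ 2 * 0 ^ 2 + (0 - A * C) ^ 2) with (A ^ 2 * C ^ 2) by ring. rewrite H. nra.
    - assert (0 < S ^ 2) by (apply pow2_gt_0; auto). generalize (pow2_ge_0 j); intros.
      assert (0 < A ^ 2 * S ^ 2) by (apply Rmult_lt_0_compat; [apply pow_lt; lra | auto]). lra. }
  assert (Hd : A ^ 2 - x ^ 2 = PI * (2 * A - PI)) by (unfold x; ring).
  assert (Hd2 : 314 / 100 * (2 * A - 315 / 100) <= A ^ 2 - x ^ 2) by (rewrite Hd; apply Rmult_le_compat; lra).
  assert (Hlow : (A ^ 2 - x ^ 2) * (A ^ 2 * W) <=
    (A ^ 4 - x ^ 4) * j ^ 2 + (A ^ 2 - x ^ 2) * (A ^ 2 * S) ^ 2).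
  { replace ((A ^ 4 - x ^ 4) * j ^ 2 + (A ^ 2 - x ^ 2) * (A ^ 2 * S) ^ 2 - 0) with
      ((A ^ 2 - x ^ 2) * ((A ^ 2 + x ^ 2) * j ^ 2 + A ^ 4 * S ^ 2)) by ring.
    replace ((A ^ 4 - x ^ 4) * j ^ 2 + (A ^ 2 - x ^ 2) * (A ^ 2 * S) ^ 2) with
      ((A ^ 2 - x ^ 2) * (A ^ 2 * W + x ^ 2 * j ^ 2)) by (unfold W; ring).
    apply Rmult_le_compat_l; [nra |].
    assert (0 <= x ^ 2 * j ^ 2) by (apply Rmult_le_pos; apply pow2_ge_0). lra. }
  assert (Hup : (A ^ 2 * S ^ 2 + 2 * j ^ 2) ^ 2 <= 4 * (A ^ 2 + A + 1) * W).
  { assert (0 <= A ^ 2 * S ^ 2) by (apply Rmult_le_pos; apply pow2_ge_0).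
    generalize (pow2_ge_0 j); intros.
    apply Rle_trans with ((2 * W) ^ 2); [apply pow_incr; unfold W; lra | nra]. }
  assert (Hpoly : 4 * (A ^ 2 + A + 1) < 314 / 100 * (2 * A - 315 / 100) * A ^ 2).
  { assert (44 / 10 * A <= A * A) by (apply Rmult_le_compat_r; lra).
    assert (44 / 10 * A ^ 2 <= A * A ^ 2) by (apply Rmult_le_compat_r; [apply pow2_ge_0 | lra]). lra. }
  assert (4 * (A ^ 2 + A + 1) * W < (A ^ 2 - x ^ 2) * (A ^ 2 * W)).
  { apply Rlt_le_trans with (314 / 100 * (2 * A - 315 / 100) * A ^ 2 * W).
    - apply Rmult_lt_compat_r; lra.
    - rewrite Rmult_assoc. apply Rmult_le_compat_r; [| lra].
      apply Rmult_le_pos; [apply pow2_ge_0 | lra]. }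
  lra.
Qed.

(* The curve (kf, qf) spirals outwards, so its earlier part stays on one side of each of its tangents. *)
Lemma spiral A x : 44 / 10 <= A -> 0 <= x < A ->
  0 < jf A * (qf A - qf x) - A ^ 2 * sin A * (kf A - kf x).
Proof.
  intros HA Hx. generalize PI_bounds; intros HP.
  cut (supp (jf A) (A ^ 2 * sin A) x < supp (jf A) (A ^ 2 * sin A) A).
  { rewrite !supp_eq; lra. }
  assert (HN := supp_at_pos A ltac:(lra)). assert (Hamp := spiral_amp A HA).
  destruct (Rle_lt_dec x (A - PI)) as [Hl | Hl].
  { apply supp_lt with (y := A - PI); auto; lra. }
  destruct (Req_dec (jf A) 0) as [H0 | H0].
  - rewrite H0 in *.
    apply derive_pos_lt with (df := fun x => 0 * (x ^ 2 * sin x) - (A ^ 2 * sin A) * jf x); [lra | |].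
    + intros y _; apply is_derive_supp.
    + intros y Hy. rewrite Rmult_0_l.
      assert (Hb := jf_before_zero A (A - y) H0 ltac:(lra) ltac:(lra)).
      replace (A - (A - y)) with y in Hb by ring.
      assert (Es : sin A = A * cos A) by (unfold jf in H0; lra). rewrite Es.
      assert (0 < A ^ 3) by (apply pow_lt; lra). nra.
  - assert (Hv : 0 <= Rabs (jf A) / A) by (apply Rdiv_le_0_compat; [apply Rabs_pos | lra]).
    generalize (supp_max A 0 (A - PI) ltac:(lra) (Rle_refl 0) H0 ltac:(lra)).
    cbv zeta. rewrite Rmult_0_l, Rminus_0_r. intros H; apply H; auto; [| lra].
    apply supp_lt with (y := A - PI); auto; lra.
Qed.

(** * The potential and the criterion for adverse amplitudes *)

Definition pot (lam x : R) : R := x ^ 2 / 2 + lam * (1 - cos x).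
Definition dpot (lam x : R) : R := x + lam * sin x.
Lemma is_derive_pot lam x : is_derive (pot lam) x (dpot lam x).
Proof. unfold pot, dpot; auto_derive; [exact I | field]. Qed.

Lemma supp_diff A c x : let j0 := jf A in let e := A ^ 2 * sin A - c * j0 in
  supp j0 e A - supp j0 e x =
    j0 * (qf A - qf x) - A ^ 2 * sin A * (kf A - kf x) + c * (j0 * (kf A - kf x)).
Proof. cbv zeta. rewrite !supp_eq. ring. Qed.

(* Under the dilation x = A X, the second A-derivative of the integrand of the period is, up to a multiple of
   the first one and a positive factor, lam * bracket; the coefficient c is free where T' = 0. *)
Definition bracket (lam A c x : R) : R :=
  qf A - qf x - c * (kf A - kf x) + 3 / 2 * lam * (kf A - kf x) ^ 2 / (pot lam A - pot lam x).

(** The quadratic term is at most [3/2 |lam| q |j K|] whenever [|K| <= q D]. Where j K >= 0, tilting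
    the tangent by [3/2 k2 |lam|] absorbs it. Where j K < 0 the tilt itself also costs
    [3/2 k2 |lam| |j K|], and the curve must stay on its side of a tangent tilted by the sum; hence
    [cI] and [cII]. Before the last half turn a better constant [kap] may be available, and then a
    smaller tilt is enough. *)
Lemma adverse_core lam A k2 kap cI cII :
  44 / 10 <= A -> lam * jf A < 0 ->
  (forall x, 0 <= x < A -> 0 < pot lam A - pot lam x) ->
  (forall x, 0 <= x < A -> Rabs (kf A - kf x) <= k2 * (pot lam A - pot lam x)) ->
  (forall x, 0 <= x <= A - PI -> jf A * (kf A - kf x) < 0 ->
     Rabs (kf A - kf x) <= kap * (pot lam A - pot lam x)) ->
  3 / 2 * Rabs lam * (k2 + k2) <= cI -> 3 / 2 * Rabs lam * (k2 + kap) <= cII ->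
  (forall x, A - PI <= x < A ->
     supp (jf A) (A ^ 2 * sin A - cI * jf A) x < supp (jf A) (A ^ 2 * sin A - cI * jf A) A) ->
  (forall x, 0 <= x <= A - PI ->
     supp (jf A) (A ^ 2 * sin A - cII * jf A) x < supp (jf A) (A ^ 2 * sin A - cII * jf A) A) ->
  exists c', forall x, 0 <= x < A ->
    0 < jf A * bracket lam A c' x.
Proof.
  intros HA Hl HD HK HK2 HcI HcII GI GII.
  assert (Hj : jf A <> 0) by (intros H; rewrite H in Hl; lra).
  exists (A ^ 2 * sin A / jf A - 3 / 2 * k2 * Rabs lam). intros x Hx. unfold bracket.
  specialize (HD x Hx). specialize (HK x Hx).
  generalize (spiral A x HA Hx); intros Hsp.
  assert (Hlj : lam * jf A = - (Rabs lam * Rabs (jf A))) by (rewrite <- Rabs_mult, Rabs_left; lra).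
  specialize (GI x). specialize (GII x). specialize (HK2 x).
  assert (dI := supp_diff A cI x). assert (dII := supp_diff A cII x). cbv zeta in dI, dII.
  set (K := kf A - kf x) in *. set (D := pot lam A - pot lam x) in *. set (dQ := qf A - qf x) in *.
  set (mu := Rabs lam) in *. set (j := jf A) in *.
  assert (Hmu : 0 <= mu) by apply Rabs_pos.
  replace (j * (dQ - (A ^ 2 * sin A / j - 3 / 2 * k2 * mu) * K + 3 / 2 * lam * K ^ 2 / D)) with
    (j * dQ - A ^ 2 * sin A * K + 3 / 2 * k2 * mu * (j * K) + 3 / 2 * (lam * j) * (K ^ 2 / D))
    by (field; split; lra).
  rewrite Hlj.
  assert (Habs : Rabs j * Rabs K = Rabs (j * K)) by (symmetry; apply Rabs_mult).
  assert (HKK : Rabs K * Rabs K = K ^ 2) by (rewrite <- Rabs_mult, Rabs_right; [ring | nra]).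
  assert (Hbound : forall q, Rabs K <= q * D ->
     3 / 2 * mu * Rabs j * (K ^ 2 / D) <= 3 / 2 * mu * q * Rabs (j * K)).
  { intros q Hq. rewrite <- Habs.
    assert (K ^ 2 / D <= q * Rabs K).
    { apply Rmult_le_reg_r with D; [lra |]. unfold Rdiv. rewrite Rmult_assoc, Rinv_l by lra.
      rewrite <- HKK. generalize (Rabs_pos K). nra. }
    assert (0 <= 3 / 2 * mu * Rabs j) by (generalize (Rabs_pos j); intros; apply Rmult_le_pos; lra).
    replace (3 / 2 * mu * q * (Rabs j * Rabs K)) with (3 / 2 * mu * Rabs j * (q * Rabs K)) by ring.
    apply Rmult_le_compat_l; auto. }
  destruct (Rle_lt_dec 0 (j * K)) as [Hp | Hn].
  - generalize (Hbound k2 HK). rewrite (Rabs_right (j * K)) by lra. lra.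
  - rewrite (Rabs_left (j * K)) in Hbound by lra.
    destruct (Rle_lt_dec x (A - PI)) as [Hx1 | Hx1].
    + specialize (HK2 ltac:(lra) Hn). generalize (Hbound kap HK2); intros.
      specialize (GII ltac:(lra)).
      assert (cII * (j * K) <= 3 / 2 * mu * (k2 + kap) * (j * K)) by nra. lra.
    + generalize (Hbound k2 HK); intros. specialize (GI ltac:(lra)).
      assert (cI * (j * K) <= 3 / 2 * mu * (k2 + k2) * (j * K)) by nra. lra.
Qed.

(* The numbers v = |j(A)|/A and p = +-sin A, normalised to the sign of j(A). *)
Lemma normal_form A : 0 < A -> jf A <> 0 -> exists v p, 0 < v /\ Rabs (jf A) = A * v /\
  jf A ^ 2 = A ^ 2 * v ^ 2 /\ jf A * sin A = A * v * p /\ sin A ^ 2 = p ^ 2 /\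
  p ^ 2 + (p / A - v) ^ 2 = 1 /\ jf A * cos A = A * v * (p / A - v).
Proof.
  intros HA Hj. generalize (sin2_cos2' A); intros E.
  assert (Ec : cos A = (sin A - jf A) / A) by (unfold jf; field; lra).
  destruct (Rlt_le_dec (jf A) 0) as [H | H].
  - exists (- jf A / A), (- sin A). rewrite Rabs_left by lra.
    repeat split; try (field; lra); try ring.
    + apply Rdiv_lt_0_compat; lra.
    + rewrite <- E. rewrite Ec. field; lra.
    + rewrite Ec. field; lra.
  - exists (jf A / A), (sin A). rewrite Rabs_right by lra.
    repeat split; try (field; lra); try ring.
    + apply Rdiv_lt_0_compat; lra.
    + rewrite <- E. rewrite Ec. field; lra.
    + rewrite Ec. field; lra.
Qed.

(** For [supp = a cos A + b sin A] the defect from a^2 + b^2 is (a sin A - b cos A)^2, and this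
    combination simplifies because [2 sin A - A cos A = sin A + jf A]. *)
Lemma supp_at_sq A c : let j0 := jf A in let e := A ^ 2 * sin A - c * j0 in
  supp j0 e A ^ 2 = supp_amp j0 e A - (A ^ 2 * sin A ^ 2 - c * (j0 * sin A) - (c - 2) * j0 ^ 2) ^ 2.
Proof.
  intros j0 e. unfold supp, supp_amp, e, j0, jf.
  generalize (sin2_cos2' A). set (S := sin A). set (C := cos A). intros E.
  set (j := S - A * C). set (e' := A ^ 2 * S - c * j).
  replace (A ^ 4 * j ^ 2 + A ^ 2 * e' ^ 2 + 4 * (j + e') ^ 2)
    with ((A ^ 4 * j ^ 2 + A ^ 2 * e' ^ 2 + 4 * (j + e') ^ 2) * (S ^ 2 + C ^ 2)) by (rewrite E; ring).
  unfold e', j. ring.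
Qed.

Lemma supp_amp_lt A c x v p : 0 < A -> jf A ^ 2 = A ^ 2 * v ^ 2 -> jf A * sin A = A * v * p ->
  sin A ^ 2 = p ^ 2 ->
  (A * (p ^ 2 - (c - 2) * v ^ 2) - c * v * p) ^ 2 < (A ^ 2 - x ^ 2) * (v ^ 2 * (A ^ 2 + x ^ 2) + (A * p - c * v) ^ 2) ->
  supp_amp (jf A) (A ^ 2 * sin A - c * jf A) x < supp (jf A) (A ^ 2 * sin A - c * jf A) A ^ 2.
Proof.
  intros HA H1 H2 H3 H. rewrite (supp_at_sq A c). cbv zeta. rewrite H1, H2, H3.
  unfold supp_amp.
  assert (He : (A ^ 2 * sin A - c * jf A) ^ 2 = A ^ 2 * (A * p - c * v) ^ 2).
  { replace ((A ^ 2 * sin A - c * jf A) ^ 2) with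
      (A ^ 4 * sin A ^ 2 - 2 * c * A ^ 2 * (jf A * sin A) + c ^ 2 * jf A ^ 2) by ring.
    rewrite H1, H2, H3. ring. }
  rewrite H1, He.
  assert (HA2 : 0 < A ^ 2) by (apply pow_lt; lra).
  apply (Rmult_lt_compat_l (A ^ 2)) in H; [| lra].
  set (u := jf A + (A ^ 2 * sin A - c * jf A)). set (q := A * p - c * v) in *.
  assert (Eq : (A ^ 2 * p ^ 2 - c * (A * v * p) - (c - 2) * (A ^ 2 * v ^ 2)) ^ 2 =
     A ^ 2 * (A * (p ^ 2 - (c - 2) * v ^ 2) - c * v * p) ^ 2) by ring.
  rewrite Eq.
  replace (A ^ 2 * ((A ^ 2 - x ^ 2) * (v ^ 2 * (A ^ 2 + x ^ 2) + q ^ 2))) with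
    (A ^ 4 * (A ^ 2 * v ^ 2) + A ^ 2 * (A ^ 2 * q ^ 2) - (x ^ 4 * (A ^ 2 * v ^ 2) + x ^ 2 * (A ^ 2 * q ^ 2))) in H by ring.
  lra.
Qed.

Lemma sin_cos_normal A v p : 0 < A -> jf A * sin A = A * v * p -> sin A ^ 2 = p ^ 2 ->
  sin A * cos A = p ^ 2 / A - v * p.
Proof.
  intros HA H2 H3. assert (Ec : cos A = (sin A - jf A) / A) by (unfold jf; field; lra).
  rewrite Ec. replace (sin A * ((sin A - jf A) / A)) with ((sin A ^ 2 - jf A * sin A) / A) by (field; lra).
  rewrite H2, H3. field; lra.
Qed.

Lemma normal_prod A v p : 1 <= A -> p ^ 2 + (p / A - v) ^ 2 = 1 -> v * p <= 1 / 2 + p ^ 2 / A /\ p ^ 2 <= 1.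
Proof.
  intros HA H. assert (0 < / A) by (apply Rinv_0_lt_compat; lra).
  unfold Rdiv in *. generalize (pow2_ge_0 (p - (v - p * / A))) (pow2_ge_0 (p * / A - v)); intros. split; nra.
Qed.

Lemma supp_at_pos_c A c v p : 1 <= A -> jf A ^ 2 = A ^ 2 * v ^ 2 -> jf A * sin A = A * v * p ->
  sin A ^ 2 = p ^ 2 -> jf A * cos A = A * v * (p / A - v) -> p ^ 2 + (p / A - v) ^ 2 = 1 ->
  1 <= c -> (c - 1) * (A ^ 2 / 2 + A) + 2 * A + 2 * (2 + 2 * c) < A ^ 3 ->
  0 < supp (jf A) (A ^ 2 * sin A - c * jf A) A.
Proof.
  intros HA H1 H2 H3 H4 H5 Hc HcA.
  assert (E := supp_at A c). cbv zeta in E. rewrite E. clear E.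
  replace (c * jf A * (2 * cos A + A * sin A)) with (2 * c * (jf A * cos A) + c * A * (jf A * sin A)) by ring.
  rewrite H2, H4.
  generalize (sin2_cos2' A); intros E2.
  rewrite (sin_cos_normal A v p) by (auto; lra).
  replace (cos A ^ 2) with (1 - sin A ^ 2) by lra. rewrite H3.
  destruct (normal_prod A v p HA H5) as [Hvp Hp1].
  replace (A ^ 3 + 2 * A * (p ^ 2 - (1 - p ^ 2)) + (2 - A ^ 2) * (p ^ 2 / A - v * p) -
    (2 * c * (A * v * (p / A - v)) + c * A * (A * v * p))) with
    (A ^ 3 - (c - 1) * (A ^ 2 * (v * p)) + 3 * A * p ^ 2 - 2 * A + 2 * p ^ 2 / A
      - (2 + 2 * c) * (v * p) + 2 * c * A * v ^ 2) by (field; lra).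
  assert (0 <= 2 * p ^ 2 / A) by (apply Rdiv_le_0_compat; [generalize (pow2_ge_0 p); lra | lra]).
  assert (0 <= 3 * A * p ^ 2) by (apply Rmult_le_pos; [lra | apply pow2_ge_0]).
  assert (0 <= 2 * c * A * v ^ 2) by (apply Rmult_le_pos; [nra | apply pow2_ge_0]).
  assert (HA2 : 1 <= A ^ 2) by nra.
  destruct (Rle_lt_dec (v * p) 0) as [Hs | Hs].
  - assert (Hneg : forall a b, 0 <= a -> b <= 0 -> a * b <= 0) by (intros; nra).
    assert ((c - 1) * (A ^ 2 * (v * p)) <= 0) by (apply Hneg; [lra | apply Hneg; lra]).
    assert ((2 + 2 * c) * (v * p) <= 0) by (apply Hneg; lra).
    assert (0 <= (c - 1) * (A ^ 2 / 2 + A)) by (apply Rmult_le_pos; lra). lra.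
  - assert (Hq : A ^ 2 * (v * p) <= A ^ 2 / 2 + A * p ^ 2).
    { apply Rmult_le_compat_l with (r := A ^ 2) in Hvp; [| lra].
      replace (A ^ 2 * (1 / 2 + p ^ 2 / A)) with (A ^ 2 / 2 + A * p ^ 2) in Hvp by (field; lra). lra. }
    assert (A * p ^ 2 <= A) by nra.
    assert (p ^ 2 / A <= 1) by (apply Rmult_le_reg_r with A; [lra|]; unfold Rdiv; rewrite Rmult_assoc, Rinv_l; lra).
    assert (v * p <= 2) by lra.
    assert ((c - 1) * (A ^ 2 * (v * p)) <= (c - 1) * (A ^ 2 / 2 + A)) by (apply Rmult_le_compat_l; lra).
    assert ((2 + 2 * c) * (v * p) <= (2 + 2 * c) * 2) by (apply Rmult_le_compat_l; lra). lra.
Qed.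

(** A half turn only changes the signs of sine and cosine, so the gap becomes a quadratic form in
    (v, p), whose positivity is a discriminant condition. *)
Lemma supp_half_turn A c v p : 1 <= A -> jf A ^ 2 = A ^ 2 * v ^ 2 -> jf A * sin A = A * v * p ->
  sin A ^ 2 = p ^ 2 -> jf A * cos A = A * v * (p / A - v) ->
  let x := A - PI in let e := A ^ 2 * sin A - c * jf A in
  supp (jf A) e A - supp (jf A) e x =
    (A * (A ^ 2 + x ^ 2 - 4) + 4 * c * A) * v ^ 2
    - (A ^ 2 + x ^ 2 - 4 + 4 * A ^ 2 + 4 * c + (c - 2) * A * (A + x)) * (v * p)
    + (4 * A + (A + x) * A ^ 2) * p ^ 2.
Proof.
  intros HA H1 H2 H3 H4 x e.
  assert (Hsc := sin_cos_normal A v p ltac:(lra) H2 H3).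
  assert (Ex : supp (jf A) e x = - ((jf A * (2 - x ^ 2) + 2 * e) * cos A + x * (2 * jf A + e) * sin A)).
  { unfold supp. replace (cos x) with (- cos A); [replace (sin x) with (- sin A); [ring |] |];
     unfold x, Rminus; [rewrite sin_plus | rewrite cos_plus]; rewrite sin_neg, cos_neg, sin_PI, cos_PI; ring. }
  rewrite Ex. unfold supp, e.
  replace (_ - - _) with
   ((4 - A ^ 2 - x ^ 2) * (jf A * cos A) + 4 * A ^ 2 * (sin A * cos A) - 4 * c * (jf A * cos A)
    + (A + x) * (2 * (jf A * sin A) + A ^ 2 * sin A ^ 2 - c * (jf A * sin A))) by ring.
  rewrite H2, H3, H4, Hsc. field; lra.
Qed.

Lemma sq_lt_of_abs u m B : - m <= u <= m -> m ^ 2 < B -> u ^ 2 < B.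
Proof. intros H1 H2. assert (u ^ 2 <= m ^ 2) by nra. lra. Qed.

(** Worst case over a cell of (v, p): [al] bounds |p^2 - (c - 2) v^2| and [w] bounds v p. *)
Lemma tangent_amp_case c v0 v1 s0 s1 w al om A0 A v p x :
  2 <= c -> 0 <= v0 <= v -> v <= v1 <= 2 -> 0 <= s0 <= p -> p <= s1 -> v * p <= w ->
  8 <= A0 <= A -> x = A - PI - v -> 0 <= om ->
  (c - 2) * v1 ^ 2 - s0 ^ 2 <= al -> s1 ^ 2 - (c - 2) * v0 ^ 2 <= al ->
  (A * al + c * w) ^ 2 < (3.1415 + v0) * (2 * A - (3.1415 + v0)) *
      (v0 ^ 2 * (A ^ 2 + (A - 3.1416 - v1) ^ 2) + (2 * om * (c * v0 - A * s1) - om ^ 2)) ->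
  (A * (p ^ 2 - (c - 2) * v ^ 2) - c * v * p) ^ 2 <
    (A ^ 2 - x ^ 2) * (v ^ 2 * (A ^ 2 + x ^ 2) + (A * p - c * v) ^ 2).
Proof.
  intros Hc Hv0 Hv1 Hp0 Hp1 Hw HA Hx Hom Ha1 Ha2 Hnum. generalize PI_bounds; intros HP.
  assert (Hvv : v0 ^ 2 <= v ^ 2 <= v1 ^ 2) by (split; apply pow_incr; lra).
  assert (Hpp : s0 ^ 2 <= p ^ 2 <= s1 ^ 2) by (split; apply pow_incr; lra).
  assert (Hvp : 0 <= v * p) by (apply Rmult_le_pos; lra).
  apply sq_lt_of_abs with (A * al + c * w).
  - assert (c * (v * p) <= c * w) by (apply Rmult_le_compat_l; lra).
    assert (0 <= c * (v * p)) by (apply Rmult_le_pos; lra).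
    assert ((c - 2) * v0 ^ 2 <= (c - 2) * v ^ 2 <= (c - 2) * v1 ^ 2)
      by (split; apply Rmult_le_compat_l; lra).
    assert (A * - al <= A * (p ^ 2 - (c - 2) * v ^ 2) <= A * al)
      by (split; apply Rmult_le_compat_l; lra).
    replace (c * v * p) with (c * (v * p)) by ring. lra.
  - eapply Rlt_le_trans; [exact Hnum |].
    assert (HP1 : (3.1415 + v0) * (2 * A - (3.1415 + v0)) <= A ^ 2 - x ^ 2).
    { rewrite Hx. replace (A ^ 2 - (A - PI - v) ^ 2) with ((PI + v) * (2 * A - (PI + v))) by ring.
      assert (0 <= (PI + v - (3.1415 + v0)) * (2 * A - (3.1415 + v0) - (PI + v))) by (apply Rmult_le_pos; lra). lra. }
    assert (HP0 : 0 <= (3.1415 + v0) * (2 * A - (3.1415 + v0))) by (apply Rmult_le_pos; lra).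
    assert (HB : v0 ^ 2 * (A ^ 2 + (A - 3.1416 - v1) ^ 2) + (2 * om * (c * v0 - A * s1) - om ^ 2)
       <= v ^ 2 * (A ^ 2 + x ^ 2) + (A * p - c * v) ^ 2).
    { assert ((A - 3.1416 - v1) ^ 2 <= x ^ 2) by (apply pow_incr; rewrite Hx; lra).
      assert (v0 ^ 2 * (A ^ 2 + (A - 3.1416 - v1) ^ 2) <= v ^ 2 * (A ^ 2 + x ^ 2)).
      { apply Rmult_le_compat; try apply pow2_ge_0; try lra.
        generalize (pow2_ge_0 A) (pow2_ge_0 (A - 3.1416 - v1)); lra. }
      assert (c * v0 - A * s1 <= c * v - A * p).
      { assert (c * v0 <= c * v) by (apply Rmult_le_compat_l; lra).
        assert (A * p <= A * s1) by (apply Rmult_le_compat_l; lra). lra. }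
      assert (om * (c * v0 - A * s1) <= om * (c * v - A * p)) by (apply Rmult_le_compat_l; lra).
      generalize (pow2_ge_0 (c * v - A * p - om)).
      replace ((A * p - c * v) ^ 2) with ((c * v - A * p) ^ 2) by ring.
      set (d := c * v - A * p) in *. intros. nra. }
    assert (0 <= v ^ 2 * (A ^ 2 + x ^ 2) + (A * p - c * v) ^ 2).
    { generalize (pow2_ge_0 (A * p - c * v)) (pow2_ge_0 A) (pow2_ge_0 x) (pow2_ge_0 v); intros.
      assert (0 <= v ^ 2 * (A ^ 2 + x ^ 2)) by (apply Rmult_le_pos; lra). lra. }
    eapply Rle_trans; [apply Rmult_le_compat_l; [exact HP0 | exact HB] |].
    apply Rmult_le_compat_r; auto.
Qed.

Lemma normal_upper A A0 v v0 p s1 : 8 <= A0 <= A -> 1 / A0 <= v0 <= v -> 0 <= p ->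
  p ^ 2 + (p / A - v) ^ 2 = 1 -> 0 < s1 -> 1 <= s1 ^ 2 + (v0 - s1 / A0) ^ 2 -> v0 / A0 < s1 ->
  p <= s1.
Proof.
  intros HA Hv Hp H Hs Hn Hs2. apply Rnot_lt_le; intros Hc.
  assert (Hi0 : 0 < / A0 <= / 8) by (split; [apply Rinv_0_lt_compat; lra | apply Rinv_le_contravar; lra]).
  assert (Hi : 0 < / A <= / A0) by (split; [apply Rinv_0_lt_compat; lra | apply Rinv_le_contravar; lra]).
  unfold Rdiv in *. assert (p ^ 2 <= 1) by (generalize (pow2_ge_0 (p * / A - v)); lra). assert (p <= 1) by nra.
  assert (Hq : p * / A <= p * / A0) by (apply Rmult_le_compat_l; lra).
  set (i := / A0) in *.
  assert (p * i <= 1 * i) by (apply Rmult_le_compat_r; lra).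
  assert (Hsq : (v0 - p * i) ^ 2 <= (p * / A - v) ^ 2).
  { replace ((p * / A - v) ^ 2) with ((v - p * / A) ^ 2) by ring. apply pow_incr. lra. }
  assert (s1 ^ 2 + (v0 - s1 * i) ^ 2 < p ^ 2 + (v0 - p * i) ^ 2); [| lra].
  (* difference = (p - s1) ((p + s1)(1 + i^2) - 2 v0 i) *)
  assert (0 < (p - s1) * ((p + s1) * (1 + i ^ 2) - 2 * (v0 * i))).
  { apply Rmult_lt_0_compat; [lra |]. assert (0 <= (p + s1) * i ^ 2) by (apply Rmult_le_pos; [lra | apply pow2_ge_0]). lra. }
  lra.
Qed.

Lemma normal_lower A v p v1 s0 : 8 <= A -> 0 <= v <= v1 -> 1 / 8 <= v1 -> 0 <= p ->
  p ^ 2 + (p / A - v) ^ 2 = 1 -> 0 <= s0 -> s0 ^ 2 + v1 ^ 2 <= 1 -> s0 <= p.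
Proof.
  intros HA Hv Hv1 Hp H Hs Hn.
  assert (Hi : 0 < / A <= / 8) by (split; [apply Rinv_0_lt_compat; lra | apply Rinv_le_contravar; lra]).
  unfold Rdiv in *. assert (p ^ 2 <= 1) by (generalize (pow2_ge_0 (p * / A - v)); lra). assert (p <= 1) by nra.
  assert (0 <= p * / A <= 1 * / 8) by (split; [apply Rmult_le_pos; lra | apply Rmult_le_compat; lra]).
  assert ((p * / A - v) ^ 2 <= v1 ^ 2) by nra.
  apply Rnot_lt_le; intros Hc. nra.
Qed.

Lemma normal_v A v p : 1 <= A -> 0 <= v -> p ^ 2 + (p / A - v) ^ 2 = 1 -> v ^ 2 <= 1 + / A ^ 2.
Proof.
  intros HA Hv H. assert (Hi : 0 < / A) by (apply Rinv_0_lt_compat; lra).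
  unfold Rdiv in H. replace (/ A ^ 2) with ((/ A) ^ 2) by (field; lra). set (i := / A) in *.
  assert (v = - (p * i - v) + i * p) by ring.
  set (q := p * i - v) in *. assert (v ^ 2 = (i * p - q) ^ 2) by (rewrite H0; ring).
  rewrite H1. generalize (pow2_ge_0 (p + i * q)). nra.
Qed.

(** For p < 0 the left-hand side is the square of a difference of two nonnegative terms, hence at
    most the larger of their squares, and each is dominated separately. *)
Lemma tangent_amp_neg c A v p x : 2 <= c -> 0 < v -> p < 0 -> p ^ 2 <= 1 -> 8 <= A -> 0 <= x -> 1 < A ^ 2 - x ^ 2 ->
  A ^ 2 * (c - 2) ^ 2 * v ^ 2 < (A ^ 2 - x ^ 2) * (A ^ 2 + x ^ 2 + c ^ 2) ->
  (A * (p ^ 2 - (c - 2) * v ^ 2) - c * v * p) ^ 2 <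
    (A ^ 2 - x ^ 2) * (v ^ 2 * (A ^ 2 + x ^ 2) + (A * p - c * v) ^ 2).
Proof.
  intros Hc Hv Hp Hp1 HA Hx HP Hn. set (P := A ^ 2 - x ^ 2) in *.
  set (q := - p). assert (Hq : 0 < q <= 1) by (unfold q; split; nra).
  replace p with (- q) by (unfold q; ring).
  set (m := A * q + c * v). assert (Hm : 0 < m) by (unfold m; nra).
  replace (A * ((- q) ^ 2 - (c - 2) * v ^ 2) - c * v * - q) with (q * m - A * (c - 2) * v ^ 2) by (unfold m; ring).
  replace ((A * - q - c * v) ^ 2) with (m ^ 2) by (unfold m; ring).
  assert (Hv2 : 0 < v ^ 2) by (apply pow_lt; lra).
  assert (HA2 : 0 < A ^ 2) by (apply pow_lt; lra). generalize (pow2_ge_0 x); intros Hx2.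
  assert (0 <= A * (c - 2) * v ^ 2) by (repeat apply Rmult_le_pos; lra).
  assert (0 < q * m <= m) by (split; [apply Rmult_lt_0_compat; lra | nra]).
  assert (Hm2 : 0 < m ^ 2) by (apply pow_lt; lra).
  destruct (Rle_lt_dec 0 (q * m - A * (c - 2) * v ^ 2)) as [Hs | Hs].
  - assert ((q * m - A * (c - 2) * v ^ 2) ^ 2 <= m ^ 2) by (apply pow_incr; lra).
    assert (0 < P * (v ^ 2 * (A ^ 2 + x ^ 2))) by (repeat apply Rmult_lt_0_compat; lra). nra.
  - assert ((q * m - A * (c - 2) * v ^ 2) ^ 2 <= (A * (c - 2) * v ^ 2) ^ 2).
    { replace ((q * m - A * (c - 2) * v ^ 2) ^ 2) with ((A * (c - 2) * v ^ 2 - q * m) ^ 2) by ring.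
      apply pow_incr; lra. }
    assert ((c * v) ^ 2 <= m ^ 2) by (apply pow_incr; unfold m; nra).
    assert (v ^ 2 * (A ^ 2 * (c - 2) ^ 2 * v ^ 2) < v ^ 2 * (P * (A ^ 2 + x ^ 2 + c ^ 2)))
      by (apply Rmult_lt_compat_l; lra).
    assert (P * (c * v) ^ 2 <= P * m ^ 2) by (apply Rmult_le_compat_l; lra). nra.
Qed.

(* Tilts for which both the tangency estimate and the comparison of kf with G close, depending on v = |j(A)|/A. *)
Definition tilt (v : R) : R :=
  if Rle_dec v 0.6 then 14.95 else if Rle_dec v 0.78 then 13.6 else 12.9.

(** The abscissa A - PI - v is the point from which [supp_max] takes over, v being the margin |jf A|
    / A. The condition [10.9 + v <= A] expresses that [jf], still positive at 10.9, needs at least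
    the length v to reach [jf A]. *)
Lemma tangent_amp_pos A v p : 10.9 + v <= A -> 0 < v -> p ^ 2 + (p / A - v) ^ 2 = 1 ->
  let c := tilt v in let x := A - PI - v in
  (A * (p ^ 2 - (c - 2) * v ^ 2) - c * v * p) ^ 2 <
    (A ^ 2 - x ^ 2) * (v ^ 2 * (A ^ 2 + x ^ 2) + (A * p - c * v) ^ 2).
Proof.
  intros HA Hv H c x. generalize PI_bounds; intros HP.
  assert (Hv1 : v < 1.005).
  { generalize (normal_v A v p ltac:(lra) ltac:(lra) H). intros Hv2.
    assert (/ A ^ 2 <= / (10.9 ^ 2)) by (apply Rinv_le_contravar; [lra | apply pow_incr; lra]).
    apply Rnot_le_lt; intros Hc. assert (1.005 ^ 2 <= v ^ 2) by (apply pow_incr; lra). lra. }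
  assert (Hp1 : p ^ 2 <= 1) by (generalize (pow2_ge_0 (p / A - v)); lra).
  assert (Hpv : v * p <= 1 / 2 + p ^ 2 / A) by (apply normal_prod; auto; lra).
  destruct (Rlt_le_dec p 0) as [Hp | Hp].
  { assert (Hx : A - 3.1416 - v <= x <= A - 3.1415 - v) by (unfold x; lra).
    assert (HPP : 3.1415 * (2 * A - 3.1415) <= A ^ 2 - x ^ 2).
    { replace (A ^ 2 - x ^ 2) with ((A - x) * (A + x)) by ring.
      replace (2 * A - 3.1415) with (A + (A - 3.1415)) by ring.
      assert (x <= A - 3.1415) by lra.
      replace (A - x) with (3.1415 + (A - 3.1415 - x)) by ring.
      assert (Hd : 0 <= A - 3.1415 - x) by lra. set (d := A - 3.1415 - x) in *.
      replace (A + x) with (A + (A - 3.1415) - d) by (unfold d; ring).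
      assert (0 <= d * (A + (A - 3.1415) - d - 3.1415)) by (apply Rmult_le_pos; unfold d; lra). lra. }
    assert (Hc : 2 <= c) by (unfold c, tilt; destruct Rle_dec; [lra | destruct Rle_dec; lra]).
    apply tangent_amp_neg; auto; try lra.
    assert (Hx2 : 0 <= x ^ 2) by apply pow2_ge_0.
    apply Rle_lt_trans with (A ^ 2 * ((c - 2) ^ 2 * v ^ 2)); [lra |].
    apply Rlt_le_trans with (3.1415 * (2 * A - 3.1415) * (A ^ 2 + c ^ 2)).
    2: { apply Rmult_le_compat; try lra. generalize (pow2_ge_0 A) (pow2_ge_0 c); lra. }
    assert (Hcv : (c - 2) ^ 2 * v ^ 2 <= 0.36 * 12.95 ^ 2 /\ c = 14.95 \/ (c - 2) ^ 2 * v ^ 2 <= 1.02 * 11.6 ^ 2 /\ 12.9 <= c).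
    { assert (Hv2 : v ^ 2 <= 1.02) by (apply Rle_trans with (1.005 ^ 2); [apply pow_incr; lra | lra]).
      unfold c, tilt. destruct Rle_dec as [h | h]; [left | right; destruct Rle_dec]; (split; [| lra]).
      - assert (v ^ 2 <= 0.36) by (apply Rle_trans with (0.6 ^ 2); [apply pow_incr; lra | lra]). lra.
      - lra.
      - lra. }
    assert (HA2 : 118 <= A ^ 2) by (apply Rle_trans with (10.9 ^ 2); [lra | apply pow_incr; lra]).
    destruct Hcv as [[Hcv Ec] | [Hcv Ec]].
    - assert (Hk : A ^ 2 * ((c - 2) ^ 2 * v ^ 2) <= A ^ 2 * (0.36 * 12.95 ^ 2)) by (apply Rmult_le_compat_l; lra).
      assert (HA5 : A ^ 2 * (0.36 * 12.95 ^ 2) < 3.1415 * (2 * A - 3.1415) * (A ^ 2 + 14.95 ^ 2)).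
      { replace A with (10.9 + (A - 10.9)) by ring. set (t := A - 10.9). assert (Ht : 0 <= t) by (unfold t; lra).
        assert (0 <= t ^ 2) by apply pow2_ge_0. assert (0 <= t ^ 3) by (apply pow_le; lra). lra. }
      rewrite Ec in Hk |- *. lra.
    - assert (A ^ 2 * ((c - 2) ^ 2 * v ^ 2) <= A ^ 2 * (1.02 * 11.6 ^ 2)) by (apply Rmult_le_compat_l; lra).
      assert (12.9 ^ 2 <= c ^ 2) by (apply pow_incr; lra).
      assert (HA5 : A ^ 2 * 138 < 3.1415 * (2 * A - 3.1415) * (A ^ 2 + 12.9 ^ 2)).
      { replace A with (10.9 + (A - 10.9)) by ring. set (t := A - 10.9). assert (Ht : 0 <= t) by (unfold t; lra).
        assert (0 <= t ^ 2) by apply pow2_ge_0. assert (0 <= t ^ 3) by (apply pow_le; lra). lra. }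
      assert (3.1415 * (2 * A - 3.1415) * (A ^ 2 + 12.9 ^ 2) <= 3.1415 * (2 * A - 3.1415) * (A ^ 2 + c ^ 2))
       by (apply Rmult_le_compat_l; lra). lra. }
  assert (Hup : forall v0 s1, v0 <= v -> 0.1 <= v0 -> 0 < s1 -> 1 <= s1 ^ 2 + (v0 - s1 / (10.9 + v0)) ^ 2 ->
     v0 / (10.9 + v0) < s1 -> p <= s1).
  { intros v0 s1 H1 H2 H3 H4 H5. apply (normal_upper A (10.9 + v0) v v0 p s1); auto; try lra.
    split; [| lra]. apply Rmult_le_reg_r with (10.9 + v0); [lra |].
    unfold Rdiv; rewrite Rmult_assoc, Rinv_l by lra.
    assert (0.1 * 10.9 <= v0 * (10.9 + v0)) by (apply Rmult_le_compat; lra). lra. }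
  assert (Hlow : forall v1 s0, v <= v1 -> 0.2 <= v1 -> 0 <= s0 -> s0 ^ 2 + v1 ^ 2 <= 1 -> s0 <= p).
  { intros. apply (normal_lower A v p v1 s0); auto; lra. }
  assert (Hw : forall s1 w A0, p <= s1 -> 0 < A0 <= A -> 1 / 2 + s1 ^ 2 / A0 <= w -> v * p <= w).
  { intros s1 w A0 H1 H2 H3. eapply Rle_trans; [exact Hpv |]. eapply Rle_trans; [| exact H3].
    apply Rplus_le_compat_l. apply Rmult_le_compat; [apply pow2_ge_0 | left; apply Rinv_0_lt_compat; lra | apply pow_incr; lra | apply Rinv_le_contravar; lra]. }
  (* On a cell v0 <= v <= v1 the normalisation confines p to [s0, s1], leaving an inequality in A alone;
     om linearises the square (A p - c v)^2 from below. *)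
  assert (Hcase : forall c' v0 v1 s0 s1 w al om, c' = c -> v0 <= v -> v <= v1 <= 2 -> 0.1 <= v0 -> 0.2 <= v1 ->
     0 <= s0 -> s0 <= p ->
     0 < s1 -> 1 <= s1 ^ 2 + (v0 - s1 / (10.9 + v0)) ^ 2 -> v0 / (10.9 + v0) < s1 ->
     1 / 2 + s1 ^ 2 / (10.9 + v0) <= w -> 2 <= c' -> 0 <= om ->
     (c' - 2) * v1 ^ 2 - s0 ^ 2 <= al -> s1 ^ 2 - (c' - 2) * v0 ^ 2 <= al ->
     (forall t, 0 <= t -> (((10.9 + v0) + t) * al + c' * w) ^ 2 < (3.1415 + v0) * (2 * ((10.9 + v0) + t) - (3.1415 + v0)) *
      (v0 ^ 2 * (((10.9 + v0) + t) ^ 2 + (((10.9 + v0) + t) - 3.1416 - v1) ^ 2) + (2 * om * (c' * v0 - ((10.9 + v0) + t) * s1) - om ^ 2))) ->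
    (A * (p ^ 2 - (c - 2) * v ^ 2) - c * v * p) ^ 2 <
    (A ^ 2 - x ^ 2) * (v ^ 2 * (A ^ 2 + x ^ 2) + (A * p - c * v) ^ 2)).
  { intros c' v0 v1 s0 s1 w al om -> H1 H2 H3 H4 H5 H6 H7 H8 H9 H10 H11 H12 H13 H14 Hn.
    assert (p <= s1) by (apply (Hup v0); auto).
    apply (tangent_amp_case c v0 v1 s0 s1 w al om (10.9 + v0)); auto; try lra.
    - apply (Hw s1 w (10.9 + v0)); auto; lra.
    - specialize (Hn (A - (10.9 + v0)) ltac:(lra)).
      replace (10.9 + v0 + (A - (10.9 + v0))) with A in Hn by ring. exact Hn. }
  (* For small v the number p is close to 1, and the term (A p - c v)^2 suffices alone. *)
  destruct (Rle_lt_dec v 0.3) as [h0 | h0].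
  { assert (Ec : c = 14.95) by (unfold c, tilt; destruct Rle_dec; lra). rewrite Ec.
    assert (Hp0 : 0.9539 <= p) by (apply (Hlow 0.3); lra).
    assert (Hpu : p <= 1) by (apply Rnot_lt_le; intros Hc; assert (1 * 1 < p * p) by (apply Rmult_gt_0_lt_compat; lra); lra).
    assert (Hx : A - 3.1416 - v <= x <= A - 3.1415 - v) by (unfold x; lra).
    assert (HPP : 58 <= A ^ 2 - x ^ 2).
    { apply Rle_trans with (A ^ 2 - (A - 3.1415) ^ 2); [lra |].
      assert (x ^ 2 <= (A - 3.1415) ^ 2) by (apply pow_incr; lra). lra. }
    assert (Hvp : 0 <= v * p <= 0.3 * 1) by (split; [apply Rmult_le_pos; lra | apply Rmult_le_compat; lra]).
    apply sq_lt_of_abs with (A * 1 + 4.5).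
    - assert (0 <= v ^ 2 <= 0.09) by (split; [apply pow2_ge_0 | apply Rle_trans with (0.3 ^ 2); [apply pow_incr; lra | lra]]).
      assert (0.9 <= p ^ 2) by (apply Rle_trans with (0.9539 ^ 2); [lra | apply pow_incr; lra]).
      replace (14.95 * v * p) with (14.95 * (v * p)) by ring.
      assert (A * -1 <= A * (p ^ 2 - (14.95 - 2) * v ^ 2) <= A * 1) by (split; apply Rmult_le_compat_l; lra). lra.
    - assert (A * 0.9539 <= A * p) by (apply Rmult_le_compat_l; lra).
      assert (Hb : (A * 0.9539 - 4.485) ^ 2 <= (A * p - 14.95 * v) ^ 2) by (apply pow_incr; lra).
      assert (0 <= v ^ 2 * (A ^ 2 + x ^ 2)) by (apply Rmult_le_pos; [apply pow2_ge_0 | generalize (pow2_ge_0 A) (pow2_ge_0 x); lra]).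
      apply Rlt_le_trans with (58 * (A * 0.9539 - 4.485) ^ 2).
      + replace A with (10.9 + (A - 10.9)) by ring. set (t := A - 10.9). assert (Ht : 0 <= t) by (unfold t; lra).
        assert (0 <= t ^ 2) by apply pow2_ge_0. lra.
      + apply Rmult_le_compat; try lra; apply pow2_ge_0. }
  (** With t = A - (10.9 + v0) each remaining inequality is cubic in t, and linear in the monomials
      t, t^2, t^3, all nonnegative. *)
  Ltac fin := intros t Ht; assert (0 <= t ^ 2) by apply pow2_ge_0; assert (0 <= t ^ 3) by (apply pow_le; lra); lra.
  destruct (Rle_lt_dec v 0.45) as [h1 | h1].
  { assert (Ec : 14.95 = c) by (unfold c, tilt; destruct Rle_dec; lra).
    apply (Hcase 14.95 0.3 0.45 0.893 0.978 0.586 1.826 0); auto; try lra; [apply (Hlow 0.45); lra | fin]. }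
  destruct (Rle_lt_dec v 0.55) as [h2 | h2].
  { assert (Ec : 14.95 = c) by (unfold c, tilt; destruct Rle_dec; lra).
    apply (Hcase 14.95 0.45 0.55 0.835 0.931 0.577 3.2202 0); auto; try lra; [apply (Hlow 0.55); lra | fin]. }
  destruct (Rle_lt_dec v 0.6) as [h3 | h3].
  { assert (Ec : 14.95 = c) by (unfold c, tilt; destruct Rle_dec; lra).
    apply (Hcase 14.95 0.55 0.6 0.8 0.882 0.568 4.022 0); auto; try lra; [apply (Hlow 0.6); lra | fin]. }
  destruct (Rle_lt_dec v 0.78) as [h4 | h4].
  { assert (Ec : 13.6 = c) by (unfold c, tilt; destruct Rle_dec; [lra | destruct Rle_dec; lra]).
    destruct (Rle_lt_dec v 0.68) as [h5 | h5].
    { apply (Hcase 13.6 0.6 0.68 0.733 0.851 0.564 4.8266 0); auto; try lra; [apply (Hlow 0.68); lra | fin]. }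
    destruct (Rle_lt_dec v 0.74) as [h6 | h6].
    { apply (Hcase 13.6 0.68 0.74 0.672 0.792 0.5545 5.901 0); auto; try lra; [apply (Hlow 0.74); lra | fin]. }
    apply (Hcase 13.6 0.74 0.78 0.625 0.737 0.547 6.667 1.5); auto; try lra; [apply (Hlow 0.78); lra | fin]. }
  assert (Ec : 12.9 = c) by (unfold c, tilt; destruct Rle_dec; [lra | destruct Rle_dec; lra]).
  destruct (Rle_lt_dec v 0.83) as [h5 | h5].
  { apply (Hcase 12.9 0.78 0.83 0.557 0.694 0.5414 7.1989 2); auto; try lra; [apply (Hlow 0.83); lra | fin]. }
  destruct (Rle_lt_dec v 0.88) as [h6 | h6].
  { apply (Hcase 12.9 0.83 0.88 0.474 0.631 0.5341 8.2165 3); auto; try lra; [apply (Hlow 0.88); lra | fin]. }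
  destruct (Rle_lt_dec v 0.92) as [h7 | h7].
  { apply (Hcase 12.9 0.88 0.92 0.391 0.554 0.5262 9.074 5); auto; try lra; [apply (Hlow 0.92); lra | fin]. }
  destruct (Rle_lt_dec v 0.96) as [h8 | h8].
  { apply (Hcase 12.9 0.92 0.96 0.28 0.476 0.5193 9.968 6); auto; try lra; [apply (Hlow 0.96); lra | fin]. }
  apply (Hcase 12.9 0.96 1.005 0 0.372 0.5118 11.0103 8); auto; try lra; fin.
Qed.

(** * Comparison of k with G *)

Lemma trig_combo_le a b r x : 0 <= r -> a ^ 2 + b ^ 2 <= r ^ 2 -> - r <= a * sin x + b * cos x <= r.
Proof.
  intros Hr H. generalize (sin2_cos2' x); intros E.
  assert ((a * sin x + b * cos x) ^ 2 <= r ^ 2).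
  { assert (0 <= (a * cos x - b * sin x) ^ 2) by apply pow2_ge_0.
    replace ((a * sin x + b * cos x) ^ 2) with ((a ^ 2 + b ^ 2) * (sin x ^ 2 + cos x ^ 2) - (a * cos x - b * sin x) ^ 2) by ring.
    rewrite E. lra. }
  split; nra.
Qed.

Lemma kf_bound x r : 0 <= r -> 4 + x ^ 2 <= r ^ 2 -> - r <= kf x - 2 <= r.
Proof.
  intros Hr H. generalize (trig_combo_le (- x) (-2) r x Hr). unfold kf. intros Ht.
  replace (2 * (1 - cos x) - x * sin x - 2) with (- x * sin x + -2 * cos x) by ring. apply Ht. nra.
Qed.

Lemma jf_bound x r : 0 <= r -> 1 + x ^ 2 <= r ^ 2 -> - r <= jf x <= r.
Proof.
  intros Hr H. generalize (trig_combo_le 1 (- x) r x Hr). unfold jf. intros Ht.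
  replace (sin x - x * cos x) with (1 * sin x + - x * cos x) by ring. apply Ht. nra.
Qed.

Lemma kf_le_pot lam kap x A : x <= A ->
  (forall y, x <= y <= A -> Rabs (jf y) <= kap * dpot lam y) ->
  Rabs (kf A - kf x) <= kap * (pot lam A - pot lam x).
Proof.
  intros Hx H.
  assert (Hj : forall y, x <= y <= A -> - (kap * dpot lam y) <= jf y <= kap * dpot lam y).
  { intros y Hy. specialize (H y Hy). unfold Rabs in H. destruct Rcase_abs; lra. }
  assert (kap * pot lam x - kf x <= kap * pot lam A - kf A).
  { apply derive_nonneg_le with (f := fun y => kap * pot lam y - kf y) (df := fun y => kap * dpot lam y - jf y); auto.
    - intros y _. apply (is_derive_minus (fun y => kap * pot lam y) kf).
      + apply (is_derive_scal (pot lam)), is_derive_pot.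
      + apply is_derive_kf.
    - intros y Hy. specialize (Hj y Hy). lra. }
  assert (kap * pot lam x + kf x <= kap * pot lam A + kf A).
  { apply derive_nonneg_le with (f := fun y => kap * pot lam y + kf y) (df := fun y => kap * dpot lam y + jf y); auto.
    - intros y _. apply (is_derive_plus (fun y => kap * pot lam y) kf).
      + apply (is_derive_scal (pot lam)), is_derive_pot.
      + apply is_derive_kf.
    - intros y Hy. specialize (Hj y Hy). lra. }
  apply Rabs_le; lra.
Qed.

(** [kap * dpot lam y] plus or minus [jf y] is [kap * y] plus a combination of sin y and cos y whose
    squared amplitude is at most [(1 + kap * Rabs lam) ^ 2 + y ^ 2]. *)
Lemma jf_le_dpot lam kap y : 0 < y -> 0 <= kap -> (1 + kap * Rabs lam) ^ 2 + y ^ 2 <= kap ^ 2 * y ^ 2 ->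
  Rabs (jf y) <= kap * dpot lam y.
Proof.
  intros Hy Hk H. unfold dpot.
  assert (Hl : - Rabs lam <= lam <= Rabs lam) by (generalize (Rle_abs lam) (Rle_abs (- lam)); rewrite Rabs_Ropp; lra).
  assert (Hl2 : - (kap * Rabs lam) <= kap * lam <= kap * Rabs lam) by (split; nra).
  assert (H1 := trig_combo_le (1 - kap * lam) (- y) (kap * y) y ltac:(nra)).
  assert (H2 := trig_combo_le (1 + kap * lam) (- y) (kap * y) y ltac:(nra)).
  assert ((1 - kap * lam) ^ 2 <= (1 + kap * Rabs lam) ^ 2) by nra.
  assert ((1 + kap * lam) ^ 2 <= (1 + kap * Rabs lam) ^ 2) by nra.
  specialize (H1 ltac:(nra)). specialize (H2 ltac:(nra)).
  unfold jf. apply Rabs_le; split; nra.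
Qed.

(** Evaluated through the nearby multiple 7 PI / 2, where sine and cosine reduce to a small angle; 5
    PI / 2 plays the same part for 7.7. *)
Lemma jf_109_pos : 0 < jf 10.9.
Proof.
  generalize PI_bounds; intros HP. set (e := 7 * (PI / 2) - 10.9).
  assert (He : 0.0955 < e < 0.0957) by (unfold e; lra).
  assert (Es : sin 10.9 = - cos e).
  { replace 10.9 with (- e + PI / 2 + PI + 2 * PI) by (unfold e; field).
    rewrite sin_plus, cos_2PI, sin_2PI, neg_sin, sin_plus, sin_PI2, cos_PI2, cos_neg. ring. }
  assert (Ec : cos 10.9 = - sin e).
  { replace 10.9 with (- e + PI / 2 + PI + 2 * PI) by (unfold e; field).
    rewrite cos_plus, cos_2PI, sin_2PI, neg_cos, cos_plus, sin_PI2, cos_PI2, sin_neg. ring. }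
  unfold jf. rewrite Es, Ec. generalize (sin_lower e ltac:(lra)) (COS_bound e); intros.
  assert (e ^ 3 <= 0.0957 ^ 3) by (apply pow_incr; lra). lra.
Qed.

Lemma jf_77_neg : jf 7.7 < 0.
Proof.
  generalize PI_bounds; intros HP. set (e := 5 * (PI / 2) - 7.7).
  assert (He : 0.1539 < e < 0.154) by (unfold e; lra).
  assert (Es : sin 7.7 = cos e).
  { replace 7.7 with (- e + PI / 2 + 2 * PI) by (unfold e; field).
    rewrite sin_plus, cos_2PI, sin_2PI, sin_plus, sin_PI2, cos_PI2, cos_neg. ring. }
  assert (Ec : cos 7.7 = sin e).
  { replace 7.7 with (- e + PI / 2 + 2 * PI) by (unfold e; field).
    rewrite cos_plus, cos_2PI, sin_2PI, cos_plus, sin_PI2, cos_PI2, sin_neg. ring. }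
  unfold jf. rewrite Es, Ec. generalize (sin_lower e ltac:(lra)) (COS_bound e); intros.
  assert (e ^ 3 <= 0.154 ^ 3) by (apply pow_incr; lra). lra.
Qed.

Lemma sin_minus_2PI y : sin y = sin (y - 2 * PI).
Proof. rewrite sin_minus, sin_2PI, cos_2PI; ring. Qed.

Lemma sin_ge_0_shift y : 2 * PI <= y <= 3 * PI -> 0 <= sin y.
Proof. intros H. rewrite sin_minus_2PI. apply sin_ge_0; lra. Qed.

Lemma sin_le_0_shift y : 3 * PI <= y <= 4 * PI -> sin y <= 0.
Proof. intros H. rewrite sin_minus_2PI. apply sin_le_0; lra. Qed.

Lemma jf_pos_3PI y : 3 * PI <= y <= 10.9 -> 0 < jf y.
Proof.
  intros H. generalize PI_bounds jf_109_pos; intros HP H1.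
  assert (- jf y <= - jf 10.9); [| lra].
  apply derive_nonneg_le with (f := fun y => - jf y) (df := fun y => - (y * sin y)); [lra | |].
  - intros t _. apply (is_derive_opp jf), is_derive_jf.
  - intros t Ht. assert (sin t <= 0) by (apply sin_le_0_shift; lra). nra.
Qed.

(** The constant 1.16 is nearly the least that the amplitude bound admits at y = 10.9 for lam =
    4.6034. Below 10.9 signs replace it: first sin y >= 0, then [jf y > 0], which leaves only one
    inequality to prove. *)
Lemma jf_le_dpot_pos lam y : 0 < lam <= 4.6034 -> 2 * PI <= y -> 0 <= dpot lam y ->
  Rabs (jf y) <= 1.16 * dpot lam y.
Proof.
  intros Hl Hy Hd. generalize PI_bounds; intros HP.
  destruct (Rle_lt_dec y (3 * PI)) as [H1 | H1].
  - assert (Hs : 0 <= sin y) by (apply sin_ge_0_shift; lra).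
    assert (- (1.16 * y) <= jf y <= 1.16 * y) by (apply jf_bound; nra).
    unfold dpot. assert (0 <= lam * sin y) by nra. apply Rabs_le; lra.
  - destruct (Rle_lt_dec y 10.9) as [H2 | H2].
    + assert (Hj : 0 < jf y) by (apply jf_pos_3PI; lra).
      assert (Ht := trig_combo_le (1 - 1.16 * lam) (- y) (1.16 * y) y ltac:(lra)).
      assert ((1 - 1.16 * lam) ^ 2 + (- y) ^ 2 <= (1.16 * y) ^ 2) by nra.
      rewrite Rabs_right by lra. unfold dpot, jf. specialize (Ht H). lra.
    + apply jf_le_dpot; try lra. rewrite Rabs_right by lra.
      assert ((1 + 1.16 * lam) ^ 2 <= (1 + 1.16 * 4.6034) ^ 2) by (apply pow_incr; lra).
      assert (10.9 ^ 2 <= y ^ 2) by (apply pow_incr; lra). lra.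
Qed.

Lemma pot_diff_lower lam x A : pot lam A - pot lam x >= (A ^ 2 - x ^ 2) / 2 - 2 * Rabs lam.
Proof.
  unfold pot. assert (Hb : Rabs (lam * (cos x - cos A)) <= Rabs lam * 2).
  { rewrite Rabs_mult. apply Rmult_le_compat_l; [apply Rabs_pos |].
    generalize (COS_bound x) (COS_bound A); intros. apply Rabs_le; lra. }
  assert (- (Rabs lam * 2) <= lam * (cos x - cos A)).
  { unfold Rabs at 1 in Hb; destruct Rcase_abs in Hb; generalize (Rabs_pos lam); lra. }
  lra.
Qed.

(** Below 2 PI the force may be nearly zero, so no comparison of derivatives holds there; the sizes
    of K and D are compared directly. *)
Lemma kf_le_pot_pos lam A x : 0 < lam <= 4.6034 -> 10.9 <= A -> 0 <= x < A ->
  (forall y, 0 < y -> 0 < dpot lam y) ->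
  Rabs (kf A - kf x) <= 1.16 * (pot lam A - pot lam x).
Proof.
  intros Hl HA Hx Hd. generalize PI_bounds; intros HP.
  destruct (Rle_lt_dec (2 * PI) x) as [H | H].
  - apply kf_le_pot; [lra |]. intros y Hy. apply jf_le_dpot_pos; try lra. left; apply Hd; lra.
  - generalize (pot_diff_lower lam x A). rewrite (Rabs_right lam) by lra.
    assert (- (A + 0.19) <= kf A - 2 <= A + 0.19) by (apply kf_bound; nra).
    assert (- (6.6) <= kf x - 2 <= 6.6) by (apply kf_bound; nra).
    intros Hp. apply Rle_trans with (A + 0.19 + 6.6); [apply Rabs_le; lra |].
    assert (x ^ 2 <= 6.2832 ^ 2) by (apply pow_incr; lra). nra.
Qed.

Lemma kf_le_pot_neg lam A x : -1 <= lam < 0 -> 7.7 <= A -> 0 <= x < A ->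
  Rabs (kf A - kf x) <= 1.06 * (pot lam A - pot lam x).
Proof.
  intros Hl HA Hx. generalize PI_bounds; intros HP.
  assert (El : Rabs lam = - lam) by (apply Rabs_left; lra).
  destruct (Rle_lt_dec PI x) as [H | H].
  - apply kf_le_pot; [lra |]. intros y Hy. destruct (Rle_lt_dec y (2 * PI)) as [H2 | H2].
    + assert (Hs : sin y <= 0) by (apply sin_le_0; lra).
      assert (- (1.06 * y) <= jf y <= 1.06 * y) by (apply jf_bound; nra).
      unfold dpot. assert (0 <= lam * sin y) by nra. apply Rabs_le; lra.
    + apply jf_le_dpot; try lra. rewrite El. nra.
  - generalize (pot_diff_lower lam x A). rewrite El.
    assert (- (A + 0.3) <= kf A - 2 <= A + 0.3) by (apply kf_bound; nra).
    assert (- (3.75) <= kf x - 2 <= 3.75) by (apply kf_bound; nra).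
    intros Hp. apply Rle_trans with (A + 0.3 + 3.75); [apply Rabs_le; lra |].
    assert (x ^ 2 <= 3.1416 ^ 2) by (apply pow_incr; lra). nra.
Qed.

(** * Adverse amplitudes beyond the first window *)

Lemma quad_pos a b s v p : 0 < a -> b ^ 2 < 4 * a * s -> v <> 0 ->
  0 < a * v ^ 2 - b * (v * p) + s * p ^ 2.
Proof.
  intros Ha Hb Hv. apply Rmult_lt_reg_l with (4 * a); [lra |]. rewrite Rmult_0_r.
  replace (4 * a * (a * v ^ 2 - b * (v * p) + s * p ^ 2)) with
    ((2 * a * v - b * p) ^ 2 + (4 * a * s - b ^ 2) * p ^ 2) by ring.
  generalize (pow2_ge_0 (2 * a * v - b * p)); intros.
  destruct (Req_dec p 0) as [-> | Hp].
  - replace (2 * a * v - b * 0) with (2 * a * v) by ring.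
    assert (0 < (2 * a * v) ^ 2); [| lra]. apply pow2_gt_0.
    repeat apply Rmult_integral_contrapositive_currified; lra.
  - assert (0 < p ^ 2) by (apply pow2_gt_0; auto). nra.
Qed.

Lemma adverse_neg lam A : -1 <= lam < 0 -> 7.7 <= A -> 0 < jf A ->
  (forall x, 0 <= x < A -> 0 < pot lam A - pot lam x) ->
  exists c', forall x, 0 <= x < A ->
    0 < jf A * bracket lam A c' x.
Proof.
  intros Hl HA Hj HD. generalize PI_bounds; intros HP.
  assert (El : Rabs lam = - lam) by (apply Rabs_left; lra).
  assert (Hj0 : jf A <> 0) by lra.
  destruct (normal_form A ltac:(lra) Hj0) as (v & p & Hv & Ev & Ej2 & Ejs & Es2 & En & Ejc).
  assert (HN : 0 < supp (jf A) (A ^ 2 * sin A - 3.2 * jf A) A).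
  { apply supp_at_pos_c with v p; auto; try lra.
    assert (7.7 * A <= A ^ 2) by nra.
    assert (7.7 * A ^ 2 <= A ^ 3) by (replace (A ^ 3) with (A * A ^ 2) by ring; apply Rmult_le_compat_r; lra).
    lra. }
  destruct (normal_prod A v p ltac:(lra) En) as [_ Hp2].
  assert (Hv2 := normal_v A v p ltac:(lra) ltac:(lra) En).
  assert (Hi : / A ^ 2 <= / 50) by (apply Rinv_le_contravar; nra).
  assert (HG : forall x, 0 <= x <= A - PI -> supp (jf A) (A ^ 2 * sin A - 3.2 * jf A) x < supp (jf A) (A ^ 2 * sin A - 3.2 * jf A) A).
  { intros x Hx. apply supp_lt with (A - PI); auto.
    apply supp_amp_lt with v p; auto; [lra |].
    replace (A * (p ^ 2 - (3.2 - 2) * v ^ 2) - 3.2 * v * p) with (p * (A * p - 3.2 * v) - 1.2 * A * v ^ 2) by lra.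
    set (m := A * p - 3.2 * v). set (w := A * v ^ 2).
    assert (Hw : w ^ 2 <= 1.02 * (A ^ 2 * v ^ 2)).
    { unfold w. replace ((A * v ^ 2) ^ 2) with (v ^ 2 * (A ^ 2 * v ^ 2)) by ring.
      apply Rmult_le_compat_r; [| lra]. apply Rmult_le_pos; apply pow2_ge_0. }
    assert (Hm : p ^ 2 * m ^ 2 <= m ^ 2) by (generalize (pow2_ge_0 m); nra).
    assert (Hq : (p * m - 1.2 * w) ^ 2 <= 2 * m ^ 2 + 2.88 * w ^ 2) by (generalize (pow2_ge_0 (p * m + 1.2 * w)); nra).
    replace (1.2 * A * v ^ 2) with (1.2 * w) by (unfold w; ring).
    assert (Hmm := pow2_ge_0 m). assert (HAv : 0 < A ^ 2 * v ^ 2) by (apply Rmult_lt_0_compat; apply pow_lt; lra).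
    assert (HPx : 30 <= A ^ 2 - (A - PI) ^ 2) by nra.
    set (P := A ^ 2 - (A - PI) ^ 2) in *.
    assert (30 * (A ^ 2 * v ^ 2 + m ^ 2) <= P * (A ^ 2 * v ^ 2 + m ^ 2)) by (apply Rmult_le_compat_r; lra).
    assert (0 <= P * (v ^ 2 * (A - PI) ^ 2)).
    { apply Rmult_le_pos; [lra |]. apply Rmult_le_pos; apply pow2_ge_0. }
    lra. }
  (* Here 3/2 * |lam| * 2 * 1.06 <= 3.18, and this tilt is small enough to serve on both ranges. *)
  apply adverse_core with (k2 := 1.06) (kap := 1.06) (cI := 3.2) (cII := 3.2); auto; try lra.
  - nra.
  - intros; apply kf_le_pot_neg; auto.
  - intros; apply kf_le_pot_neg; auto; lra.
  - intros x Hx. apply supp_max with (A - PI); auto; try lra.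
    + assert (0 <= Rabs (jf A) / A) by (rewrite Ev; unfold Rdiv; apply Rmult_le_pos; [nra | left; apply Rinv_0_lt_compat; lra]). lra.
    + apply HG; lra.
Qed.

(** The tilt 16.1 exceeds 3/2 * 4.6034 * 2 * 1.16 = 16.02, and A - PI >= 0.71 A from A = 10.9 on.
    The squared middle coefficient has degree 4 in A, the product of the outer ones degree 6. *)
Lemma half_turn_disc A x : 10.9 < A -> 0.71 * A <= x <= A - 3.14159 ->
  0 < A * (A ^ 2 + x ^ 2 - 4) + 4 * 16.1 * A /\
  (A ^ 2 + x ^ 2 - 4 + 4 * A ^ 2 + 4 * 16.1 + (16.1 - 2) * A * (A + x)) ^ 2 <
  4 * (A * (A ^ 2 + x ^ 2 - 4) + 4 * 16.1 * A) * (4 * A + (A + x) * A ^ 2).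
Proof.
  intros HA Hx.
  assert (Hx2 : 0.5041 * A ^ 2 <= x ^ 2) by (replace (0.5041 * A ^ 2) with ((0.71 * A) ^ 2) by lra; apply pow_incr; lra).
  assert (Hx3 : x ^ 2 <= A ^ 2) by (apply pow_incr; lra).
  assert (Hxx : A * x <= A * (A - 3.14159)) by (apply Rmult_le_compat_l; lra).
  assert (Hxp : 0 <= A * x) by (apply Rmult_le_pos; lra).
  assert (HA2 : 118.81 <= A ^ 2) by nra.
  assert (Ha : A * (1.5041 * A ^ 2 + 60) <= A * (A ^ 2 + x ^ 2 - 4) + 4 * 16.1 * A).
  { replace (A * (A ^ 2 + x ^ 2 - 4) + 4 * 16.1 * A) with (A * (A ^ 2 + x ^ 2 + 60.4)) by lra.
    apply Rmult_le_compat_l; lra. }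
  assert (Hs : 1.71 * (A * A ^ 2) <= 4 * A + (A + x) * A ^ 2).
  { assert (1.71 * A * A ^ 2 <= (A + x) * A ^ 2) by (apply Rmult_le_compat_r; lra). lra. }
  assert (H0 : 0 < A * (1.5041 * A ^ 2 + 60)) by (apply Rmult_lt_0_compat; lra).
  assert (H1 : 0 < 1.71 * (A * A ^ 2)) by (assert (0 < A * A ^ 2) by (apply Rmult_lt_0_compat; lra); lra).
  split; [lra |].
  set (b := A ^ 2 + x ^ 2 - 4 + 4 * A ^ 2 + 4 * 16.1 + (16.1 - 2) * A * (A + x)).
  assert (Hb : 0 <= b <= 34.3 * A ^ 2) by (unfold b; split; lra).
  assert (Hb2 : b ^ 2 <= (34.3 * A ^ 2) ^ 2) by (apply pow_incr; lra).
  apply Rle_lt_trans with (1 := Hb2).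
  apply Rlt_le_trans with (4 * (A * (1.5041 * A ^ 2 + 60)) * (1.71 * (A * A ^ 2))).
  - replace (4 * (A * (1.5041 * A ^ 2 + 60)) * (1.71 * (A * A ^ 2))) with (A ^ 4 * (6.84 * (1.5041 * A ^ 2 + 60))) by lra.
    replace ((34.3 * A ^ 2) ^ 2) with (A ^ 4 * 1176.49) by lra. apply Rmult_lt_compat_l; [apply pow_lt |]; lra.
  - apply Rmult_le_compat; lra.
Qed.

Lemma adverse_pos lam A : 0 < lam <= 4.6034 -> 10.9 < A -> jf A < 0 ->
  (forall y, 0 < y -> 0 < dpot lam y) ->
  (forall x, 0 <= x < A -> 0 < pot lam A - pot lam x) ->
  exists c', forall x, 0 <= x < A ->
    0 < jf A * bracket lam A c' x.
Proof.
  intros Hl HA Hj Hd HD. generalize PI_bounds; intros HP.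
  assert (El : Rabs lam = lam) by (apply Rabs_right; lra).
  assert (Hj0 : jf A <> 0) by lra.
  destruct (normal_form A ltac:(lra) Hj0) as (v & p & Hv & Ev & Ej2 & Ejs & Es2 & En & Ejc).
  assert (Evv : Rabs (jf A) / A = v) by (rewrite Ev; field; lra).
  assert (Ej : jf A = - (A * v)) by (rewrite <- Ev, Rabs_left; lra).
  assert (ES : sin A = - p) by (apply Rmult_eq_reg_l with (jf A); auto; rewrite Ejs, Ej; ring).
  assert (EC : cos A = - (p / A - v)) by (apply Rmult_eq_reg_l with (jf A); auto; rewrite Ejc, Ej; ring).
  assert (HAv : 10.9 + v <= A).
  { generalize (jf_lipschitz 10.9 A ltac:(lra)) jf_109_pos; intros H1 H2.
    rewrite Rabs_left in H1 by lra. rewrite Ej in H1.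
    assert (A * v < A * (A - 10.9)) by lra.
    assert (v < A - 10.9) by (apply Rmult_lt_reg_l with A; lra). lra. }
  destruct (normal_prod A v p ltac:(lra) En) as [_ Hp2].
  assert (Hp1 : p <= 1) by nra.
  assert (HNc : forall c, 1 <= c <= 16.1 -> 0 < supp (jf A) (A ^ 2 * sin A - c * jf A) A).
  { intros c Hc. apply supp_at_pos_c with v p; auto; try lra.
    assert ((c - 1) * (A ^ 2 / 2 + A) <= 15.1 * (A ^ 2 / 2 + A)) by (apply Rmult_le_compat_r; nra).
    assert (10.9 * A <= A ^ 2) by nra.
    assert (10.9 * A ^ 2 <= A ^ 3) by (replace (A ^ 3) with (A * A ^ 2) by ring; apply Rmult_le_compat_r; lra).
    lra. }
  assert (Hcut : 12.9 <= tilt v <= 14.95) by (unfold tilt; repeat destruct Rle_dec; lra).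
  assert (HG0 : forall x, 0 <= x <= A - PI - v ->
    supp (jf A) (A ^ 2 * sin A - tilt v * jf A) x < supp (jf A) (A ^ 2 * sin A - tilt v * jf A) A).
  { intros x Hx. apply supp_lt with (A - PI - v); auto; [apply HNc; lra |].
    apply supp_amp_lt with v p; auto; [lra |]. apply tangent_amp_pos; auto. }
  assert (Hv2 := normal_v A v p ltac:(lra) ltac:(lra) En).
  assert (Hi : / A ^ 2 <= / 50) by (apply Rinv_le_contravar; nra).
  assert (Hv3 : v < 1.1) by nra.
  (* As [jf A < 0], the bad sign is K > 0, so only an upper bound of [kf A], roughly A p, matters. A
     larger v forces a smaller p, which permits a smaller [kap] and so a smaller tilt; this is why
     [tilt] decreases with v. *)
  assert (Hkap : exists kap, 3 / 2 * lam * (1.16 + kap) <= tilt v /\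
     forall x, 0 <= x <= A - PI -> 0 < kf A - kf x -> kf A - kf x <= kap * (pot lam A - pot lam x)).
  { assert (Hb : forall kap s1, 0 < kap -> p <= s1 ->
      2 * (s1 / A) - 2 * v + A * s1 + (A - PI + 0.26) <= kap * (PI * A - 14.142) ->
      forall x, 0 <= x <= A - PI -> 0 < kf A - kf x -> kf A - kf x <= kap * (pot lam A - pot lam x)).
    { intros kap s1 Hk Hps Hle x Hx _.
      assert (- (A - PI + 0.26) <= kf x - 2 <= A - PI + 0.26) by (apply kf_bound; nra).
      assert (kf A - 2 = 2 * (p / A) - 2 * v + A * p) by (unfold kf; rewrite ES, EC; field; lra).
      assert (p / A <= s1 / A) by (apply Rmult_le_compat_r; [left; apply Rinv_0_lt_compat; lra | lra]).
      assert (A * p <= A * s1) by (apply Rmult_le_compat_l; lra).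
      generalize (pot_diff_lower lam x A). rewrite El. intros Hpd.
      assert (PI * A - 14.142 <= pot lam A - pot lam x).
      { assert (x ^ 2 <= (A - PI) ^ 2) by (apply pow_incr; lra).
        assert (PI ^ 2 <= 3.1416 ^ 2) by (apply pow_incr; lra). lra. }
      assert (kap * (PI * A - 14.142) <= kap * (pot lam A - pot lam x)) by (apply Rmult_le_compat_l; lra). lra. }
    assert (Hi1 : 0 < / A <= / 10.9) by (split; [apply Rinv_0_lt_compat; lra | apply Rinv_le_contravar; lra]).
    assert (HPA : 3.14159 * A <= PI * A) by (apply Rmult_le_compat_r; lra).
    (* Each [kap] is, rounded down, the largest with 3/2 * 4.6034 * (1.16 + kap) below the tilt;
       0.851 and 0.694 bound p when v exceeds 0.6 and 0.78. *)
    unfold tilt; destruct Rle_dec as [H6 | H6]; [| destruct Rle_dec as [H7 | H7]].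
    - exists 1.005. split; [lra |]. apply Hb with 1; [lra | lra |].
      clear - HAv Hv Hi1 HPA HP. unfold Rdiv. lra.
    - exists 0.8095. split; [lra |]. apply Hb with 0.851; [lra | |].
      + clear - HAv H6 En. destruct (Rle_lt_dec p 0); [lra |]. apply normal_upper with A 11.5 v 0.6; lra.
      + clear - HAv Hv Hi1 HPA HP H6. unfold Rdiv. lra.
    - exists 0.708. split; [lra |]. apply Hb with 0.694; [lra | |].
      + clear - HAv H7 En. destruct (Rle_lt_dec p 0); [lra |]. apply normal_upper with A 11.68 v 0.78; lra.
      + clear - HAv Hv Hi1 HPA HP H7. unfold Rdiv. lra. }
  destruct Hkap as (kap & Hk1 & Hk2).
  apply adverse_core with (k2 := 1.16) (kap := kap) (cI := 16.1) (cII := tilt v); auto; try lra.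
  - nra.
  - intros; apply kf_le_pot_pos; auto; lra.
  - intros x Hx Hs. assert (0 < kf A - kf x) by nra. rewrite Rabs_right by lra. apply Hk2; auto.
  - rewrite El; lra.
  - apply supp_max; auto; try lra.
    + apply Rminus_gt_0_lt. rewrite (supp_half_turn A 16.1 v p); auto; [| lra].
      set (x := A - PI).
      assert (Hx : 0.71 * A <= x <= A - 3.14159) by (unfold x; lra).
      destruct (half_turn_disc A x) as [Ha Hb]; [lra | lra |].
      apply quad_pos; [exact Ha | exact Hb | lra].
    + apply HNc; lra.
  - intros x Hx. destruct (Rle_lt_dec x (A - PI - v)); [apply HG0; lra |].
    apply supp_max with (A - PI - v); auto; try lra; [apply HG0; lra | apply HNc; lra].
Qed.

Lemma sin_3PI2_minus e : sin (3 * (PI / 2) - e) = - cos e.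
Proof. replace (3 * (PI / 2) - e) with (PI / 2 - e + PI) by field. rewrite neg_sin, sin_shift. reflexivity. Qed.
Lemma cos_3PI2_minus e : cos (3 * (PI / 2) - e) = - sin e.
Proof. replace (3 * (PI / 2) - e) with (PI / 2 - e + PI) by field. rewrite neg_cos, cos_shift. reflexivity. Qed.

Lemma jf_449_pos : 0 < jf 4.49.
Proof.
  generalize PI_bounds; intros HP. set (e := 3 * (PI / 2) - 4.49).
  assert (He : 0.22238 < e < 0.22241) by (unfold e; lra).
  replace 4.49 with (3 * (PI / 2) - e) by (unfold e; ring). unfold jf.
  rewrite sin_3PI2_minus, cos_3PI2_minus. replace (3 * (PI / 2) - e) with 4.49 by (unfold e; ring).
  generalize (sin_lower e ltac:(lra)) (cos_upper e); intros.
  assert (e ^ 3 <= 0.22241 ^ 3) by (apply pow_incr; lra). assert (e ^ 4 <= 0.22241 ^ 4) by (apply pow_incr; lra).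
  assert (0.22238 ^ 2 <= e ^ 2) by (apply pow_incr; lra). lra.
Qed.

Lemma jf_4494_neg : jf 4.494 < 0.
Proof.
  generalize PI_bounds; intros HP. set (e := 3 * (PI / 2) - 4.494).
  assert (He : 0.21838 < e < 0.21841) by (unfold e; lra).
  replace 4.494 with (3 * (PI / 2) - e) by (unfold e; ring). unfold jf.
  rewrite sin_3PI2_minus, cos_3PI2_minus. replace (3 * (PI / 2) - e) with 4.494 by (unfold e; ring).
  generalize (sin_upper e ltac:(lra)) (cos_lower e); intros.
  assert (e ^ 5 <= 0.21841 ^ 5) by (apply pow_incr; lra). assert (e ^ 2 <= 0.21841 ^ 2) by (apply pow_incr; lra).
  assert (0.21838 ^ 3 <= e ^ 3) by (apply pow_incr; lra). lra.
Qed.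

Lemma jf_decr x y : PI <= x < y -> y <= 2 * PI -> jf y < jf x.
Proof.
  intros H1 H2. generalize PI_bounds; intros HP. apply Ropp_lt_cancel.
  apply derive_pos_lt with (f := fun y => - jf y) (df := fun y => - (y * sin y)); [lra | |].
  - intros t _. apply (is_derive_opp jf), is_derive_jf.
  - intros t Ht. assert (sin t < 0) by (apply sin_lt_0; lra). nra.
Qed.

(** * The window between the first zero of j and 2 pi *)

(** The root 4.4934... of tan z = z. The value -1 / cos z = 4.60333... is the parameter at which G'
    acquires a positive zero, a double one, at z. *)
Definition first_zero (z : R) : Prop := 4.49 < z < 4.494 /\ jf z = 0.

Lemma first_zero_exists : exists z, first_zero z.
Proof.
  destruct (jf_ivt 4.49 4.494) as [z [Hz E]]; [lra | generalize jf_449_pos jf_4494_neg; nra |].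
  exists z; split; auto.
Qed.

Lemma jf_pos_before z x : first_zero z -> 0 < x < z -> 0 < jf x.
Proof.
  intros [Hz E] Hx. generalize PI_bounds; intros HP.
  destruct (Rle_lt_dec x PI); [apply jf_pos; lra |]. rewrite <- E. apply jf_decr; lra.
Qed.

Lemma jf_neg_after z x : first_zero z -> z < x <= 7.7 -> jf x < 0.
Proof.
  intros [Hz E] Hx. generalize PI_bounds; intros HP.
  destruct (Rle_lt_dec x (2 * PI)); [rewrite <- E; apply jf_decr; lra |].
  apply Rle_lt_trans with (jf 7.7); [| apply jf_77_neg].
  apply derive_nonneg_le with (df := fun y => y * sin y); [lra | |].
  - intros; apply is_derive_jf.
  - intros y Hy. assert (0 <= sin y) by (apply sin_ge_0_shift; lra). nra.
Qed.

Lemma first_zero_facts z : first_zero z ->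
  0.2172 < - cos z < 0.2174 /\ sin z = z * cos z /\ cos z ^ 2 * (1 + z ^ 2) = 1.
Proof.
  intros [Hz E]. generalize PI_bounds; intros HP.
  assert (Hs : sin z = z * cos z) by (unfold jf in E; lra).
  generalize (sin2_cos2' z); intros H. rewrite Hs in H.
  assert (H' : cos z ^ 2 * (1 + z ^ 2) = 1) by lra.
  assert (Hc : cos z < 0) by (apply cos_lt_0; lra).
  repeat split; auto.
  - apply Rnot_le_lt; intros Hn. assert ((- cos z) ^ 2 <= 0.2172 ^ 2) by (apply pow_incr; lra).
    assert (z ^ 2 <= 4.494 ^ 2) by (apply pow_incr; lra). assert (0 <= cos z ^ 2) by apply pow2_ge_0.
    assert (cos z ^ 2 * (1 + z ^ 2) <= 0.2172 ^ 2 * (1 + 4.494 ^ 2)) by (apply Rmult_le_compat; nra). lra.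
  - apply Rnot_le_lt; intros Hn. assert (0.2174 ^ 2 <= (- cos z) ^ 2) by (apply pow_incr; lra).
    assert (4.49 ^ 2 <= z ^ 2) by (apply pow_incr; lra).
    assert (0.2174 ^ 2 * (1 + 4.49 ^ 2) <= cos z ^ 2 * (1 + z ^ 2)) by (apply Rmult_le_compat; nra). lra.
Qed.

(* [tang z] is G'/lambda for the borderline parameter: the line of slope - cos z is tangent to - sin at z *)
Definition tang (z y : R) : R := - cos z * y + sin y.

(** This factor decides the monotonicity in [jf_sq_le]. Divided by y it decreases on [PI, z], and
    its value at z is 9 + 2 / cos z - 2 cos z, about 0.23. *)
Lemma slope_poly_pos z y : first_zero z -> 0 < y <= z -> 0 <= 9 * y - 2 * jf y + 2 * y ^ 2 * sin y.
Proof.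
  intros Hz Hy. generalize PI_bounds; intros HP.
  destruct (first_zero_facts z Hz) as (Hc & Hs & Hn). destruct Hz as [Hz E].
  unfold jf. destruct (Rle_lt_dec y PI) as [H | H].
  - assert (0 <= sin y) by (apply sin_ge_0; lra). generalize (COS_bound y) (sin_lt_x y ltac:(lra)); intros.
    assert (0 <= y ^ 2 * sin y) by (apply Rmult_le_pos; nra). nra.
  - set (B := fun y => 9 + 2 * y * sin y - 2 * (sin y / y) + 2 * cos y).
    assert (HB : 0 <= B y).
    { assert (0 <= B z).
      { unfold B. rewrite Hs. replace (z * cos z / z) with (cos z) by (field; lra).
        replace (9 + 2 * z * (z * cos z) - 2 * cos z + 2 * cos z) with (9 + 2 * cos z * (1 + z ^ 2) - 2 * cos z) by ring.
        assert (cos z * (cos z * (1 + z ^ 2)) = 1) by lra. set (t := cos z * (1 + z ^ 2)) in *. nra. }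
      apply Rle_trans with (B z); auto. apply Ropp_le_cancel.
      apply derive_nonneg_le with (f := fun y => - B y) (df := fun y => - (2 * y * cos y + 2 * (jf y / y ^ 2))); [lra | |].
      - intros t Ht. unfold B, jf. auto_derive; [lra |]. field; lra.
      - intros t Ht. assert (jf t <= PI).
        { replace PI with (jf PI) by (unfold jf; rewrite sin_PI, cos_PI; ring).
          destruct (Rle_lt_or_eq_dec PI t ltac:(lra)) as [Ht2 | <-]; [left; apply jf_decr; lra | lra]. }
        assert (cos t <= cos z) by (apply cos_incr_1; lra).
        assert (jf t / t ^ 2 <= 0.32).
        { apply Rmult_le_reg_r with (t ^ 2); [apply pow_lt; lra |]. unfold Rdiv. rewrite Rmult_assoc, Rinv_l by (apply pow_nonzero; lra). nra. }
        nra. }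
    unfold B in HB. assert (0 <= y * (9 + 2 * y * sin y - 2 * (sin y / y) + 2 * cos y)) by (apply Rmult_le_pos; lra).
    replace (y * (9 + 2 * y * sin y - 2 * (sin y / y) + 2 * cos y)) with (9 * y - 2 * (sin y - y * cos y) + 2 * y ^ 2 * sin y) in H0 by (field; lra). lra.
Qed.

(** Both sides vanish to second order at z, where [jf ^ 2 / (y * tang)] tends to 2 z |sin z| =
    8.77...; the constant 9 is therefore nearly sharp. The quotient by y^2 is monotone up to z. *)
Lemma jf_sq_le z y : first_zero z -> 0 < y <= z -> jf y ^ 2 <= 9 * y * tang z y.
Proof.
  intros Hz Hy. destruct (first_zero_facts z Hz) as (Hc & Hs & Hn).
  set (phi := fun y => 9 * (- cos z + sin y / y) - (jf y / y) ^ 2).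
  assert (H : 0 <= phi y).
  { replace 0 with (phi z) by (unfold phi; rewrite (proj2 Hz), Hs; field; lra).
    apply Ropp_le_cancel.
    apply derive_nonneg_le with (f := fun y => - phi y)
      (df := fun y => jf y / y ^ 3 * (9 * y - 2 * jf y + 2 * y ^ 2 * sin y)); [lra | |].
    - intros t Ht. unfold phi, jf. auto_derive; [lra |]. field; lra.
    - intros t Ht. apply Rmult_le_pos; [| apply (slope_poly_pos z); auto; lra].
      apply Rmult_le_pos; [| left; apply Rinv_0_lt_compat, pow_lt; lra].
      destruct (Req_dec t z) as [-> |]; [rewrite (proj2 Hz); lra | left; apply (jf_pos_before z); auto; lra]. }
  assert (0 <= y ^ 2 * phi y) by (apply Rmult_le_pos; [apply pow2_ge_0 | auto]).
  replace (y ^ 2 * phi y) with (9 * y * tang z y - jf y ^ 2) in H0 by (unfold phi, tang; field; lra). lra.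
Qed.

Lemma tang_nonneg z y : first_zero z -> 0 <= y -> y <= 2 * PI -> 0 <= tang z y.
Proof.
  intros Hz Hy Hy2. generalize PI_bounds; intros HP. destruct (first_zero_facts z Hz) as (Hc & Hs & Hn).
  destruct Hy as [Hy | <-]; [| unfold tang; rewrite sin_0; lra].
  destruct (Rle_lt_dec y z) as [H | H].
  - generalize (jf_sq_le z y Hz ltac:(lra)) (pow2_ge_0 (jf y)); intros.
    assert (0 <= y * tang z y) by lra. nra.
  - assert (Hyz : 0 <= - cos z + sin y / y).
    { replace 0 with (- cos z + sin z / z) by (rewrite Hs; field; destruct Hz; lra).
      apply derive_nonneg_le with (f := fun y => - cos z + sin y / y) (df := fun y => - jf y / y ^ 2); [lra | |].
      - destruct Hz. intros t Ht. unfold jf. auto_derive; [lra |]. field; lra.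
      - intros t Ht. apply Rmult_le_pos; [| left; apply Rinv_0_lt_compat, pow_lt; destruct Hz; lra].
        destruct (Req_dec t z) as [-> |]; [rewrite (proj2 Hz); lra | generalize (jf_neg_after z t Hz); lra]. }
    replace (tang z y) with (y * (- cos z + sin y / y)) by (unfold tang; field; lra).
    apply Rmult_le_pos; lra.
Qed.

(** The maximum, where tan y = - y near 4.913, is 4.814... *)
Lemma ysin_bound y : PI <= y <= 2 * PI -> - (y * sin y) <= 4.82.
Proof.
  intros Hy. generalize PI_bounds; intros HP. set (t := y - 3 * (PI / 2)).
  assert (Hs : sin y = - cos t).
  { replace y with (3 * (PI / 2) - - t) by (unfold t; ring). rewrite sin_3PI2_minus, cos_neg. reflexivity. }
  rewrite Hs. assert (Ht : y <= 4.7125 + t) by (unfold t; lra).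
  assert (Hc : 0 <= cos t) by (apply cos_ge_0; unfold t; lra).
  assert (Ht2 : -1.571 <= t <= 1.571) by (unfold t; lra).
  assert (y * cos t <= (4.7125 + t) * cos t) by (apply Rmult_le_compat_r; lra).
  assert (Hu := cos_upper t). assert (Htt := pow2_ge_0 t).
  destruct (Rle_lt_dec t 0) as [H1 | H1].
  - generalize (COS_bound t); intros. nra.
  - destruct (Rle_lt_dec t 0.6) as [H2 | H2].
    + assert (t ^ 4 <= 0.36 * t ^ 2) by (replace (t ^ 4) with (t ^ 2 * t ^ 2) by ring; apply Rmult_le_compat_r; [apply pow2_ge_0 | nra]).
      assert ((4.7125 + t) * cos t <= (4.7125 + t) * (1 - 0.485 * t ^ 2)) by (apply Rmult_le_compat_l; lra).
      assert (0 <= (t - 0.2) ^ 2 * (t + 0.4)) by (apply Rmult_le_pos; [apply pow2_ge_0 | lra]).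
      generalize (pow2_ge_0 (t - 0.206)); intros. lra.
    + assert (t ^ 4 <= 2.4681 * t ^ 2) by (replace (t ^ 4) with (t ^ 2 * t ^ 2) by ring; apply Rmult_le_compat_r; [apply pow2_ge_0 | nra]).
      assert ((4.7125 + t) * cos t <= (4.7125 + t) * (1 - 0.397 * t ^ 2)) by (apply Rmult_le_compat_l; lra).
      assert (0 <= t ^ 3) by (apply pow_le; lra). generalize (pow2_ge_0 (t - 0.6)); intros. lra.
Qed.

Lemma kf_decr_after z x y : first_zero z -> z <= x < y -> y <= 7.7 -> kf y < kf x.
Proof.
  intros Hz H1 H2. apply Ropp_lt_cancel.
  apply derive_pos_lt with (f := fun y => - kf y) (df := fun y => - jf y); [lra | |].
  - intros t _. apply (is_derive_opp kf), is_derive_kf.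
  - intros t Ht. generalize (jf_neg_after z t Hz); lra.
Qed.

Lemma kf_incr_before z x y : first_zero z -> 0 <= x < y -> y <= z -> kf x < kf y.
Proof.
  intros Hz H1 H2. apply derive_pos_lt with (df := jf); [lra | |].
  - intros t _. apply is_derive_kf.
  - intros t Ht. apply (jf_pos_before z); auto; lra.
Qed.

Lemma kf_pos z x : first_zero z -> 0 < x < 2 * PI -> 0 < kf x.
Proof.
  intros Hz Hx. generalize PI_bounds; intros HP. destruct (Rle_lt_dec x z).
  - replace 0 with (kf 0) by (unfold kf; rewrite cos_0; ring). apply (kf_incr_before z); auto; lra.
  - replace 0 with (kf (2 * PI)) by (unfold kf; rewrite cos_2PI, sin_2PI; ring). apply (kf_decr_after z); auto; lra.
Qed.

Lemma dpot_tang lam z y : lam <> 0 -> dpot lam y = lam * ((/ lam + cos z) * y + tang z y).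
Proof. intros H. unfold dpot, tang. field; auto. Qed.

(** Here [eta] measures how far lam is from the borderline. Before z, [jf <= 3 sqrt (y * tang)], and
    the arithmetic-geometric mean with [9 <= 4 eta c1 ^ 2] gives [lam K <= c1 D]; after z,
    [- jf <= Rabs (jf A)] gives [- lam K <= c2 D] with [c2 = Rabs (jf A) / (eta z)]. The tilt c2
    settles K <= 0 by the spiral inequality, and the last hypothesis settles K > 0. *)
Lemma window1_dilation lam z A eta c1 :
  0 < lam -> first_zero z -> z < A < 2 * PI -> 0 < eta <= / lam + cos z ->
  (forall x, 0 <= x < A -> 0 < pot lam A - pot lam x) ->
  0 < c1 -> 9 <= 4 * eta * c1 ^ 2 ->
  3 / 2 * (c1 + Rabs (jf A) / (eta * z)) < A ^ 2 * sin A / jf A + 1 + A * Rabs (jf A) / kf A ->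
  exists c', forall x, 0 <= x < A ->
    0 < jf A * bracket lam A c' x.
Proof.
  intros Hl Hz HA He HD Hc1 H9 H. generalize PI_bounds; intros HP.
  assert (Hz0 : 4.49 < z < 4.494) by apply Hz.
  assert (Hj : jf A < 0) by (apply (jf_neg_after z); auto; lra).
  assert (HkA : 0 < kf A) by (apply (kf_pos z); auto; lra).
  rewrite Rabs_left in H by auto. set (J := - jf A) in *. assert (HJ : 0 < J) by (unfold J; lra).
  set (c2 := J / (eta * z)) in *.
  assert (Hez : 0 < eta * z) by (apply Rmult_lt_0_compat; lra).
  assert (Hc2 : 0 < c2) by (unfold c2; apply Rdiv_lt_0_compat; auto).
  set (rho := A ^ 2 * sin A / jf A) in *.
  assert (Htang : forall y, 0 <= y <= A -> 0 <= tang z y) by (intros; apply tang_nonneg; auto; lra).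
  assert (Hup : forall y, 0 <= y <= A -> lam * jf y <= c1 * dpot lam y).
  { intros y Hy. rewrite (dpot_tang lam z) by lra.
    replace (c1 * (lam * ((/ lam + cos z) * y + tang z y))) with (lam * (c1 * ((/ lam + cos z) * y + tang z y))) by ring.
    apply Rmult_le_compat_l; [lra |]. specialize (Htang y Hy). set (t := tang z y) in *.
    assert (Hey : eta * y <= (/ lam + cos z) * y) by (apply Rmult_le_compat_r; lra).
    apply Rle_trans with (c1 * (eta * y + t)); [| apply Rmult_le_compat_l; lra].
    destruct (Rle_lt_dec y z) as [Hyz | Hyz].
    - destruct (Req_dec y 0) as [-> | Hy0].
      { unfold jf; rewrite sin_0. rewrite Rmult_0_r, Rmult_0_l, Rminus_0_r. apply Rmult_le_pos; lra. }
      assert (Hsq := jf_sq_le z y Hz ltac:(lra)). fold t in Hsq.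
      assert (0 <= c1 * (eta * y + t)) by (apply Rmult_le_pos; [lra | assert (0 <= eta * y) by (apply Rmult_le_pos; lra); lra]).
      apply Rnot_lt_le; intros Hn.
      assert ((c1 * (eta * y + t)) ^ 2 < jf y ^ 2) by nra.
      assert (0 <= c1 ^ 2 * (eta * y - t) ^ 2) by (apply Rmult_le_pos; apply pow2_ge_0).
      assert (9 * (y * t) <= 4 * eta * c1 ^ 2 * (y * t)) by (apply Rmult_le_compat_r; [apply Rmult_le_pos |]; lra).
      lra.
    - assert (jf y < 0) by (apply (jf_neg_after z); auto; lra).
      assert (0 <= c1 * (eta * y + t)); [apply Rmult_le_pos; [lra |] | lra].
      assert (0 <= eta * y) by (apply Rmult_le_pos; lra). lra. }
  assert (Hdn : forall y, 0 <= y <= A -> - (lam * jf y) <= c2 * dpot lam y).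
  { intros y Hy. rewrite (dpot_tang lam z) by lra.
    replace (c2 * (lam * ((/ lam + cos z) * y + tang z y))) with (lam * (c2 * ((/ lam + cos z) * y + tang z y))) by ring.
    replace (- (lam * jf y)) with (lam * - jf y) by ring.
    apply Rmult_le_compat_l; [lra |]. specialize (Htang y Hy). set (t := tang z y) in *.
    assert (Hey : eta * y <= (/ lam + cos z) * y) by (apply Rmult_le_compat_r; lra).
    assert (0 <= eta * y) by (apply Rmult_le_pos; lra).
    destruct (Rle_lt_dec y z) as [Hyz | Hyz].
    - assert (0 <= jf y). { destruct (Req_dec y 0) as [-> |]; [unfold jf; rewrite sin_0; lra |].
        destruct (Req_dec y z) as [-> |]; [rewrite (proj2 Hz); lra |]. left; apply (jf_pos_before z); auto; lra. }
      assert (0 <= c2 * ((/ lam + cos z) * y + t)); [apply Rmult_le_pos; lra | lra].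
    - assert (- jf y <= J).
      { unfold J. destruct (Req_dec y A) as [-> |]; [lra |]. assert (jf A < jf y) by (apply jf_decr; lra). lra. }
      apply Rle_trans with (c2 * (eta * z)); [replace (c2 * (eta * z)) with J by (unfold c2; field; split; lra); lra |].
      apply Rmult_le_compat_l; [lra |]. assert (eta * z <= eta * y) by (apply Rmult_le_compat_l; lra). lra. }
  exists (rho - 3 / 2 * c2). intros x Hx. unfold bracket.
  specialize (HD x Hx).
  assert (HKup : lam * (kf A - kf x) <= c1 * (pot lam A - pot lam x)).
  { assert (c1 * pot lam x - lam * kf x <= c1 * pot lam A - lam * kf A); [| lra].
    apply derive_nonneg_le with (f := fun y => c1 * pot lam y - lam * kf y) (df := fun y => c1 * dpot lam y - lam * jf y); [lra | |].
    - intros y _. unfold pot, kf, dpot, jf. auto_derive; [exact I | field].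
    - intros y Hy. specialize (Hup y ltac:(lra)). lra. }
  assert (HKdn : - (lam * (kf A - kf x)) <= c2 * (pot lam A - pot lam x)).
  { assert (c2 * pot lam x + lam * kf x <= c2 * pot lam A + lam * kf A); [| lra].
    apply derive_nonneg_le with (f := fun y => c2 * pot lam y + lam * kf y) (df := fun y => c2 * dpot lam y + lam * jf y); [lra | |].
    - intros y _. unfold pot, kf, dpot, jf. auto_derive; [exact I | field].
    - intros y Hy. specialize (Hdn y ltac:(lra)). lra. }
  assert (Hsp := spiral A x ltac:(lra) Hx).
  (* K > 0 forces x <= z. Since q + k = y j, this factor makes q + th k vanish at A, while it is
     nonnegative at x. This improves on the tangent there. *)
  assert (Hth : 0 < kf A - kf x -> (1 + A * J / kf A) * (kf A - kf x) <= - (qf A - qf x)).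
  { intros HK. set (th := 1 + A * J / kf A).
    assert (Hq : forall y, qf y + kf y = y * jf y) by (intros; unfold qf, kf, jf; ring).
    assert (Hxz : x <= z).
    { apply Rnot_lt_le; intros Hn. generalize (kf_decr_after z x A Hz); lra. }
    assert (0 <= jf x). { destruct (Req_dec x 0) as [-> |]; [unfold jf; rewrite sin_0; lra |].
        destruct (Req_dec x z) as [-> |]; [rewrite (proj2 Hz); lra |]. left; apply (jf_pos_before z); auto; lra. }
    assert (0 <= kf x). { destruct (Req_dec x 0) as [-> |]; [unfold kf; rewrite cos_0; lra |]. left; apply (kf_pos z); auto; lra. }
    assert (E1 : qf A + th * kf A = 0).
    { replace (qf A + th * kf A) with ((qf A + kf A) + A * J) by (unfold th; field; lra). rewrite Hq. unfold J; ring. }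
    assert (E2 : 0 <= qf x + th * kf x).
    { replace (qf x + th * kf x) with ((qf x + kf x) + A * J / kf A * kf x) by (unfold th; ring). rewrite Hq.
      assert (0 <= x * jf x) by (apply Rmult_le_pos; lra).
      assert (0 <= A * J / kf A) by (apply Rlt_le, Rdiv_lt_0_compat; [apply Rmult_lt_0_compat |]; lra).
      assert (0 <= A * J / kf A * kf x) by (apply Rmult_le_pos; lra). lra. }
    lra. }
  set (K := kf A - kf x) in *. set (D := pot lam A - pot lam x) in *. set (dQ := qf A - qf x) in *.
  assert (Ej : jf A = - J) by (unfold J; ring).
  replace (jf A * (dQ - (rho - 3 / 2 * c2) * K + 3 / 2 * lam * K ^ 2 / D)) with
    (J * (- dQ + (rho - 3 / 2 * c2) * K - 3 / 2 * lam * K ^ 2 / D)) by (rewrite Ej; ring).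
  apply Rmult_lt_0_compat; auto.
  assert (Hsp' : 0 < J * (- dQ + rho * K)).
  { replace (J * (- dQ + rho * K)) with (jf A * dQ - A ^ 2 * sin A * K); [exact Hsp |].
    unfold rho. rewrite Ej. field; lra. }
  assert (Hsp'' : 0 < - dQ + rho * K) by nra.
  assert (Hb : forall q, lam * Rabs K <= q * D -> lam * K ^ 2 / D <= q * Rabs K).
  { intros q Hq. apply Rmult_le_reg_r with D; [lra |]. unfold Rdiv. rewrite Rmult_assoc, Rinv_l by lra.
    replace (K ^ 2) with (Rabs K ^ 2) by apply pow2_abs. generalize (Rabs_pos K). nra. }
  destruct (Rle_lt_dec K 0) as [HK | HK].
  - rewrite Rabs_left1 in Hb by auto. specialize (Hb c2 ltac:(lra)). lra.
  - rewrite Rabs_right in Hb by lra. specialize (Hb c1 ltac:(lra)). specialize (Hth HK).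
    assert (3 / 2 * (c1 + c2) * K < (rho + 1 + A * J / kf A) * K) by (apply Rmult_lt_compat_r; lra). lra.
Qed.

Lemma sin_near_3PI2 A : 4.49 <= A <= 4.935 -> 0.975 <= - sin A.
Proof.
  intros HA. generalize PI_bounds; intros HP. set (t := A - 3 * (PI / 2)).
  assert (Hs : sin A = - cos t).
  { replace A with (3 * (PI / 2) - - t) by (unfold t; ring). rewrite sin_3PI2_minus, cos_neg. reflexivity. }
  rewrite Hs. generalize (cos_lower t); intros. assert (-0.2225 <= t <= 0.2227) by (unfold t; lra). nra.
Qed.

Lemma jf_growth z A : first_zero z -> z < A < 2 * PI -> - jf A <= 4.82 * (A - z).
Proof.
  intros Hz HA. generalize PI_bounds; intros HP. assert (Hz0 : 4.49 < z < 4.494) by apply Hz.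
  assert (4.82 * z + jf z <= 4.82 * A + jf A); [| rewrite (proj2 Hz) in H; lra].
  apply derive_nonneg_le with (f := fun y => 4.82 * y + jf y) (df := fun y => 4.82 + y * sin y); [lra | |].
  - intros y _. unfold jf. auto_derive; [exact I | ring].
  - intros y Hy. generalize (ysin_bound y ltac:(lra)); lra.
Qed.

(** With [eta = (A - z) ^ 2], [c1 = 3 / (2 (A - z))] is the equality case of [9 <= 4 eta c1 ^ 2]. As
    [jf A] vanishes linearly at z, the main terms are all of order 1 / (A - z), and
    [A ^ 2 * sin A / jf A] outweighs the left-hand side alone. *)
Lemma dilation_margin_small z A : first_zero z -> z < A < 2 * PI -> A - z <= 0.415 ->
  3 / 2 * (3 / 2 / (A - z) + Rabs (jf A) / ((A - z) ^ 2 * z)) <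
  A ^ 2 * sin A / jf A + 1 + A * Rabs (jf A) / kf A.
Proof.
  intros Hz HA Ha. generalize PI_bounds; intros HP. assert (Hz0 : 4.49 < z < 4.494) by apply Hz.
  assert (Hj : jf A < 0) by (apply (jf_neg_after z); auto; lra).
  assert (HkA : 0 < kf A) by (apply (kf_pos z); auto; lra).
  assert (HJ := jf_growth z A Hz HA).
  assert (Hs := sin_near_3PI2 A ltac:(lra)).
  rewrite Rabs_left by auto. set (J := - jf A) in *. assert (Ej : jf A = - J) by (unfold J; ring). rewrite Ej.
  set (a := A - z) in *. assert (Ha0 : 0 < a) by (unfold a; lra). assert (HJ0 : 0 < J) by (unfold J; lra).
  assert (0 < A * J / kf A) by (apply Rdiv_lt_0_compat; [apply Rmult_lt_0_compat |]; lra).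
  assert (3 / 2 * (3 / 2 / a + J / (a ^ 2 * z)) <= A ^ 2 * sin A / - J); [| lra].
  apply Rmult_le_reg_r with (a ^ 2 * z * J); [repeat apply Rmult_lt_0_compat; try apply pow_lt; lra |].
  replace (3 / 2 * (3 / 2 / a + J / (a ^ 2 * z)) * (a ^ 2 * z * J)) with (J * (9 / 4 * a * z + 3 / 2 * J)) by (field; split; lra).
  replace (A ^ 2 * sin A / - J * (a ^ 2 * z * J)) with (a ^ 2 * (A ^ 2 * - sin A * z)) by (field; lra).
  apply Rle_trans with ((4.82 * a) * (9 / 4 * a * z + 3 / 2 * (4.82 * a))).
  { apply Rmult_le_compat; try lra. assert (0 <= a * z) by (apply Rmult_le_pos; lra). lra. }
  replace (4.82 * a * (9 / 4 * a * z + 3 / 2 * (4.82 * a))) with (a ^ 2 * (4.82 * (9 / 4 * z + 7.23))) by lra.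
  apply Rmult_le_compat_l; [apply pow2_ge_0 |].
  assert (HA2 : 20.16 <= A ^ 2) by nra.
  assert (20.16 * 0.975 <= A ^ 2 * - sin A) by (apply Rmult_le_compat; lra).
  assert (20.16 * 0.975 * z <= A ^ 2 * - sin A * z) by (apply Rmult_le_compat_r; lra). lra.
Qed.

(** Beyond 0.415, [c1] is frozen and [eta] grows only linearly, so both summands on the left stay
    bounded. *)
Lemma dilation_margin_large z A : first_zero z -> z < A < 2 * PI -> 0.415 <= A - z ->
  3 / 2 * (3 / 2 / 0.415 + Rabs (jf A) / (0.415 * (A - z) * z)) <
  A ^ 2 * sin A / jf A + 1 + A * Rabs (jf A) / kf A.
Proof.
  intros Hz HA Ha. generalize PI_bounds; intros HP. assert (Hz0 : 4.49 < z < 4.494) by apply Hz.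
  assert (Hj : jf A < 0) by (apply (jf_neg_after z); auto; lra).
  assert (HkA : 0 < kf A) by (apply (kf_pos z); auto; lra).
  assert (HJ := jf_growth z A Hz HA).
  rewrite Rabs_left by auto. set (J := - jf A) in *. assert (Ej : jf A = - J) by (unfold J; ring). rewrite Ej.
  set (a := A - z) in *. assert (HJ0 : 0 < J) by (unfold J; lra).
  assert (H1 : J / (0.415 * a * z) <= 4.82 / (0.415 * 4.49)).
  { assert (Hq : 0 < 0.415 * a * z) by (apply Rmult_lt_0_compat; lra).
    apply Rmult_le_reg_r with (0.415 * a * z); [exact Hq |]. unfold Rdiv at 1. rewrite Rmult_assoc, Rinv_l by lra.
    assert (0 <= a * (z - 4.49)) by (apply Rmult_le_pos; lra). lra. }
  set (S := - sin A). set (k := kf A) in *.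
  assert (HS : 0 < S) by (unfold S; generalize (sin_lt_0 A ltac:(lra) ltac:(lra)); lra).
  replace (A ^ 2 * sin A / - J) with (A ^ 2 * S / J) by (unfold S; field; lra).
  (* arithmetic-geometric mean, the product of the two terms being A^3 S / k *)
  assert (Hprod : 17.3 * k <= A ^ 3 * S).
  { set (h := (2 * PI - A) / 2). assert (Hh : 0 < h < 0.6893) by (unfold h, a in *; lra).
    assert (ES : S = 2 * sin h * cos h).
    { unfold S. rewrite <- sin_2a. replace (2 * h) with (- A + 2 * PI) by (unfold h; field).
      rewrite sin_plus, sin_2PI, cos_2PI, sin_neg. ring. }
    assert (Ek : k = 4 * sin h ^ 2 + A * S).
    { unfold k, kf, S. assert (cos A = cos (2 * h)) by (unfold h; replace (2 * ((2 * PI - A) / 2)) with (- A + 2 * PI) by field; rewrite cos_plus, sin_2PI, cos_2PI, cos_neg; ring).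
      rewrite H, cos_2a_sin. ring. }
    assert (Hc : 0.7624 <= cos h) by (generalize (cos_lower h); intros; nra).
    assert (Hsh : 0 < sin h) by (apply sin_gt_0; lra).
    assert (Hs2 : sin h <= 0.6472) by (generalize (sin2_cos2' h); intros; nra).
    assert (HA3 : 117.8 <= A ^ 3 ) by (apply Rle_trans with (4.904 ^ 3); [lra | apply pow_incr; unfold a in *; lra]).
    assert (HA4 : 33 <= A ^ 3 - 17.3 * A).
    { assert (0 <= (A - 4.904) * (A ^ 2 + 4.904 * A + 4.904 ^ 2 - 17.3)) by (apply Rmult_le_pos; [unfold a in *; lra | generalize (pow2_ge_0 A); lra]). lra. }
    rewrite Ek, ES.
    assert (0 <= sin h * (33 * (2 * cos h) - 17.3 * 4 * sin h) ); [apply Rmult_le_pos; [lra |] |].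
    - lra.
    - assert (33 * (2 * sin h * cos h) <= (A ^ 3 - 17.3 * A) * (2 * sin h * cos h)); [apply Rmult_le_compat_r; [| lra] | lra].
      repeat apply Rmult_le_pos; lra. }
  set (X := A ^ 2 * S / J). set (Y := A * J / k).
  assert (HX : 0 < X) by (apply Rdiv_lt_0_compat; [apply Rmult_lt_0_compat; [apply pow_lt |] |]; lra).
  assert (HY : 0 < Y) by (apply Rdiv_lt_0_compat; [apply Rmult_lt_0_compat |]; lra).
  assert (HXY : 17.3 <= X * Y).
  { replace (X * Y) with (A ^ 3 * S / k) by (unfold X, Y; field; split; lra).
    apply Rmult_le_reg_r with k; auto. unfold Rdiv; rewrite Rmult_assoc, Rinv_l by lra. lra. }
  assert (8.31 <= X + Y) by (generalize (pow2_ge_0 (X - Y)); nra). lra.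
Qed.

(** * Differentiation under the integral sign *)

Lemma continuity_2d_continuous f x y : continuity_2d_pt f x y -> continuous (f x) y.
Proof.
  intros H. apply continuity_pt_filterlim, continuity_pt_locally. intros eps.
  apply (locally_2d_1d_const_x _ x y (H eps)).
Qed.

Lemma continuity_2d_pos f x y : continuity_2d_pt f x y -> 0 < f x y -> locally_2d (fun u v => 0 < f u v) x y.
Proof.
  intros H Hp. apply locally_2d_impl with (2 := H (mkposreal _ Hp)). apply locally_2d_forall.
  simpl. intros u v Huv. apply Rabs_def2 in Huv. lra.
Qed.

Lemma ex_RInt_cont (f : R -> R) (a b : R) : a <= b -> (forall x, a <= x <= b -> continuous f x) -> ex_RInt f a b.
Proof.
  intros H Hf. apply (ex_RInt_continuous (V := R_CompleteNormedModule)).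
  rewrite Rmin_left, Rmax_right by lra. exact Hf.
Qed.

Lemma continuous_const_mult (k : R) (f : R -> R) (x : R) : continuous f x -> continuous (fun x => k * f x) x.
Proof. apply (continuous_scal_r (K := R_AbsRing) (V := R_NormedModule)). Qed.

Lemma RInt_const_mult (k : R) (f : R -> R) (a b : R) : a <= b -> (forall x, a <= x <= b -> continuous f x) ->
  RInt (fun x => k * f x) a b = k * RInt f a b.
Proof. intros H Hf. apply (RInt_scal (V := R_CompleteNormedModule) f), ex_RInt_cont; auto. Qed.

(** Regularity is asked only for parameters beyond [lo], since the densities make sense only for A >
    c. *)
Lemma param_derive (f df : R -> R -> R) (a b lo x : R) : a <= b ->
  (forall y t, lo < y -> a <= t <= b ->
     locally_2d (fun u v => is_derive (fun z => f z v) u (df u v)) y t /\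
     continuity_2d_pt f y t /\ continuity_2d_pt df y t) ->
  lo < x -> is_derive (fun y => RInt (f y) a b) x (RInt (df x) a b).
Proof.
  intros Hab H Hx.
  assert (Hloc : locally x (fun y => lo < y)) by (apply (open_gt lo); auto).
  assert (Hd : forall y t, lo < y -> a <= t <= b -> is_derive (fun z => f z t) y (df y t)).
  { intros y t Hy Ht. destruct (H y t Hy Ht) as [H1 _]. apply (locally_2d_singleton _ _ _ H1). }
  rewrite (RInt_ext (df x) (fun t => Derive (fun u => f u t) x)).
  2:{ intros t Ht. rewrite Rmin_left, Rmax_right in Ht by lra. symmetry. apply is_derive_unique, Hd; lra. }
  apply is_derive_RInt_param; rewrite ?Rmin_left, ?Rmax_right by lra.
  - apply filter_imp with (2 := Hloc). intros y Hy t Ht. exists (df y t). apply Hd; lra.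
  - intros t Ht. destruct (H x t Hx Ht) as (H1 & _ & H3).
    apply continuity_2d_pt_ext_loc with (2 := H3).
    apply locally_2d_impl with (2 := H1). apply locally_2d_forall.
    intros u v Huv. symmetry. apply is_derive_unique, Huv.
  - apply filter_imp with (2 := Hloc). intros y Hy. apply (ex_RInt_cont (f y)); auto. intros t Ht. apply continuity_2d_continuous, H; auto.
Qed.

Lemma cont2_minus f g x y : continuity_2d_pt f x y -> continuity_2d_pt g x y -> continuity_2d_pt (fun u v => f u v - g u v) x y.
Proof. apply continuity_2d_pt_minus. Qed.
Lemma cont2_div f g x y : continuity_2d_pt f x y -> continuity_2d_pt g x y -> g x y <> 0 -> continuity_2d_pt (fun u v => f u v / g u v) x y.
Proof. intros Hf Hg Hn. apply continuity_2d_pt_mult; auto. apply continuity_2d_pt_inv; auto. Qed.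
Lemma cont2_pow f n x y : continuity_2d_pt f x y -> continuity_2d_pt (fun u v => f u v ^ n) x y.
Proof.
  intros Hf. induction n; simpl; [apply continuity_2d_pt_const | apply continuity_2d_pt_mult; auto].
Qed.
Lemma cont2_sqrt f x y : continuity_2d_pt f x y -> 0 <= f x y -> continuity_2d_pt (fun u v => sqrt (f u v)) x y.
Proof. intros H Hp. apply (continuity_1d_2d_pt_comp sqrt); auto. apply continuity_pt_sqrt; auto. Qed.

Create HintDb cont1d.
#[global] Hint Resolve continuity_sin continuity_cos : cont1d.
Ltac cont2 :=
  lazymatch goal with
  | |- continuity_2d_pt (fun u v => u) _ _ => apply continuity_2d_pt_id1
  | |- continuity_2d_pt (fun u v => v) _ _ => apply continuity_2d_pt_id2
  | |- continuity_2d_pt (fun _ _ => ?c) _ _ => apply continuity_2d_pt_const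
  | |- continuity_2d_pt (fun u v => @?f u v + @?g u v) _ _ => apply (continuity_2d_pt_plus f g); cont2
  | |- continuity_2d_pt (fun u v => @?f u v - @?g u v) _ _ => apply (cont2_minus f g); cont2
  | |- continuity_2d_pt (fun u v => @?f u v * @?g u v) _ _ => apply (continuity_2d_pt_mult f g); cont2
  | |- continuity_2d_pt (fun u v => @?f u v / @?g u v) _ _ => apply (cont2_div f g); [cont2 | cont2 | ]
  | |- continuity_2d_pt (fun u v => / @?f u v) _ _ => apply (continuity_2d_pt_inv f); [cont2 | ]
  | |- continuity_2d_pt (fun u v => - @?f u v) _ _ => apply (continuity_2d_pt_opp f); cont2
  | |- continuity_2d_pt (fun u v => @?f u v ^ ?n) _ _ => apply (cont2_pow f n); cont2
  | |- continuity_2d_pt (fun u v => sqrt (@?f u v)) _ _ => apply (cont2_sqrt f); [cont2 | ]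
  | |- continuity_2d_pt (fun u v => ?h (@?f u v)) _ _ =>
      apply (continuity_1d_2d_pt_comp h f); [solve [auto with cont1d] | cont2]
  | _ => idtac
  end.

(** This is sin y / y, written as an integral so that it is smooth at 0 without a case distinction
    and its derivatives have the same form. *)
Definition sinc (y : R) : R := RInt (fun s => cos (y * s)) 0 1.
Definition sinc1 (y : R) : R := RInt (fun s => - (s * sin (y * s))) 0 1.
Definition sinc2 (y : R) : R := RInt (fun s => - (s ^ 2 * cos (y * s))) 0 1.

Lemma is_derive_sinc y : is_derive sinc y (sinc1 y).
Proof.
  apply (param_derive (fun y s => cos (y * s)) (fun y s => - (s * sin (y * s))) 0 1 (y - 1)); [lra | | lra].
  intros z t _ _. repeat split; try cont2.
  apply locally_2d_forall. intros u v. auto_derive; [exact I | ring].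
Qed.

Lemma is_derive_sinc1 y : is_derive sinc1 y (sinc2 y).
Proof.
  apply (param_derive (fun y s => - (s * sin (y * s))) (fun y s => - (s ^ 2 * cos (y * s))) 0 1 (y - 1)); [lra | | lra].
  intros z t _ _. repeat split; try cont2.
  apply locally_2d_forall. intros u v. auto_derive; [exact I | ring].
Qed.

Lemma continuity_sinc2 : continuity sinc2.
Proof.
  intros y. apply derivable_continuous_pt. exists (RInt (fun s => s ^ 3 * sin (y * s)) 0 1). apply is_derive_Reals.
  apply (param_derive (fun y s => - (s ^ 2 * cos (y * s))) (fun y s => s ^ 3 * sin (y * s)) 0 1 (y - 1)); [lra | | lra].
  intros z t _ _. repeat split; try cont2.
  apply locally_2d_forall. intros u v. auto_derive; [exact I | ring].
Qed.

Lemma derive_continuity (f df : R -> R) : (forall x, is_derive f x (df x)) -> continuity f.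
Proof. intros H x. apply derivable_continuous_pt. exists (df x). apply is_derive_Reals, H. Qed.

Lemma continuity_sinc : continuity sinc.
Proof. apply (derive_continuity _ _ is_derive_sinc). Qed.
Lemma continuity_sinc1 : continuity sinc1.
Proof. apply (derive_continuity _ _ is_derive_sinc1). Qed.
#[global] Hint Resolve continuity_sinc continuity_sinc1 continuity_sinc2 : cont1d.

Lemma mul_sinc y : y * sinc y = sin y.
Proof.
  assert (H : is_RInt (fun s => y * cos (y * s)) 0 1 (sin y)).
  { replace (sin y) with (minus (sin (y * 1)) (sin (y * 0))) by (rewrite Rmult_1_r, Rmult_0_r, sin_0; unfold minus, plus, opp; simpl; ring).
    apply (is_RInt_derive (fun s => sin (y * s))).
    - intros s _. auto_derive; [exact I | ring].
    - intros s _. apply (ex_derive_continuous (fun s => y * cos (y * s))). auto_derive; exact I. }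
  rewrite <- (is_RInt_unique _ _ _ _ H). unfold sinc.
  symmetry. apply (RInt_const_mult y (fun s => cos (y * s))); [lra |].
  intros s _. apply (ex_derive_continuous (fun s => cos (y * s))). auto_derive; exact I.
Qed.

Lemma sinc_0 : sinc 0 = 1.
Proof.
  unfold sinc. rewrite (RInt_ext _ (fun _ => 1)).
  - rewrite RInt_const. unfold scal; simpl; unfold mult; simpl. ring.
  - intros s _. rewrite Rmult_0_l, cos_0. reflexivity.
Qed.

Lemma is_derive_val (f : R -> R) (x a b : R) : is_derive f x a -> a = b -> is_derive f x b.
Proof. intros H <-; exact H. Qed.
Lemma deriv_const (c x : R) : is_derive (fun _ => c) x 0.
Proof. apply (is_derive_const (V := R_NormedModule)). Qed.
Lemma deriv_id (x : R) : is_derive (fun x => x) x 1.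
Proof. apply (is_derive_id (K := R_AbsRing)). Qed.
Lemma deriv_plus (f g : R -> R) (x a b : R) : is_derive f x a -> is_derive g x b -> is_derive (fun x => f x + g x) x (a + b).
Proof. apply (is_derive_plus f g). Qed.
Lemma deriv_minus (f g : R -> R) (x a b : R) : is_derive f x a -> is_derive g x b -> is_derive (fun x => f x - g x) x (a - b).
Proof. apply (is_derive_minus f g). Qed.
Lemma deriv_opp (f : R -> R) (x a : R) : is_derive f x a -> is_derive (fun x => - f x) x (- a).
Proof. apply (is_derive_opp f). Qed.
Lemma deriv_mult (f g : R -> R) (x a b : R) : is_derive f x a -> is_derive g x b -> is_derive (fun x => f x * g x) x (a * g x + f x * b).
Proof. intros H1 H2. apply (is_derive_mult f g); auto. apply Rmult_comm. Qed.
Lemma deriv_pow (f : R -> R) n (x a : R) : is_derive f x a -> is_derive (fun x => f x ^ n) x (INR n * a * f x ^ pred n).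
Proof. apply (is_derive_pow f). Qed.
Lemma deriv_div (f g : R -> R) (x a b : R) : is_derive f x a -> is_derive g x b -> g x <> 0 ->
  is_derive (fun x => f x / g x) x ((a * g x - f x * b) / g x ^ 2).
Proof. apply (is_derive_div f g). Qed.

Lemma deriv_comp (h dh : R -> R) (f : R -> R) (x a : R) : (forall y, is_derive h y (dh y)) ->
  is_derive f x a -> is_derive (fun x => h (f x)) x (a * dh (f x)).
Proof. intros H Hf. apply (is_derive_comp h f); auto. Qed.
Lemma deriv_sin (f : R -> R) (x a : R) : is_derive f x a -> is_derive (fun x => sin (f x)) x (a * cos (f x)).
Proof. apply (deriv_comp sin cos). intros; apply is_derive_sin. Qed.
Lemma deriv_cos (f : R -> R) (x a : R) : is_derive f x a -> is_derive (fun x => cos (f x)) x (a * - sin (f x)).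
Proof. apply (deriv_comp cos (fun y => - sin y)). intros; apply is_derive_cos. Qed.
Lemma deriv_sinc (f : R -> R) (x a : R) : is_derive f x a -> is_derive (fun x => sinc (f x)) x (a * sinc1 (f x)).
Proof. apply (deriv_comp sinc sinc1), is_derive_sinc. Qed.
Lemma deriv_sinc1 (f : R -> R) (x a : R) : is_derive f x a -> is_derive (fun x => sinc1 (f x)) x (a * sinc2 (f x)).
Proof. apply (deriv_comp sinc1 sinc2), is_derive_sinc1. Qed.
Lemma deriv_sqrt (f : R -> R) (x a : R) : is_derive f x a -> 0 < f x -> is_derive (fun x => sqrt (f x)) x (a / (2 * sqrt (f x))).
Proof. intros H Hp. apply (is_derive_sqrt f); auto. Qed.

Ltac rderive :=
  lazymatch goal with
  | |- is_derive (fun x => x) _ _ => apply deriv_id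
  | |- is_derive (fun x => @?f x - @?g x) _ _ => apply (deriv_minus f g); rderive
  | |- is_derive (fun x => @?f x + @?g x) _ _ => apply (deriv_plus f g); rderive
  | |- is_derive (fun x => @?f x * @?g x) _ _ => apply (deriv_mult f g); rderive
  | |- is_derive (fun x => @?f x / @?g x) _ _ => apply (deriv_div f g); [rderive | rderive | ]
  | |- is_derive (fun x => @?f x ^ ?n) _ _ => apply (deriv_pow f n); rderive
  | |- is_derive (fun x => - @?f x) _ _ => apply (deriv_opp f); rderive
  | |- is_derive (fun x => sin (@?f x)) _ _ => apply (deriv_sin f); rderive
  | |- is_derive (fun x => cos (@?f x)) _ _ => apply (deriv_cos f); rderive
  | |- is_derive (fun x => sinc (@?f x)) _ _ => apply (deriv_sinc f); rderive
  | |- is_derive (fun x => sinc1 (@?f x)) _ _ => apply (deriv_sinc1 f); rderive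
  | |- is_derive (fun x => sqrt (@?f x)) _ _ => apply (deriv_sqrt f); [rderive | ]
  | |- is_derive (fun _ => ?c) _ _ => apply (deriv_const c)
  | |- is_derive (fun x => ?h x) _ _ =>
      first [ match goal with
              | H : forall y, _ -> is_derive h y _ |- _ => apply H
              | H : forall y, is_derive h y _ |- _ => apply H
              end | idtac ]
  | _ => idtac
  end.

(** * The dilation about the Newton point *)

Section Profile.
(** [1 - s] is the tangent of the normalised force at A, so the deviation [q] vanishes to second
    order at 0. Convexity and the bound 16/3 come from the position of the Newton point and from
    [newton_curvature]; [I] is the area under [q]. *)
Variables (q dq ddq I : R -> R).
Hypothesis Hq : forall s, 0 <= s <= 1 -> is_derive q s (dq s).
Hypothesis Hdq : forall s, 0 <= s <= 1 -> is_derive dq s (ddq s).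
Hypothesis HI : forall s, 0 <= s <= 1 -> is_derive I s (q s).
Hypothesis Hdd : forall s, 0 <= s <= 1 -> 0 <= ddq s <= 16 / 3.
Hypothesis (Hq0 : q 0 = 0) (Hdq0 : dq 0 = 0) (HI0 : I 0 = 0).

Local Ltac pder := eapply is_derive_val;
  [rderive; try lra | simpl INR; simpl pred].
Lemma profile_dq_nonneg s : 0 <= s <= 1 -> 0 <= dq s.
Proof.
  intros Hs. rewrite <- Hdq0. apply derive_nonneg_le with (df := ddq); [lra | |]; intros; [apply Hdq | apply Hdd]; lra.
Qed.

Lemma profile_q_nonneg s : 0 <= s <= 1 -> 0 <= q s.
Proof.
  intros Hs. rewrite <- Hq0. apply derive_nonneg_le with (df := dq); [lra | |]; intros; [apply Hq | apply profile_dq_nonneg]; lra.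
Qed.

Lemma profile_I_nonneg s : 0 <= s <= 1 -> 0 <= I s.
Proof.
  intros Hs. rewrite <- HI0. apply derive_nonneg_le with (df := q); [lra | |]; intros; [apply HI | apply profile_q_nonneg]; lra.
Qed.

Lemma profile_q_le s : 0 <= s <= 1 -> q s <= s * dq s.
Proof.
  intros Hs. assert (0 * dq 0 - q 0 <= s * dq s - q s); [| lra].
  apply derive_nonneg_le with (f := fun s => s * dq s - q s) (df := fun s => s * ddq s); [lra | |].
  - intros t Ht. pder. field.
  - intros t Ht. apply Rmult_le_pos; [lra | apply Hdd; lra].
Qed.

Lemma profile_I_le_q s : 0 <= s <= 1 -> 2 * I s <= s * q s.
Proof.
  intros Hs. assert (0 * q 0 - 2 * I 0 <= s * q s - 2 * I s); [| lra].
  apply derive_nonneg_le with (f := fun s => s * q s - 2 * I s) (df := fun s => s * dq s - q s); [lra | |].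
  - intros t Ht. pder. field.
  - intros t Ht. generalize (profile_q_le t ltac:(lra)); lra.
Qed.

(* I / s^2 and q / s are nondecreasing. *)
Lemma profile_scaled s : 0 < s <= 1 -> I s <= s ^ 2 * I 1 /\ q s <= s * q 1.
Proof.
  intros Hs. split.
  - assert (I s / s ^ 2 <= I 1 / 1 ^ 2).
    { apply derive_nonneg_le with (f := fun s => I s / s ^ 2) (df := fun s => (s * q s - 2 * I s) / s ^ 3); [lra | |].
      - intros t Ht. pder; [apply pow_nonzero; lra |]. field; lra.
      - intros t Ht. apply Rmult_le_pos; [generalize (profile_I_le_q t ltac:(lra)); lra | left; apply Rinv_0_lt_compat, pow_lt; lra]. }
    replace (I s) with (s ^ 2 * (I s / s ^ 2)) by (field; lra). apply Rmult_le_compat_l; [apply pow2_ge_0 | lra].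
  - assert (q s / s <= q 1 / 1).
    { apply derive_nonneg_le with (f := fun s => q s / s) (df := fun s => (s * dq s - q s) / s ^ 2); [lra | |].
      - intros t Ht. pder. field; lra.
      - intros t Ht. apply Rmult_le_pos; [generalize (profile_q_le t ltac:(lra)); lra | left; apply Rinv_0_lt_compat, pow_lt; lra]. }
    replace (q s) with (s * (q s / s)) by (field; lra). apply Rmult_le_compat_l; lra.
Qed.

Lemma profile_dq_sq s : 0 <= s <= 1 -> dq s ^ 2 <= 32 / 3 * q s.
Proof.
  intros Hs. assert (32 / 3 * q 0 - dq 0 ^ 2 <= 32 / 3 * q s - dq s ^ 2); [| rewrite Hq0, Hdq0 in H; lra].
  apply derive_nonneg_le with (f := fun s => 32 / 3 * q s - dq s ^ 2) (df := fun s => 32 / 3 * dq s - 2 * dq s * ddq s); [lra | |].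
  - intros t Ht. pder. field.
  - intros t Ht. assert (Hdd' := Hdd t ltac:(lra)). generalize (profile_dq_nonneg t ltac:(lra)); intros.
    assert (dq t * ddq t <= dq t * (16 / 3)) by (apply Rmult_le_compat_l; lra). lra.
Qed.

(** Interpolation between I and its third derivative: with a bounded [ddq], a small area forces a
    small end value. *)
Lemma profile_q1_cube : q 1 ^ 3 <= 128 / 3 * I 1 ^ 2.
Proof.
  assert (Hf : forall s, 0 <= s <= 1 -> 0 <= 256 / 3 * I s - 3 * (q s * dq s)).
  { intros s Hs. assert (256 / 3 * I 0 - 3 * (q 0 * dq 0) <= 256 / 3 * I s - 3 * (q s * dq s)); [| rewrite HI0, Hq0 in H; lra].
    apply derive_nonneg_le with (f := fun s => 256 / 3 * I s - 3 * (q s * dq s)) (df := fun s => 256 / 3 * q s - 3 * (dq s * dq s + q s * ddq s)); [lra | |].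
    - intros t Ht. pder. field.
    - intros t Ht. assert (Hdd' := Hdd t ltac:(lra)). generalize (profile_dq_sq t ltac:(lra)) (profile_q_nonneg t ltac:(lra)); intros.
      assert (q t * ddq t <= q t * (16 / 3)) by (apply Rmult_le_compat_l; lra). lra. }
  assert (128 / 3 * I 0 ^ 2 - q 0 ^ 3 <= 128 / 3 * I 1 ^ 2 - q 1 ^ 3); [| rewrite HI0, Hq0 in H; lra].
  apply derive_nonneg_le with (f := fun s => 128 / 3 * I s ^ 2 - q s ^ 3) (df := fun s => q s * (256 / 3 * I s - 3 * (q s * dq s))); [lra | |].
  - intros t Ht. pder. field.
  - intros t Ht. apply Rmult_le_pos; [apply profile_q_nonneg | apply Hf]; lra.
Qed.

Lemma profile_bounds_1 : q 1 <= 8 / 3 /\ I 1 <= 1.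
Proof.
  assert (H1 : forall s, 0 <= s <= 1 -> q s <= 8 / 3 * s ^ 2).
  { assert (forall s, 0 <= s <= 1 -> dq s <= 16 / 3 * s).
    { intros s Hs. assert (16 / 3 * 0 - dq 0 <= 16 / 3 * s - dq s); [| lra].
      apply derive_nonneg_le with (f := fun s => 16 / 3 * s - dq s) (df := fun s => 16 / 3 - ddq s); [lra | |].
      - intros t Ht. pder. field.
      - intros t Ht. assert (Hdd' := Hdd t ltac:(lra)); lra. }
    intros s Hs. assert (8 / 3 * 0 ^ 2 - q 0 <= 8 / 3 * s ^ 2 - q s); [| lra].
    apply derive_nonneg_le with (f := fun s => 8 / 3 * s ^ 2 - q s) (df := fun s => 16 / 3 * s - dq s); [lra | |].
    - intros t Ht. pder. field.
    - intros t Ht. specialize (H t ltac:(lra)); lra. }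
  split; [generalize (H1 1 ltac:(lra)); lra |].
  assert (8 / 9 * 0 ^ 3 - I 0 <= 8 / 9 * 1 ^ 3 - I 1); [| lra].
  apply derive_nonneg_le with (f := fun s => 8 / 9 * s ^ 3 - I s) (df := fun s => 8 / 3 * s ^ 2 - q s); [lra | |].
  - intros t Ht. pder. field.
  - intros t Ht. specialize (H1 t ltac:(lra)); lra.
Qed.

(* Minus the second variation on [c, A], in the variable s = (A - x) / (A - c) with
   G'(x) = G'(A) (1 - s + q s); the linear part is exact when c = A - G'(A) / G''(A) is the Newton point. *)
Definition newton_form (gam s : R) : R :=
  let E0 := 2 * s - s ^ 2 in let u := (1 - s) * q s in let D := E0 / 2 + I s in
  3 / 2 * E0 * I s + E0 * u - 3 / 4 * u ^ 2 - u * I s + / 2 * D * (1 - s) ^ 2 * dq s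
    - gam * (D * (I s + u / 2)).

(** By convexity [s * dq s >= q s], which trades the term in [dq] for one in [q]. *)
Lemma newton_form_lower gam s : 0 < s <= 1 ->
  let E0 := 2 * s - s ^ 2 in let u := (1 - s) * q s in
  3 / 2 * E0 * I s + E0 * u - 3 / 4 * u ^ 2 - u * I s + u * ((2 - s) * (1 - s) / 4)
    - gam * ((E0 / 2 + I s) * (I s + u / 2)) <= newton_form gam s.
Proof.
  intros Hs E0 u. assert (Hq' := profile_q_nonneg s ltac:(lra)). assert (HI' := profile_I_nonneg s ltac:(lra)).
  assert (Hd := profile_q_le s ltac:(lra)). assert (Hd0 := profile_dq_nonneg s ltac:(lra)).
  unfold newton_form. fold E0. fold u.
  assert (H : u * ((2 - s) * (1 - s) / 4) <= / 2 * (E0 / 2 + I s) * (1 - s) ^ 2 * dq s); [| lra].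
  assert (H1 : 0 <= (1 - s) ^ 2 * dq s) by (apply Rmult_le_pos; [apply pow2_ge_0 | auto]).
  assert (H2 : 0 <= (2 - s) * (1 - s) ^ 2 / 4) by (generalize (pow2_ge_0 (1 - s)); intros; nra).
  assert (H3 : 0 <= I s * ((1 - s) ^ 2 * dq s)) by (apply Rmult_le_pos; auto).
  assert (H4 : (2 - s) * (1 - s) ^ 2 / 4 * q s <= (2 - s) * (1 - s) ^ 2 / 4 * (s * dq s)) by (apply Rmult_le_compat_l; auto).
  unfold u, E0. lra.
Qed.

Lemma newton_form_2 s : 0 < s <= 1 -> I s <= s ^ 2 / 4 -> q s <= 5 / 3 * s -> 0 <= newton_form 2 s.
Proof.
  intros Hs H1 H2. assert (Hq' := profile_q_nonneg s ltac:(lra)). assert (HI' := profile_I_nonneg s ltac:(lra)).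
  apply Rle_trans with (2 := newton_form_lower 2 s Hs). set (Q := q s) in *. set (J := I s) in *.
  set (u := (1 - s) * Q). assert (Hu : 0 <= u) by (apply Rmult_le_pos; lra).
  assert (A1 : 0 <= J * (s - s ^ 2 / 2 - 2 * J)) by (apply Rmult_le_pos; nra).
  assert (A2 : 0 <= u * (s - s ^ 2 / 2 - 3 / 4 * u - 2 * J + (2 - s) * (1 - s) / 4)).
  { apply Rmult_le_pos; [lra |]. assert (u <= (1 - s) * (5 / 3 * s)) by (apply Rmult_le_compat_l; lra). nra. }
  lra.
Qed.

Lemma newton_form_1 s : 0 < s <= 1 -> I s <= s ^ 2 / 2 -> q s <= 7 / 3 * s -> 0 <= newton_form 1 s.
Proof.
  intros Hs H1 H2. assert (Hq' := profile_q_nonneg s ltac:(lra)). assert (HI' := profile_I_nonneg s ltac:(lra)).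
  apply Rle_trans with (2 := newton_form_lower 1 s Hs). set (Q := q s) in *. set (J := I s) in *.
  set (u := (1 - s) * Q). assert (Hu : 0 <= u) by (apply Rmult_le_pos; lra).
  assert (A1 : 0 <= J * (2 * s - s ^ 2 - J)) by (apply Rmult_le_pos; nra).
  assert (A2 : 0 <= u * (3 / 4 * (2 * s - s ^ 2) - 3 / 4 * u - 3 / 2 * J + (2 - s) * (1 - s) / 4)).
  { apply Rmult_le_pos; [lra |]. assert (u <= (1 - s) * (7 / 3 * s)) by (apply Rmult_le_compat_l; lra). nra. }
  lra.
Qed.

Lemma newton_form_half s : 0 < s <= 1 -> I s <= s ^ 2 -> q s <= 8 / 3 * s -> 0 <= newton_form (1 / 2) s.
Proof.
  intros Hs H1 H2. assert (Hq' := profile_q_nonneg s ltac:(lra)). assert (HI' := profile_I_nonneg s ltac:(lra)).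
  apply Rle_trans with (2 := newton_form_lower (1 / 2) s Hs). set (Q := q s) in *. set (J := I s) in *.
  set (u := (1 - s) * Q). assert (Hu : 0 <= u) by (apply Rmult_le_pos; lra).
  assert (Hu2 : u <= (1 - s) * (8 / 3 * s)) by (apply Rmult_le_compat_l; lra).
  destruct (Rle_lt_dec s 0.53).
  - assert (A1 : 0 <= J * (5 / 4 * (2 * s - s ^ 2) - / 2 * J)) by (apply Rmult_le_pos; nra).
    assert (A2 : 0 <= u * (7 / 8 * (2 * s - s ^ 2) - 3 / 4 * u - 5 / 4 * J + (2 - s) * (1 - s) / 4)).
    { apply Rmult_le_pos; [lra |]. nra. }
    lra.
  - assert (A1 : 0 <= J * (5 / 4 * (2 * s - s ^ 2) - / 2 * J - 5 / 4 * u)) by (apply Rmult_le_pos; [lra | nra]).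
    assert (A2 : 0 <= u * (7 / 8 * (2 * s - s ^ 2) - 3 / 4 * u + (2 - s) * (1 - s) / 4)).
    { apply Rmult_le_pos; [lra |]. nra. }
    lra.
Qed.

(** The piece [0, c] asks for a large [gam] when I 1 is small; the form on [c, A] asks for a small
    one when I 1 is large. With I 1 at least 0, 1/4, 1/2 the values 2, 1, 1/2 just meet the first
    demand, and the end values 5/3, 7/3, 8/3 of [q] belong to the same three ranges. *)
Lemma newton_profile : exists gam, 0 <= gam /\ 3 / 2 <= (1 + gam) * (/ 2 + I 1) /\
  forall s, 0 < s <= 1 -> 0 <= newton_form gam s.
Proof.
  destruct profile_bounds_1 as [Hq1 HI1]. assert (HI1' := profile_I_nonneg 1 ltac:(lra)).
  assert (Hc := profile_q1_cube). assert (Hq1' := profile_q_nonneg 1 ltac:(lra)).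
  assert (Hmain : forall a b gam, I 1 <= a -> q 1 <= b ->
    (forall s, 0 < s <= 1 -> I s <= s ^ 2 * a -> q s <= b * s -> 0 <= newton_form gam s) ->
    forall s, 0 < s <= 1 -> 0 <= newton_form gam s).
  { intros a b gam Ha Hb H s Hs. destruct (profile_scaled s Hs) as [Hs1 Hs2]. apply H; auto.
    - apply Rle_trans with (1 := Hs1). apply Rmult_le_compat_l; [apply pow2_ge_0 | auto].
    - apply Rle_trans with (1 := Hs2). rewrite (Rmult_comm b). apply Rmult_le_compat_l; lra. }
  assert (Hcube : forall a b, 0 <= b -> I 1 <= a -> 128 / 3 * a ^ 2 <= b ^ 3 -> q 1 <= b).
  { intros a b Hb Ha Hab. apply Rnot_lt_le; intros Hn. assert (I 1 ^ 2 <= a ^ 2) by (apply pow_incr; lra).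
    assert (b ^ 3 < q 1 ^ 3); [| lra].
    assert (b ^ 2 <= q 1 ^ 2) by (apply pow_incr; lra).
    replace (b ^ 3) with (b * b ^ 2) by ring. replace (q 1 ^ 3) with (q 1 * q 1 ^ 2) by ring.
    apply Rle_lt_trans with (b * q 1 ^ 2); [apply Rmult_le_compat_l; lra |].
    apply Rmult_lt_compat_r; [apply pow_lt |]; lra. }
  destruct (Rle_lt_dec (I 1) (1 / 4)); [| destruct (Rle_lt_dec (I 1) (1 / 2))].
  - exists 2. split; [lra |]. split; [lra |]. apply (Hmain (1 / 4) (5 / 3)); auto; [apply (Hcube (1 / 4)); lra |].
    intros; apply newton_form_2; lra.
  - exists 1. split; [lra |]. split; [lra |]. apply (Hmain (1 / 2) (7 / 3)); auto; [apply (Hcube (1 / 2)); lra |].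
    intros; apply newton_form_1; lra.
  - exists (1 / 2). split; [lra |]. split; [lra |]. apply (Hmain 1 (8 / 3)); auto.
    intros; apply newton_form_half; lra.
Qed.
End Profile.

Lemma jf_minus_PI A : jf (A - PI) = (A - PI) * cos A - sin A.
Proof. unfold jf. rewrite sin_minus, cos_minus, sin_PI, cos_PI. ring. Qed.

(** For lam > 0, [jf (A - PI) >= PI / lam] is equivalent to G'(A) <= (A - PI) G''(A). Where G''(A) >
    0 this puts the Newton point at PI or beyond, so that G' is convex from there to A. The rate
    0.415 is the room left for [/ lam + cos z]. *)
Lemma jf_half_turn_back z A : first_zero z -> z < A < 2 * PI ->
  PI * (- cos z) + 0.415 * PI * (A - z) <= jf (A - PI).
Proof.
  intros Hz HA. generalize PI_bounds; intros HP. destruct (first_zero_facts z Hz) as (Hc & Hs & _).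
  assert (Hz0 : 4.49 < z < 4.494) by apply Hz.
  assert (E0 : jf (z - PI) = PI * - cos z) by (rewrite jf_minus_PI, Hs; ring).
  assert (Hm : 0.415 * PI * (A - z) <= 1.3038 * (A - z)) by (apply Rmult_le_compat_r; lra).
  destruct (Rle_lt_dec (A - PI) 2.12) as [H | H].
  - assert (jf (z - PI) - 1.3038 * (z - PI) <= jf (A - PI) - 1.3038 * (A - PI)); [| lra].
    apply derive_nonneg_le with (f := fun y => jf y - 1.3038 * y) (df := fun y => y * sin y - 1.3038); [lra | |].
    + intros y _. unfold jf. auto_derive; [exact I | ring].
    + intros y Hy. assert (Es : sin y = cos (y - PI / 2)) by (rewrite cos_minus, sin_PI2, cos_PI2; ring).
      rewrite Es. generalize (cos_lower (y - PI / 2)); intros Hl.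
      set (w := y - PI / 2) in *. assert (Hw : -0.2225 <= w <= 0.5493) by (unfold w; lra).
      destruct (Rle_lt_dec w 0).
      * assert ((- w) ^ 2 <= 0.2225 ^ 2) by (apply pow_incr; lra).
        assert (1.34836 * 0.975 <= y * cos w) by (apply Rmult_le_compat; lra). lra.
      * assert (w ^ 2 <= 0.5493 ^ 2) by (apply pow_incr; lra). assert (1.57 <= y) by (unfold w in *; lra).
        assert (1.57 * 0.849 <= y * cos w) by (apply Rmult_le_compat; lra). lra.
  - set (t := PI - (A - PI)). assert (Ht : 0 < t < 1.0217) by (unfold t; lra).
    assert (Ej : jf (A - PI) = sin t + (PI - t) * cos t).
    { replace (A - PI) with (PI - t) by (unfold t; ring). unfold jf. rewrite sin_PI_x, cos_minus, cos_PI, sin_PI. ring. }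
    rewrite Ej. generalize (sin_lower t ltac:(lra)) (cos_lower t); intros H1 H2.
    assert (H3 : (PI - t) * (1 - t ^ 2 / 2) <= (PI - t) * cos t) by (apply Rmult_le_compat_l; lra).
    assert (H4 : PI * - cos z <= 3.1416 * 0.2174) by (apply Rmult_le_compat; lra).
    assert (H5 : 1.3038 * (A - z) <= 1.3038 * (1.7932 - t)) by (unfold t; lra).
    assert (H6 : PI * t ^ 2 <= 3.1416 * t ^ 2) by (apply Rmult_le_compat_r; [apply pow2_ge_0 | lra]).
    assert (H7 : 0 <= t * (1.0217 - t)) by (apply Rmult_le_pos; lra).
    assert (H8 : 0 <= (t - 0.55) ^ 2 * (t + 1.1)) by (apply Rmult_le_pos; [apply pow2_ge_0 | lra]). lra.
Qed.

(** This makes the quadratic 16/3 h^2 - A h - j(A) nonnegative for every h, its minimum being at h =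
    3 A / 32. *)
Lemma neg_jf_large A : 4.74 <= A <= 2 * PI -> 3 * A ^ 2 / 64 <= - jf A.
Proof.
  intros HA. generalize PI_bounds; intros HP.
  assert (Hs : forall y, sin y = - cos (y - 3 * (PI / 2)) /\ cos y = sin (y - 3 * (PI / 2))).
  { intros y. replace (sin y) with (sin (3 * (PI / 2) - - (y - 3 * (PI / 2)))) by (f_equal; ring).
    replace (cos y) with (cos (3 * (PI / 2) - - (y - 3 * (PI / 2)))) by (f_equal; ring).
    rewrite sin_3PI2_minus, cos_3PI2_minus, cos_neg, sin_neg. split; ring. }
  assert (H0 : 3 * 4.74 ^ 2 / 64 <= - jf 4.74).
  { unfold jf. destruct (Hs 4.74) as [-> ->]. set (t := 4.74 - 3 * (PI / 2)).
    assert (Ht : 0.0276 <= t <= 0.0277) by (unfold t; lra).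
    generalize (cos_lower t) (sin_lower t ltac:(lra)); intros.
    assert (t ^ 3 <= 0.0277 ^ 3) by (apply pow_incr; lra). assert (t ^ 2 <= 0.0277 ^ 2) by (apply pow_incr; lra). lra. }
  destruct (Rle_lt_dec A 6) as [H | H].
  - assert (- jf 4.74 - 3 * 4.74 ^ 2 / 64 <= - jf A - 3 * A ^ 2 / 64); [| lra].
    apply derive_nonneg_le with (f := fun y => - jf y - 3 * y ^ 2 / 64) (df := fun y => y * (- sin y - 3 / 32)); [lra | |].
    + intros y _. unfold jf. auto_derive; [exact I | field].
    + intros y Hy. apply Rmult_le_pos; [lra |]. destruct (Hs y) as [-> _].
      generalize (cos_lower (y - 3 * (PI / 2))); intros.
      assert ((y - 3 * (PI / 2)) ^ 2 <= 1.29 ^ 2) by (apply pow_incr; lra). lra.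
  - set (h := 2 * PI - A). assert (Hh : 0 <= h <= 0.2832) by (unfold h; lra).
    assert (E : - jf A = sin h + A * cos h).
    { unfold jf. replace (sin A) with (- sin h); [replace (cos A) with (cos h); [ring |] |]; unfold h; rewrite ?sin_minus, ?cos_minus, sin_2PI, cos_2PI; ring. }
    rewrite E. generalize (cos_lower h) (sin_ge_0 h ltac:(lra) ltac:(lra)); intros.
    assert (0.95 <= cos h) by nra. nra.
Qed.

(** With H = G'(A) / lam and H' = G''(A) / lam this says t^2 lam / G'(A) <= 16/3 for the Newton step
    t = H / H'. Near z the leading terms are (z + 1/2) (A - z)^2 against 16/3 * (0.976 (A - z))^2,
    so 16/3 has little slack. *)
Lemma newton_curvature lam z A : 0 < lam -> first_zero z -> z < A < 2 * PI ->
  0 < / lam + cos z <= (A - z) * Rmin (A - z) 0.415 ->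
  let H := (/ lam + cos z) * A + tang z A in let H' := / lam + cos A in
  H <= 16 / 3 * H' ^ 2.
Proof.
  intros Hl Hz HA Hnu H H'. generalize PI_bounds; intros HP. destruct (first_zero_facts z Hz) as (Hc & Hs & _).
  assert (Hz0 : 4.49 < z < 4.494) by apply Hz.
  set (nu := / lam + cos z) in *. set (a := A - z) in *.
  destruct (Rle_lt_dec a 0.25) as [Ha | Ha].
  - rewrite Rmin_left in Hnu by lra. set (h := cos A - cos z).
    assert (EH' : H' = nu + h) by (unfold H', nu, h; ring).
    assert (Hh1 : 0.976 * a <= h).
    { assert (cos z - 0.976 * z <= cos A - 0.976 * A); [| unfold h, a; lra].
      apply derive_nonneg_le with (f := fun y => cos y - 0.976 * y) (df := fun y => - sin y - 0.976); [lra | |].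
      - intros y _. auto_derive; [exact I | ring].
      - intros y Hy. destruct (Rle_lt_dec y (3 * (PI / 2))).
        + assert (sin y <= sin z) by (apply sin_decr_1; lra).
          assert (sin z <= - 0.976); [| lra]. apply Rnot_lt_le; intros Hn.
          assert (sin z < 0) by (apply sin_lt_0; lra).
          generalize (sin2_cos2' z); intros.
          assert ((- cos z) ^ 2 <= 0.2174 ^ 2) by (apply pow_incr; lra).
          assert ((- sin z) ^ 2 <= 0.976 ^ 2) by (apply pow_incr; lra). lra.
        + set (t := y - 3 * (PI / 2)). replace y with (3 * (PI / 2) - - t) by (unfold t; ring).
          rewrite sin_3PI2_minus, cos_neg. generalize (cos_lower t); intros.
          assert (t ^ 2 <= 0.04 ^ 2) by (apply pow_incr; unfold t, a in *; lra). lra. }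
    assert (Hh2 : forall y, z <= y -> cos y - cos z <= y - z).
    { intros y Hy. assert (z - cos z <= y - cos y); [| lra].
      apply derive_nonneg_le with (f := fun y => y - cos y) (df := fun y => 1 + sin y); [lra | |].
      - intros; auto_derive; [exact I | ring].
      - intros t _. generalize (SIN_bound t); lra. }
    assert (HT : tang z A <= a ^ 2 / 2).
    { assert ((z - z) ^ 2 / 2 - tang z z <= (A - z) ^ 2 / 2 - tang z A).
      { apply derive_nonneg_le with (f := fun y => (y - z) ^ 2 / 2 - tang z y) (df := fun y => (y - z) - (cos y - cos z)); [lra | |].
        - intros y _. unfold tang. auto_derive; [exact I | field].
        - intros y Hy. generalize (Hh2 y ltac:(lra)); lra. }
      unfold tang at 1 in H0. rewrite Hs in H0. unfold a; lra. }
    assert (Hha : h <= a) by (apply Hh2; lra).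
    assert (Ha0 : 0 < a) by (unfold a; lra).
    assert (Haa : a * a <= 0.0625) by nra.
    (* The function 16/3 (nu + h)^2 - A nu decreases in this range, which reduces the claim to the
       extreme value nu = a^2. *)
    assert (H1 : 0 <= (a * a - nu) * (A - 16 / 3 * (nu + a * a + 2 * h))) by (apply Rmult_le_pos; lra).
    assert (H2 : (a * a + 0.976 * a) ^ 2 <= (a * a + h) ^ 2) by (apply pow_incr; split; nra).
    assert (H3 : 0 < a ^ 3) by (apply pow_lt; lra). assert (H4 : 0 < a ^ 4) by (apply pow_lt; lra).
    assert (H5 : A * (a * a) <= (4.494 + a) * (a * a)) by (apply Rmult_le_compat_r; [nra | unfold a; lra]).
    assert (H6 : 0 <= a * a) by nra.
    unfold H. rewrite EH'. lra.
  - assert (Hj := neg_jf_large A ltac:(unfold a in *; lra)).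
    assert (E : A * H' - H = - jf A) by (unfold H, H', nu, tang, jf; ring).
    generalize (pow2_ge_0 (H' - 3 * A / 32)); intros. lra.
Qed.

(* Here [0, c] is kept fixed while [c, A] is dilated about c: the two sign conditions make the integrand of
   T'' + gam / (A - c) * T' negative on both pieces. *)
Definition newton_split (lam A : R) : Prop :=
  exists c gam, 0 < c < A /\ 0 <= gam /\
  (forall x, 0 <= x < c ->
     3 / 4 * dpot lam A ^ 2 - / 2 * (pot lam A - pot lam x) * ((1 + lam * cos A) + gam * / (A - c) * dpot lam A) < 0) /\
  (forall x, c <= x < A ->
     let r := / (A - c) in let X := (x - c) * r in let D := pot lam A - pot lam x in
     let D1 := dpot lam A - X * dpot lam x in
     let D2 := (1 + lam * cos A) - X ^ 2 * (1 + lam * cos x) in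
     3 / 4 * D1 ^ 2 - r * D * D1 - / 2 * D * D2 + gam * (r ^ 2 * D ^ 2 - / 2 * r * D * D1) <= 0).

Lemma window1_newton lam z A : 0 < lam -> first_zero z -> z < A < 2 * PI ->
  0 < / lam + cos z <= (A - z) * Rmin (A - z) 0.415 ->
  (forall y, 0 < y -> 0 < dpot lam y) ->
  newton_split lam A.
Proof.
  intros Hl Hz HA Hnu Hd. unfold newton_split. generalize PI_bounds; intros HP.
  assert (Hz0 : 4.49 < z < 4.494) by apply Hz.
  assert (Hk := newton_curvature lam z A Hl Hz HA Hnu). cbv zeta in Hk.
  assert (Hb := jf_half_turn_back z A Hz HA).
  set (g1 := dpot lam A) in *. set (g2 := 1 + lam * cos A) in *.
  assert (Hg1 : 0 < g1) by (apply Hd; lra).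
  assert (Eg1 : g1 = lam * ((/ lam + cos z) * A + tang z A)) by (apply dpot_tang; lra).
  assert (Eg2 : g2 = lam * (/ lam + cos A)) by (unfold g2; field; lra).
  assert (Hg12 : g1 <= (A - PI) * g2).
  { rewrite jf_minus_PI in Hb.
    assert (/ lam + cos z <= (A - z) * 0.415) by (apply Rle_trans with (1 := proj2 Hnu); apply Rmult_le_compat_l; [lra | apply Rmin_r]).
    assert (PI * (/ lam + cos z) <= PI * ((A - z) * 0.415)) by (apply Rmult_le_compat_l; lra).
    rewrite Eg1, Eg2. replace ((A - PI) * (lam * (/ lam + cos A))) with (lam * ((A - PI) * (/ lam + cos A))) by ring.
    apply Rmult_le_compat_l; [lra |]. unfold tang. lra. }
  assert (Hg2 : 0 < g2) by (apply Rmult_lt_reg_l with (A - PI); lra).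
  set (t := g1 / g2). assert (Ht : 0 < t) by (apply Rdiv_lt_0_compat; auto).
  (* The Newton point A - t is thus at least PI, and sin <= 0 from there to A: this is the sign of
     [ddq]. *)
  assert (HtA : t <= A - PI).
  { apply Rmult_le_reg_r with g2; auto. unfold t, Rdiv. rewrite Rmult_assoc, Rinv_l by lra. lra. }
  assert (Hkap : t ^ 2 * lam / g1 <= 16 / 3).
  { replace (t ^ 2 * lam / g1) with (((/ lam + cos z) * A + tang z A) / (/ lam + cos A) ^ 2).
    - assert (0 < / lam + cos A) by (apply Rmult_lt_reg_l with lam; lra).
      apply Rmult_le_reg_r with ((/ lam + cos A) ^ 2); [apply pow_lt; auto |].
      unfold Rdiv at 1. rewrite Rmult_assoc, Rinv_l by (apply pow_nonzero; lra). lra.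
    - replace (t ^ 2 * lam / g1) with (g1 * lam / g2 ^ 2) by (unfold t; field; lra).
      rewrite Eg1, Eg2. field. split; [lra |]. intros Hn. rewrite Eg2 in Hg2.
      replace (/ lam + cos A) with ((lam * cos A + 1) / lam) in Hg2 by (field; lra). rewrite Rplus_comm in Hn.
      replace (lam * cos A + 1) with 0 in Hg2 by lra. unfold Rdiv in Hg2. rewrite Rmult_0_l, Rmult_0_r in Hg2. lra. }
  set (q := fun s => dpot lam (A - s * t) / g1 - 1 + s).
  set (dq := fun s => 1 - t * (1 + lam * cos (A - s * t)) / g1).
  set (ddq := fun s => t ^ 2 * lam / g1 * - sin (A - s * t)).
  set (J := fun s => (pot lam A - pot lam (A - s * t)) / (t * g1) - s + s ^ 2 / 2).
  destruct (newton_profile q dq ddq J) as (gam & Hgam & HO & HI).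
  - intros s Hs. unfold q, dq, dpot. auto_derive; [exact I |]. change (A + - (s * t)) with (A - s * t). field; lra.
  - intros s Hs. unfold dq, ddq. auto_derive; [exact I |]. change (A + - (s * t)) with (A - s * t). field; lra.
  - intros s Hs. unfold J, q, pot, dpot. auto_derive; [exact I |]. change (A + - (s * t)) with (A - s * t). field; lra.
  - intros s Hs. unfold ddq. assert (0 <= s * t <= 1 * t) by (split; [apply Rmult_le_pos | apply Rmult_le_compat_r]; lra).
    assert (sin (A - s * t) <= 0) by (apply sin_le_0; lra). generalize (SIN_bound (A - s * t)); intros Hsb.
    assert (0 <= t ^ 2 * lam / g1) by (apply Rlt_le, Rdiv_lt_0_compat; [apply Rmult_lt_0_compat; [apply pow_lt |] |]; lra).
    split; [apply Rmult_le_pos; lra |]. apply Rle_trans with (t ^ 2 * lam / g1 * 1); [apply Rmult_le_compat_l; lra | lra].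
  - unfold q. replace (A - 0 * t) with A by ring. fold g1. field; lra.
  - unfold dq. replace (A - 0 * t) with A by ring. fold g2. unfold t. field; lra.
  - unfold J. replace (A - 0 * t) with A by ring. field; split; lra.
  - assert (Etg : t * g2 = g1) by (unfold t; field; lra).
    exists (A - t), gam. split; [lra |]. split; [auto |]. split.
    + intros x Hx. replace (A - (A - t)) with t by ring.
      assert (Hxc : pot lam x < pot lam (A - t)).
      { apply derive_pos_lt with (df := dpot lam); [lra | intros; apply is_derive_pot |]. intros; apply Hd; lra. }
      assert (HD : g1 * t * (/ 2 + J 1) < pot lam A - pot lam x).
      { apply Rle_lt_trans with (pot lam A - pot lam (A - t)); [| lra].
        right. unfold J. rewrite Rmult_1_l. field. split; lra. }
      replace (g2 + gam * / t * g1) with (g2 * (1 + gam)) by (rewrite <- Etg; field; lra).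
      assert (0 < g2 * (1 + gam)) by (apply Rmult_lt_0_compat; lra).
      assert (g1 * t * (/ 2 + J 1) * (g2 * (1 + gam)) < (pot lam A - pot lam x) * (g2 * (1 + gam))) by (apply Rmult_lt_compat_r; lra).
      replace (g1 * t * (/ 2 + J 1) * (g2 * (1 + gam))) with (g1 ^ 2 * ((1 + gam) * (/ 2 + J 1))) in H0 by (rewrite <- Etg; ring).
      assert (g1 ^ 2 * (3 / 2) <= g1 ^ 2 * ((1 + gam) * (/ 2 + J 1))) by (apply Rmult_le_compat_l; [apply pow2_ge_0 | auto]). lra.
    + intros x Hx. cbv zeta. replace (A - (A - t)) with t by ring.
      set (s := (A - x) / t). assert (Est : s * t = A - x) by (unfold s; field; lra).
      assert (Ex : A - s * t = x) by lra.
      assert (Hs : 0 < s <= 1).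
      { split; [apply Rdiv_lt_0_compat; lra |]. apply Rmult_le_reg_r with t; lra. }
      specialize (HI s Hs). unfold newton_form in HI.
      assert (EX : (x - (A - t)) * / t = 1 - s) by (unfold s; field; lra). rewrite EX.
      assert (ED : pot lam A - pot lam x = g1 * t * ((2 * s - s ^ 2) / 2 + J s)).
      { unfold J. rewrite Ex. field. split; lra. }
      assert (Ed : dpot lam x = g1 * (q s + 1 - s)) by (unfold q; rewrite Ex; field; lra).
      assert (Edd : 1 + lam * cos x = g1 / t * (1 - dq s)) by (unfold dq; rewrite Ex; field; lra).
      rewrite ED, Ed, Edd. replace g2 with (g1 / t) by (rewrite <- Etg; field; lra).
      match goal with |- ?L <= 0 => replace L with (- (g1 ^ 2 * (3 / 2 * (2 * s - s ^ 2) * J s + (2 * s - s ^ 2) * ((1 - s) * q s) -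
        3 / 4 * ((1 - s) * q s) ^ 2 - (1 - s) * q s * J s +
        / 2 * ((2 * s - s ^ 2) / 2 + J s) * (1 - s) ^ 2 * dq s -
        gam * (((2 * s - s ^ 2) / 2 + J s) * (J s + (1 - s) * q s / 2))))) by (field; lra) end.
      assert (0 <= g1 ^ 2) by apply pow2_ge_0.
      match goal with |- - (_ * ?E) <= 0 => assert (0 <= g1 ^ 2 * E) by (apply Rmult_le_pos; [lra | exact HI]) end. lra.
Qed.

(** * Classification of the amplitudes *)

Section Cases.
Variable lam : R.
Hypothesis Hlam : -1 <= lam <= 4.6034.
Hypothesis Hlam0 : lam <> 0.
Hypothesis Hd : forall y, 0 < y -> 0 < dpot lam y.

Lemma pot_increasing x A : 0 <= x < A -> 0 < pot lam A - pot lam x.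
Proof.
  intros H. apply Rlt_Rminus. apply derive_pos_lt with (df := dpot lam); [lra | intros; apply is_derive_pot |].
  intros; apply Hd; lra.
Qed.

(** [kf] vanishes at 2 PI, is positive before it and decreases from it to A, because [jf] increases
    towards [jf A < 0]. So K has one sign and T' cannot vanish. *)
Lemma kf_drop z A x : first_zero z -> 2 * PI <= A <= 3 * PI -> jf A < 0 -> 0 < x < A -> kf A < kf x.
Proof.
  intros Hz HA Hj Hx. generalize PI_bounds; intros HP. assert (Hz0 : 4.49 < z < 4.494) by apply Hz.
  assert (Hdec : forall x, 2 * PI <= x < A -> kf A < kf x).
  { clear x Hx; intros x Hx. apply Ropp_lt_cancel.
    apply derive_pos_lt with (f := fun y => - kf y) (df := fun y => - jf y); [lra | |].
    - intros t _. apply (is_derive_opp kf), is_derive_kf.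
    - intros t Ht. assert (jf t <= jf A); [| lra].
      apply derive_nonneg_le with (df := fun y => y * sin y); [lra | intros; apply is_derive_jf |].
      intros y Hy. assert (0 <= sin y) by (apply sin_ge_0_shift; lra). nra. }
  destruct (Rle_lt_dec (2 * PI) x) as [H | H]; [apply Hdec; lra |].
  assert (E : kf (2 * PI) = 0) by (unfold kf; rewrite cos_2PI, sin_2PI; ring).
  assert (0 < kf x) by (apply (kf_pos z); auto; lra).
  destruct (Rle_lt_or_eq_dec (2 * PI) A ltac:(lra)) as [H1 | <-]; [| lra].
  generalize (Hdec (2 * PI) ltac:(lra)); lra.
Qed.

(** At a zero of [jf] the tangent is vertical and the spiral inequality loses its term in q. *)
Lemma spiral_zero A x : 4.4 <= A -> jf A = 0 -> 0 < x < A -> 0 < - sin A * (kf A - kf x).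
Proof.
  intros HA Hj Hx. generalize (spiral A x ltac:(lra) ltac:(lra)). rewrite Hj. intros H.
  assert (0 < A ^ 2) by (apply pow_lt; lra).
  apply Rmult_lt_reg_l with (A ^ 2); auto. lra.
Qed.

Lemma amplitude_cases A : 0 < A ->
  (exists sg, forall x, 0 < x < A -> 0 < sg * (kf A - kf x)) \/
  (exists sg c, forall x, 0 < x < A -> 0 < sg * bracket lam A c x) \/
  newton_split lam A.
Proof.
  intros HA. generalize PI_bounds; intros HP.
  destruct first_zero_exists as [z Hz]. assert (Hz0 : 4.49 < z < 4.494) by apply Hz.
  assert (HD : forall x, 0 <= x < A -> 0 < pot lam A - pot lam x) by (intros; apply pot_increasing; auto).
  destruct (Rle_lt_dec A z) as [HAz | HAz].
  { left. exists 1. intros x Hx. assert (kf x < kf A) by (apply (kf_incr_before z); auto; lra). lra. }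
  destruct (Req_dec (jf A) 0) as [Hj0 | Hj0].
  { left. exists (- sin A). intros x Hx. apply spiral_zero; auto; lra. }
  destruct (Rlt_le_dec 0 (lam * jf A)) as [Hf | Hf].
  { right; left. exists (jf A), (A ^ 2 * sin A / jf A). intros x Hx. unfold bracket.
    assert (Hs := spiral A x ltac:(lra) ltac:(lra)). specialize (HD x ltac:(lra)).
    replace (jf A * _) with ((jf A * (qf A - qf x) - A ^ 2 * sin A * (kf A - kf x))
      + 3 / 2 * ((lam * jf A) * ((kf A - kf x) ^ 2 / (pot lam A - pot lam x)))) by (field; split; lra).
    assert (0 <= (kf A - kf x) ^ 2 / (pot lam A - pot lam x)).
    { apply Rmult_le_pos; [apply pow2_ge_0 | left; apply Rinv_0_lt_compat; auto]. }
    assert (0 <= lam * jf A * ((kf A - kf x) ^ 2 / (pot lam A - pot lam x))) by (apply Rmult_le_pos; lra). lra. }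
  assert (Hclose : (exists c', forall x, 0 <= x < A -> 0 < jf A * bracket lam A c' x) ->
    exists sg c, forall x, 0 < x < A -> 0 < sg * bracket lam A c x).
  { intros [c' H]. exists (jf A), c'. intros x Hx. apply H; lra. }
  destruct (Rlt_le_dec lam 0) as [Hneg | Hpos].
  - right; left. apply Hclose. assert (Hj : 0 < jf A) by nra.
    apply adverse_neg; auto; [lra |]. apply Rnot_lt_le; intros Hn. generalize (jf_neg_after z A Hz); lra.
  - assert (Hl : 0 < lam) by lra. assert (Hj : jf A < 0) by nra.
    destruct (Rlt_le_dec A (2 * PI)) as [H2 | H2].
    (* Positivity of G' at z alone is the exact condition lam < -1 / cos z. *)
    + assert (Hnu : 0 < / lam + cos z).
      { destruct (first_zero_facts z Hz) as (_ & Hs & _). generalize (Hd z ltac:(lra)). unfold dpot. rewrite Hs. intros H.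
        apply Rmult_lt_reg_l with (z * lam); [apply Rmult_lt_0_compat; lra |].
        replace (z * lam * (/ lam + cos z)) with (z + lam * (z * cos z)) by (field; lra). lra. }
      (* Above this threshold the distance from the borderline bounds K by D well enough; below it
         the Newton point is at least PI and the curvature bound holds. *)
      destruct (Rle_lt_dec ((A - z) * Rmin (A - z) 0.415) (/ lam + cos z)) as [Hc | Hc].
      * right; left. apply Hclose. destruct (Rle_lt_dec (A - z) 0.415) as [Ha | Ha].
        -- rewrite Rmin_left in Hc by lra.
           apply window1_dilation with z ((A - z) ^ 2) (3 / 2 / (A - z)); auto.
           ++ split; [apply pow_lt; lra | lra].
           ++ apply Rdiv_lt_0_compat; lra.
           ++ right; field; lra.
           ++ apply dilation_margin_small; auto.
        -- rewrite Rmin_right in Hc by lra.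
           apply window1_dilation with z (0.415 * (A - z)) (3 / 2 / 0.415); auto.
           ++ split; lra.
           ++ lra.
           ++ lra.
           ++ apply dilation_margin_large; auto; lra.
      * right; right. apply window1_newton with z; auto; lra.
    + destruct (Rle_lt_dec A (3 * PI)) as [H3 | H3].
      * left. exists (-1). intros x Hx. generalize (kf_drop z A x Hz ltac:(lra) Hj Hx); lra.
      * right; left. apply Hclose. apply adverse_pos; auto; [lra |]. apply Rnot_le_lt; intros Hn. generalize (jf_pos_3PI A); lra.
Qed.
End Cases.

(** * The period integral and its variations *)

Section Potential.
Variable lam : R.
Hypothesis Hd : forall y, 0 < y -> 0 < dpot lam y.

(* With x = A - (A - c) u^2, [mid] and [hdf] are half the sum and half the difference of A and x,
   and G(A) - G(x) = (A - c)^2 u^2 phi. *)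
Definition mid (c A u : R) : R := A - (A - c) * u ^ 2 / 2.
Definition hdf (c A u : R) : R := (A - c) * u ^ 2 / 2.
Definition phi (c A u : R) : R :=
  (mid c A u + lam * (sin (mid c A u) * sinc (hdf c A u))) / (A - c).
Definition num1 (c A u : R) : R :=
  (1 - u ^ 2 / 2) + lam * ((1 - u ^ 2 / 2) * cos (mid c A u) * sinc (hdf c A u) + sin (mid c A u) * (u ^ 2 / 2 * sinc1 (hdf c A u))).
Definition num2 (c A u : R) : R :=
  lam * (- (1 - u ^ 2 / 2) ^ 2 * sin (mid c A u) * sinc (hdf c A u)
     + 2 * (1 - u ^ 2 / 2) * (u ^ 2 / 2) * cos (mid c A u) * sinc1 (hdf c A u)
     + (u ^ 2 / 2) ^ 2 * sin (mid c A u) * sinc2 (hdf c A u)).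
Definition phi1 (c A u : R) : R := (num1 c A u - phi c A u) / (A - c).
Definition phi2 (c A u : R) : R := (num2 c A u - 2 * phi1 c A u) / (A - c).

Lemma is_derive_phi c A u : c < A -> is_derive (fun A => phi c A u) A (phi1 c A u).
Proof.
  intros H. unfold phi, mid, hdf. eapply is_derive_val; [rderive; lra |].
  unfold phi1, num1, phi, mid, hdf. simpl INR; simpl pred. field. lra.
Qed.

Lemma is_derive_num1 c A u : is_derive (fun A => num1 c A u) A (num2 c A u).
Proof.
  unfold num1, mid, hdf. eapply is_derive_val; [rderive; lra |].
  unfold num2, mid, hdf. simpl INR; simpl pred. field.
Qed.

Lemma is_derive_phi1 c A u : c < A -> is_derive (fun A => phi1 c A u) A (phi2 c A u).
Proof.
  intros H. unfold phi1. assert (H1 := is_derive_phi c A u H). assert (H2 := is_derive_num1 c A u).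
  eapply is_derive_val; [apply (deriv_div (fun A => num1 c A u - phi c A u) (fun A => A - c)) |].
  - apply (deriv_minus (fun A => num1 c A u) (fun A => phi c A u)); [exact H2 | exact H1].
  - rderive.
  - lra.
  - unfold phi2, phi1. field. lra.
Qed.

Lemma cont2_phi c A u : c < A -> continuity_2d_pt (phi c) A u.
Proof. intros H. unfold phi, mid, hdf. cont2; lra. Qed.

Lemma cont2_phi1 c A u : c < A -> continuity_2d_pt (phi1 c) A u.
Proof.
  intros H. unfold phi1. apply cont2_div; [apply cont2_minus | cont2 | lra]; [| apply cont2_phi; auto].
  unfold num1, mid, hdf. cont2; lra.
Qed.

Lemma cont2_phi2 c A u : c < A -> continuity_2d_pt (phi2 c) A u.
Proof.
  intros H. unfold phi2. apply cont2_div; [apply cont2_minus | cont2 | lra].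
  - unfold num2, mid, hdf. cont2; lra.
  - apply continuity_2d_pt_mult; [cont2 | apply cont2_phi1; auto].
Qed.

(** [cos (m - d) - cos (m + d) = 2 sin m sin d] and [sin d = d * sinc d] factor out the zero at x =
    A exactly, leaving a smooth quotient. *)
Lemma pot_phi c A u : c < A ->
  pot lam A - pot lam (A - (A - c) * u ^ 2) = (A - c) ^ 2 * u ^ 2 * phi c A u.
Proof.
  intros H. unfold phi. set (m := mid c A u). set (d := hdf c A u).
  replace (A - (A - c) * u ^ 2) with (m - d) by (unfold m, d, mid, hdf; field).
  assert (EA : A = m + d) by (unfold m, d, mid, hdf; field).
  assert (Ed : (A - c) * u ^ 2 = 2 * d) by (unfold d, hdf; field).
  replace ((A - c) ^ 2 * u ^ 2 * ((m + lam * (sin m * sinc d)) / (A - c))) with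
    ((A - c) * u ^ 2 * (m + lam * (sin m * sinc d))) by (field; lra).
  rewrite Ed. replace (2 * d * (m + lam * (sin m * sinc d))) with (2 * d * m + 2 * lam * sin m * (d * sinc d)) by ring.
  rewrite mul_sinc, EA. unfold pot. rewrite cos_plus, cos_minus. field.
Qed.

Lemma point_range c A u : 0 <= c < A -> 0 < u < 1 -> c < A - (A - c) * u ^ 2 < A.
Proof. intros H Hu. assert (0 < u ^ 2 < 1) by nra. nra. Qed.

Lemma phi_pos c A u : 0 <= c < A -> 0 <= u <= 1 -> 0 < phi c A u.
Proof.
  intros H Hu. destruct (Req_dec u 0) as [-> | Hn].
  - unfold phi, mid, hdf. replace ((A - c) * 0 ^ 2 / 2) with 0 by field. rewrite sinc_0, Rminus_0_r.
    apply Rdiv_lt_0_compat; [| lra]. generalize (Hd A ltac:(lra)). unfold dpot. lra.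
  - assert (Hu2 : 0 < u ^ 2 <= 1) by nra.
    assert (Hp := pot_phi c A u ltac:(lra)).
    assert (0 < pot lam A - pot lam (A - (A - c) * u ^ 2)).
    { apply pot_increasing; auto. nra. }
    rewrite Hp in H0. assert (0 < (A - c) ^ 2 * u ^ 2) by (apply Rmult_lt_0_compat; [apply pow_lt |]; lra).
    apply Rmult_lt_reg_l with ((A - c) ^ 2 * u ^ 2); lra.
Qed.

(** The differential dx / sqrt (G(A) - G(x)) in the variable u: the factor 2 (A - c) u of dx cancels
    the (A - c) u of the root. *)
Definition dens (c A u : R) : R := 2 / sqrt (phi c A u).
Definition dens1 (c A u : R) : R := - phi1 c A u / (phi c A u * sqrt (phi c A u)).
Definition dens2 (c A u : R) : R :=
  (3 / 2 * phi1 c A u ^ 2 - phi c A u * phi2 c A u) / (phi c A u ^ 2 * sqrt (phi c A u)).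

Lemma is_derive_dens c A u : c < A -> 0 < phi c A u ->
  is_derive (fun A => dens c A u) A (dens1 c A u).
Proof.
  intros H Hp. assert (Hs := sqrt_lt_R0 _ Hp). assert (Es := sqrt_sqrt _ (Rlt_le _ _ Hp)).
  assert (H1 := is_derive_phi c A u H). unfold dens. eapply is_derive_val.
  - apply (deriv_div (fun _ => 2) (fun A => sqrt (phi c A u))); [rderive | apply (deriv_sqrt (fun A => phi c A u)); [exact H1 | exact Hp] | lra].
  - unfold dens1. set (r := sqrt (phi c A u)) in *. rewrite <- Es. field. lra.
Qed.

Lemma is_derive_dens1 c A u : c < A -> 0 < phi c A u ->
  is_derive (fun A => dens1 c A u) A (dens2 c A u).
Proof.
  intros H Hp. assert (Hs := sqrt_lt_R0 _ Hp). assert (Es := sqrt_sqrt _ (Rlt_le _ _ Hp)).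
  assert (H1 := is_derive_phi c A u H). assert (H2 := is_derive_phi1 c A u H). unfold dens1. eapply is_derive_val.
  - apply (deriv_div (fun A => - phi1 c A u) (fun A => phi c A u * sqrt (phi c A u))).
    + apply (deriv_opp (fun A => phi1 c A u)); exact H2.
    + apply (deriv_mult (fun A => phi c A u) (fun A => sqrt (phi c A u))); [exact H1 | apply (deriv_sqrt (fun A => phi c A u)); [exact H1 | exact Hp]].
    + apply Rgt_not_eq, Rmult_lt_0_compat; auto.
  - unfold dens2. set (r := sqrt (phi c A u)) in *. rewrite <- Es. field. lra.
Qed.

Lemma dens_regular c y t : 0 <= c < y -> 0 <= t <= 1 ->
  locally_2d (fun u v => c < u /\ 0 < phi c u v) y t /\ continuity_2d_pt (dens c) y t /\
  continuity_2d_pt (dens1 c) y t /\ continuity_2d_pt (dens2 c) y t.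
Proof.
  intros Hy Ht. assert (Hp := phi_pos c y t Hy Ht). assert (Hs := sqrt_lt_R0 _ Hp).
  assert (C0 := cont2_phi c y t ltac:(lra)). assert (C1 := cont2_phi1 c y t ltac:(lra)). assert (C2 := cont2_phi2 c y t ltac:(lra)).
  assert (Cs : continuity_2d_pt (fun u v => sqrt (phi c u v)) y t) by (apply cont2_sqrt; auto; lra).
  split; [| split; [| split]].
  - apply locally_2d_and; [| apply continuity_2d_pos; auto].
    assert (locally_2d (fun u v => 0 < u - c) y t).
    { apply (continuity_2d_pos (fun u v => u - c)); [cont2 | lra]. }
    apply locally_2d_impl with (2 := H). apply locally_2d_forall. intros; lra.
  - unfold dens. apply (cont2_div (fun _ _ => 2) (fun u v => sqrt (phi c u v))); [cont2 | auto | lra].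
  - unfold dens1. apply (cont2_div (fun u v => - phi1 c u v) (fun u v => phi c u v * sqrt (phi c u v))).
    + apply continuity_2d_pt_opp; auto.
    + apply continuity_2d_pt_mult; auto.
    + apply Rgt_not_eq, Rmult_lt_0_compat; auto.
  - unfold dens2. apply (cont2_div (fun u v => 3 / 2 * phi1 c u v ^ 2 - phi c u v * phi2 c u v) (fun u v => phi c u v ^ 2 * sqrt (phi c u v))).
    + apply cont2_minus; [apply continuity_2d_pt_mult; [cont2 | apply (cont2_pow (phi1 c)); auto] | apply continuity_2d_pt_mult; auto].
    + apply continuity_2d_pt_mult; [apply (cont2_pow (phi c)) |]; auto.
    + apply Rgt_not_eq, Rmult_lt_0_compat; auto. apply pow_lt; auto.
Qed.

Definition Tin (c A : R) : R := RInt (dens c A) 0 1.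
Definition Tin1 (c A : R) : R := RInt (dens1 c A) 0 1.
Definition Tin2 (c A : R) : R := RInt (dens2 c A) 0 1.

Lemma is_derive_Tin c A : 0 <= c < A -> is_derive (Tin c) A (Tin1 c A).
Proof.
  intros H. apply (param_derive (dens c) (dens1 c) 0 1 c A); [lra | | lra].
  intros y t Hy Ht. destruct (dens_regular c y t ltac:(lra) Ht) as (H0 & H1 & H2 & _). split; auto.
  apply locally_2d_impl with (2 := H0). apply locally_2d_forall. intros u v [Hu Hv]. apply is_derive_dens; auto.
Qed.

Lemma is_derive_Tin1 c A : 0 <= c < A -> is_derive (Tin1 c) A (Tin2 c A).
Proof.
  intros H. apply (param_derive (dens1 c) (dens2 c) 0 1 c A); [lra | | lra].
  intros y t Hy Ht. destruct (dens_regular c y t ltac:(lra) Ht) as (H0 & _ & H1 & H2). split; auto.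
  apply locally_2d_impl with (2 := H0). apply locally_2d_forall. intros u v [Hu Hv]. apply is_derive_dens1; auto.
Qed.

(* Both variations come from differentiating [pot_phi] in A at fixed u. *)
Lemma phi1_variation c A u : c < A -> let x := A - (A - c) * u ^ 2 in
  (A - c) ^ 2 * u ^ 2 * phi1 c A u =
  dpot lam A - (1 - u ^ 2) * dpot lam x - 2 * (pot lam A - pot lam x) / (A - c).
Proof.
  intros H x.
  assert (H1 : is_derive (fun A => pot lam A - pot lam (A - (A - c) * u ^ 2)) A (dpot lam A - (1 - u ^ 2) * dpot lam x)).
  { unfold pot, dpot. eapply is_derive_val; [rderive; lra | fold x; simpl INR; simpl pred; field]. }
  assert (H2 : is_derive (fun A => pot lam A - pot lam (A - (A - c) * u ^ 2)) A
     (2 * (A - c) * u ^ 2 * phi c A u + (A - c) ^ 2 * u ^ 2 * phi1 c A u)).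
  { apply is_derive_ext_loc with (fun A => (A - c) ^ 2 * u ^ 2 * phi c A u).
    - apply filter_imp with (2 := open_gt c A H). intros t Ht. symmetry. apply pot_phi, Ht.
    - eapply is_derive_val; [apply (deriv_mult (fun A => (A - c) ^ 2 * u ^ 2) (fun A => phi c A u)); [rderive | apply is_derive_phi; auto] |].
      simpl INR; simpl pred. ring. }
  assert (E := is_derive_unique _ _ _ H1). rewrite (is_derive_unique _ _ _ H2) in E.
  unfold x. rewrite pot_phi by auto. replace (2 * ((A - c) ^ 2 * u ^ 2 * phi c A u) / (A - c)) with (2 * (A - c) * u ^ 2 * phi c A u) by (field; lra).
  fold x. lra.
Qed.

Lemma phi2_variation c A u : c < A -> let x := A - (A - c) * u ^ 2 in
  (A - c) ^ 2 * u ^ 2 * phi2 c A u =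
  (1 + lam * cos A) - (1 - u ^ 2) ^ 2 * (1 + lam * cos x)
    - 4 * (A - c) * u ^ 2 * phi1 c A u - 2 * u ^ 2 * phi c A u.
Proof.
  intros H x.
  assert (H1 : is_derive (fun A => dpot lam A - (1 - u ^ 2) * dpot lam (A - (A - c) * u ^ 2)) A
     ((1 + lam * cos A) - (1 - u ^ 2) ^ 2 * (1 + lam * cos x))).
  { unfold dpot. eapply is_derive_val; [rderive; lra | fold x; simpl INR; simpl pred; field]. }
  assert (H2 : is_derive (fun A => dpot lam A - (1 - u ^ 2) * dpot lam (A - (A - c) * u ^ 2)) A
     (2 * u ^ 2 * phi c A u + 4 * (A - c) * u ^ 2 * phi1 c A u + (A - c) ^ 2 * u ^ 2 * phi2 c A u)).
  { assert (E : forall t : R, c < t -> 2 * (t - c) * u ^ 2 * phi c t u + (t - c) ^ 2 * u ^ 2 * phi1 c t u =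
      dpot lam t - (1 - u ^ 2) * dpot lam (t - (t - c) * u ^ 2)).
    { intros t Ht. rewrite phi1_variation, pot_phi by apply Ht. field. lra. }
    apply is_derive_ext_loc with (fun A => 2 * (A - c) * u ^ 2 * phi c A u + (A - c) ^ 2 * u ^ 2 * phi1 c A u).
    - apply filter_imp with (2 := open_gt c A H). exact E.
    - eapply is_derive_val; [apply (deriv_plus (fun A => 2 * (A - c) * u ^ 2 * phi c A u) (fun A => (A - c) ^ 2 * u ^ 2 * phi1 c A u)) |].
      + apply (deriv_mult (fun A => 2 * (A - c) * u ^ 2) (fun A => phi c A u)); [rderive | apply is_derive_phi; auto].
      + apply (deriv_mult (fun A => (A - c) ^ 2 * u ^ 2) (fun A => phi1 c A u)); [rderive | apply is_derive_phi1; auto].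
      + simpl INR; simpl pred. ring. }
  assert (E := is_derive_unique _ _ _ H1). rewrite (is_derive_unique _ _ _ H2) in E. lra.
Qed.
End Potential.

Ltac pospow := lazymatch goal with
  | |- 0 < _ * _ => apply Rmult_lt_0_compat; pospow
  | |- 0 < _ ^ _ => apply pow_lt; pospow
  | _ => first [assumption | lra] end.

Section Variation.
Variable lam : R.
Hypothesis Hd : forall y, 0 < y -> 0 < dpot lam y.

Lemma pot_kf A x : 2 * (pot lam A - pot lam x) - A * dpot lam A + x * dpot lam x = lam * (kf A - kf x).
Proof. unfold pot, dpot, kf. field. Qed.

Lemma pot_qf A x : A ^ 2 * (1 + lam * cos A) - x ^ 2 * (1 + lam * cos x) =
  2 * (pot lam A - pot lam x) - 2 * lam * (kf A - kf x) - lam * (qf A - qf x).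
Proof. unfold pot, kf, qf. field. Qed.

Lemma RInt_lin_comb f g (k : R) a b : a <= b ->
  (forall x, a <= x <= b -> continuous f x) -> (forall x, a <= x <= b -> continuous g x) ->
  RInt (fun x => f x + k * g x) a b = RInt f a b + k * RInt g a b.
Proof.
  intros Hab Hf Hg.
  assert (Ef : ex_RInt f a b) by (apply ex_RInt_cont; auto).
  assert (Eg : ex_RInt g a b) by (apply ex_RInt_cont; auto).
  rewrite (RInt_plus (V := R_CompleteNormedModule) f (fun x => k * g x)); auto.
  - rewrite RInt_const_mult; auto.
  - apply (ex_RInt_scal (V := R_NormedModule) g); auto.
Qed.

Lemma dens_continuous c A u : 0 <= c < A -> 0 <= u <= 1 -> continuous (dens lam c A) u.
Proof. intros H Hu. apply continuity_2d_continuous, (dens_regular lam Hd c A u H Hu). Qed.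
Lemma dens1_continuous c A u : 0 <= c < A -> 0 <= u <= 1 -> continuous (dens1 lam c A) u.
Proof. intros H Hu. apply continuity_2d_continuous, (dens_regular lam Hd c A u H Hu). Qed.
Lemma dens2_continuous c A u : 0 <= c < A -> 0 <= u <= 1 -> continuous (dens2 lam c A) u.
Proof. intros H Hu. apply continuity_2d_continuous, (dens_regular lam Hd c A u H Hu). Qed.

(** For c = 0 a fixed u means a fixed x / A, and [phi1] becomes a negative multiple of lam K; the
    integrand of T' is a positive multiple of lam K. *)
Lemma Tin1_sign A sg : 0 < A -> (forall x, 0 < x < A -> 0 < sg * (kf A - kf x)) -> lam <> 0 ->
  0 < sg * lam * Tin1 lam 0 A.
Proof.
  intros HA HK Hl. unfold Tin1.
  replace (sg * lam * RInt (dens1 lam 0 A) 0 1) with (RInt (fun u => sg * lam * dens1 lam 0 A u) 0 1).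
  2:{ apply RInt_const_mult; [lra |]. intros; apply dens1_continuous; lra. }
  apply RInt_gt_0; [lra | |].
  - intros u Hu. assert (Hp := phi_pos lam Hd 0 A u ltac:(lra) ltac:(lra)). assert (Hs := sqrt_lt_R0 _ Hp).
    assert (Hx := point_range 0 A u ltac:(lra) Hu). set (x := A - (A - 0) * u ^ 2) in *.
    assert (H1 := phi1_variation lam 0 A u HA). cbv zeta in H1. fold x in H1.
    assert (Eu : 1 - u ^ 2 = x / A) by (unfold x; field; lra). rewrite Eu, Rminus_0_r in H1.
    assert (E : A ^ 2 * u ^ 2 * phi1 lam 0 A u = - (lam * (kf A - kf x)) / A) by (rewrite H1, <- pot_kf; field; lra).
    assert (Hu2 : 0 < u ^ 2) by (apply pow_lt; lra).
    unfold dens1. replace (phi1 lam 0 A u) with (- (lam * (kf A - kf x)) / (A ^ 3 * u ^ 2)).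
    + replace (sg * lam * (- (- (lam * (kf A - kf x)) / (A ^ 3 * u ^ 2)) / (phi lam 0 A u * sqrt (phi lam 0 A u)))) with
       ((lam ^ 2 * (sg * (kf A - kf x))) / ((A ^ 3 * u ^ 2) * (phi lam 0 A u * sqrt (phi lam 0 A u)))) by (field; repeat split; lra).
      apply Rdiv_lt_0_compat.
      * apply Rmult_lt_0_compat; [apply pow2_gt_0; auto | apply HK; lra].
      * pospow.
    + replace (- (lam * (kf A - kf x)) / (A ^ 3 * u ^ 2)) with (- (lam * (kf A - kf x)) / A / (A ^ 2 * u ^ 2)) by (field; lra).
      rewrite <- E. field. lra.
  - intros u Hu. apply continuous_const_mult. apply dens1_continuous; lra.
Qed.

Lemma dens_comb c A u k : c < A -> 0 < phi lam c A u -> u <> 0 ->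
  dens2 lam c A u + k * dens1 lam c A u =
  (3 / 2 * phi1 lam c A u ^ 2 - phi lam c A u * phi2 lam c A u - k * phi lam c A u * phi1 lam c A u)
   / (phi lam c A u ^ 2 * sqrt (phi lam c A u)).
Proof.
  intros Hc Hp Hu. assert (Hs := sqrt_lt_R0 _ Hp). unfold dens1, dens2. field. split; lra.
Qed.

(** The multiplier [(2 - c) / A] is the one that gives K the coefficient - c: the second variation
    by itself contributes dQ - 2 K. *)
Lemma Tin2_sign A sg c : 0 < A -> (forall x, 0 < x < A -> 0 < sg * bracket lam A c x) -> lam <> 0 ->
  0 < sg * lam * (Tin2 lam 0 A + (2 - c) / A * Tin1 lam 0 A).
Proof.
  intros HA HK Hl. unfold Tin1, Tin2.
  rewrite <- RInt_lin_comb; [| lra | intros; apply dens2_continuous; lra | intros; apply dens1_continuous; lra].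
  set (F := fun u => dens2 lam 0 A u + (2 - c) / A * dens1 lam 0 A u).
  assert (HF : forall u, 0 <= u <= 1 -> continuous F u).
  { intros u Hu. apply (continuous_plus (V := R_NormedModule)); [apply dens2_continuous; lra |].
    apply continuous_const_mult. apply dens1_continuous; lra. }
  replace (sg * lam * RInt F 0 1) with (RInt (fun u => sg * lam * F u) 0 1).
  2:{ apply RInt_const_mult; [lra | auto]. }
  apply RInt_gt_0; [lra | |].
  - intros u Hu. assert (Hp := phi_pos lam Hd 0 A u ltac:(lra) ltac:(lra)). assert (Hs := sqrt_lt_R0 _ Hp).
    unfold F. rewrite dens_comb by lra.
    assert (Hx := point_range 0 A u ltac:(lra) Hu). set (x := A - (A - 0) * u ^ 2) in *.
    assert (H0 := pot_phi lam 0 A u HA). fold x in H0.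
    assert (H1 := phi1_variation lam 0 A u HA). cbv zeta in H1. fold x in H1.
    assert (H2 := phi2_variation lam 0 A u HA). cbv zeta in H2. fold x in H2.
    assert (Eu : 1 - u ^ 2 = x / A) by (unfold x; field; lra).
    assert (Hu2 : 0 < u ^ 2) by (apply pow_lt; lra).
    set (p0 := phi lam 0 A u) in *. set (p1 := phi1 lam 0 A u) in *. set (p2 := phi2 lam 0 A u) in *.
    rewrite Eu in H1, H2. rewrite Rminus_0_r in *.
    assert (HD : 0 < pot lam A - pot lam x) by (apply pot_increasing; auto; lra).
    assert (K1 := pot_kf A x). assert (K2 := pot_qf A x).
    specialize (HK x ltac:(lra)). unfold bracket in HK.
    set (D := pot lam A - pot lam x) in *. set (K := kf A - kf x) in *. set (dQ := qf A - qf x) in *.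
    assert (E1 : A ^ 2 * u ^ 2 * p1 = - (lam * K) / A) by (rewrite H1, <- K1; field; lra).
    assert (E2 : A ^ 2 * u ^ 2 * p2 = (2 * D - 2 * lam * K - lam * dQ) / A ^ 2 - 4 * A * u ^ 2 * p1 - 2 * u ^ 2 * p0)
      by (rewrite H2, <- K2; field; lra).
    assert (E : 3 / 2 * p1 ^ 2 - p0 * p2 - (2 - c) / A * p0 * p1 =
       lam * D * (dQ - c * K + 3 / 2 * lam * K ^ 2 / D) / (A ^ 6 * u ^ 4)).
    { replace (3 / 2 * p1 ^ 2 - p0 * p2 - (2 - c) / A * p0 * p1) with
       ((3 / 2 * (A ^ 2 * u ^ 2 * p1) ^ 2 - (A ^ 2 * u ^ 2 * p0) * (A ^ 2 * u ^ 2 * p2) - (2 - c) / A * (A ^ 2 * u ^ 2 * p0) * (A ^ 2 * u ^ 2 * p1)) / (A ^ 4 * u ^ 4)) by (field; lra).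
      rewrite E2.
      replace (4 * A * u ^ 2 * p1) with (4 / A * (A ^ 2 * u ^ 2 * p1)) by (field; lra).
      replace (2 * u ^ 2 * p0) with (2 / A ^ 2 * (A ^ 2 * u ^ 2 * p0)) by (field; lra).
      rewrite E1, <- H0. field. repeat split; lra. }
    rewrite E.
    replace (sg * lam * (lam * D * (dQ - c * K + 3 / 2 * lam * K ^ 2 / D) / (A ^ 6 * u ^ 4) / (p0 ^ 2 * sqrt p0))) with
     (lam ^ 2 * D * (sg * (dQ - c * K + 3 / 2 * lam * K ^ 2 / D)) / (A ^ 6 * u ^ 4 * (p0 ^ 2 * sqrt p0))) by (field; repeat split; lra).
    apply Rdiv_lt_0_compat.
    + apply Rmult_lt_0_compat; auto. apply Rmult_lt_0_compat; auto. apply pow2_gt_0; auto.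
    + pospow.
  - intros u Hu. apply continuous_const_mult. auto.
Qed.

Lemma dens_newton_le c A u gam : 0 <= c < A -> 0 < u < 1 ->
  (forall x, c <= x < A ->
     let r := / (A - c) in let X := (x - c) * r in let D := pot lam A - pot lam x in
     let D1 := dpot lam A - X * dpot lam x in
     let D2 := (1 + lam * cos A) - X ^ 2 * (1 + lam * cos x) in
     3 / 4 * D1 ^ 2 - r * D * D1 - / 2 * D * D2 + gam * (r ^ 2 * D ^ 2 - / 2 * r * D * D1) <= 0) ->
  dens2 lam c A u + gam * / (A - c) * dens1 lam c A u <= 0.
Proof.
  intros Hc Hu H. assert (Hp := phi_pos lam Hd c A u ltac:(lra) ltac:(lra)). assert (Hs := sqrt_lt_R0 _ Hp).
  rewrite dens_comb by lra.
  assert (Hx := point_range c A u ltac:(lra) Hu). set (x := A - (A - c) * u ^ 2) in *.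
  assert (H0 := pot_phi lam c A u (proj2 Hc)). fold x in H0.
  assert (H1 := phi1_variation lam c A u (proj2 Hc)). cbv zeta in H1. fold x in H1.
  assert (H2 := phi2_variation lam c A u (proj2 Hc)). cbv zeta in H2. fold x in H2.
  assert (Eu : (x - c) * / (A - c) = 1 - u ^ 2) by (unfold x; field; lra).
  assert (Hu2 : 0 < u ^ 2) by (apply pow_lt; lra).
  specialize (H x ltac:(lra)). cbv zeta in H. rewrite Eu in H.
  set (p0 := phi lam c A u) in *. set (p1 := phi1 lam c A u) in *. set (p2 := phi2 lam c A u) in *.
  set (D := pot lam A - pot lam x) in *. set (D1 := dpot lam A - (1 - u ^ 2) * dpot lam x) in *.
  set (D2 := 1 + lam * cos A - (1 - u ^ 2) ^ 2 * (1 + lam * cos x)) in *. set (L := A - c) in *.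
  assert (HL : 0 < L) by (unfold L; lra).
  set (B := 3 / 4 * D1 ^ 2 - / L * D * D1 - / 2 * D * D2 + gam * ((/ L) ^ 2 * D ^ 2 - / 2 * / L * D * D1)) in *.
  assert (E : 3 / 2 * p1 ^ 2 - p0 * p2 - gam * / L * p0 * p1 = 2 * B / (L ^ 4 * u ^ 4)).
  { replace (3 / 2 * p1 ^ 2 - p0 * p2 - gam * / L * p0 * p1) with
     ((3 / 2 * (L ^ 2 * u ^ 2 * p1) ^ 2 - (L ^ 2 * u ^ 2 * p0) * (L ^ 2 * u ^ 2 * p2) - gam * / L * (L ^ 2 * u ^ 2 * p0) * (L ^ 2 * u ^ 2 * p1)) / (L ^ 4 * u ^ 4)) by (field; lra).
    rewrite H2.
    replace (4 * L * u ^ 2 * p1) with (4 / L * (L ^ 2 * u ^ 2 * p1)) by (field; lra).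
    replace (2 * u ^ 2 * p0) with (2 / L ^ 2 * (L ^ 2 * u ^ 2 * p0)) by (field; lra).
    rewrite H1, <- H0. unfold B. field. lra. }
  rewrite E.
  replace (2 * B / (L ^ 4 * u ^ 4) / (p0 ^ 2 * sqrt p0)) with (B * (2 / (L ^ 4 * u ^ 4 * (p0 ^ 2 * sqrt p0)))) by (field; repeat split; lra).
  apply Rmult_le_0_r; [exact H |]. left. apply Rdiv_lt_0_compat; [lra |].
  pospow.
Qed.
End Variation.

(** * Splitting the period integral at a fixed point c *)

Section Split.
Variable lam : R.
Hypothesis Hd : forall y, 0 < y -> 0 < dpot lam y.

Definition outer (A x : R) : R := / sqrt (pot lam A - pot lam x).
Definition outer1 (A x : R) : R :=
  - / 2 * dpot lam A / ((pot lam A - pot lam x) * sqrt (pot lam A - pot lam x)).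
Definition outer2 (A x : R) : R :=
  (3 / 4 * dpot lam A ^ 2 - / 2 * (pot lam A - pot lam x) * (1 + lam * cos A)) /
  ((pot lam A - pot lam x) ^ 2 * sqrt (pot lam A - pot lam x)).

Lemma is_derive_outer A x : 0 < pot lam A - pot lam x -> is_derive (fun A => outer A x) A (outer1 A x).
Proof.
  intros Hp. assert (Hs := sqrt_lt_R0 _ Hp). assert (Es := sqrt_sqrt _ (Rlt_le _ _ Hp)).
  unfold outer. apply is_derive_val with ((0 * sqrt (pot lam A - pot lam x) - 1 * (dpot lam A / (2 * sqrt (pot lam A - pot lam x)))) / sqrt (pot lam A - pot lam x) ^ 2).
  - apply is_derive_ext with (fun A => 1 / sqrt (pot lam A - pot lam x)); [intros; unfold Rdiv; apply Rmult_1_l |].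
    apply (deriv_div (fun _ => 1) (fun A => sqrt (pot lam A - pot lam x))); [rderive | | lra].
    apply (deriv_sqrt (fun A => pot lam A - pot lam x)); [| exact Hp].
    eapply is_derive_val; [apply (deriv_minus (pot lam) (fun _ => pot lam x)); [apply is_derive_pot | rderive] | ring].
  - unfold outer1. set (D := pot lam A - pot lam x) in *. set (r := sqrt D) in *. rewrite <- Es. field. lra.
Qed.

Lemma is_derive_outer1 A x : 0 < pot lam A - pot lam x -> is_derive (fun A => outer1 A x) A (outer2 A x).
Proof.
  intros Hp. assert (Hs := sqrt_lt_R0 _ Hp). assert (Es := sqrt_sqrt _ (Rlt_le _ _ Hp)).
  assert (HD : is_derive (fun A => pot lam A - pot lam x) A (dpot lam A)).
  { eapply is_derive_val; [apply (deriv_minus (pot lam) (fun _ => pot lam x)); [apply is_derive_pot | rderive] | ring]. }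
  assert (Hg : is_derive (fun A => - / 2 * dpot lam A) A (- / 2 * (1 + lam * cos A))).
  { unfold dpot. eapply is_derive_val; [rderive; lra | ring]. }
  unfold outer1. eapply is_derive_val.
  - apply (deriv_div (fun A => - / 2 * dpot lam A) (fun A => (pot lam A - pot lam x) * sqrt (pot lam A - pot lam x))).
    + exact Hg.
    + apply (deriv_mult (fun A => pot lam A - pot lam x) (fun A => sqrt (pot lam A - pot lam x))); [exact HD |].
      apply (deriv_sqrt (fun A => pot lam A - pot lam x)); [exact HD | exact Hp].
    + apply Rgt_not_eq, Rmult_lt_0_compat; auto.
  - unfold outer2. set (D := pot lam A - pot lam x) in *. set (r := sqrt D) in *. rewrite <- Es. field. lra.
Qed.

Lemma outer_regular c y t : c < y -> 0 <= t <= c ->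
  locally_2d (fun u v => 0 < pot lam u - pot lam v) y t /\ continuity_2d_pt outer y t /\
  continuity_2d_pt outer1 y t /\ continuity_2d_pt outer2 y t.
Proof.
  intros Hy Ht. assert (Hp := pot_increasing lam Hd t y ltac:(lra)). assert (Hs := sqrt_lt_R0 _ Hp).
  assert (C : continuity_2d_pt (fun u v => pot lam u - pot lam v) y t) by (unfold pot; cont2; lra).
  assert (Cs : continuity_2d_pt (fun u v => sqrt (pot lam u - pot lam v)) y t) by (apply cont2_sqrt; auto; lra).
  assert (Cd : continuity_2d_pt (fun u v => dpot lam u) y t) by (unfold dpot; cont2; lra).
  split; [apply continuity_2d_pos; auto |].
  split; [| split].
  - unfold outer. apply (continuity_2d_pt_inv (fun u v => sqrt (pot lam u - pot lam v))); auto; lra.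
  - unfold outer1. apply (cont2_div (fun u v => - / 2 * dpot lam u) (fun u v => (pot lam u - pot lam v) * sqrt (pot lam u - pot lam v))).
    + apply (continuity_2d_pt_mult (fun _ _ => - / 2) (fun u v => dpot lam u)); [cont2 | auto].
    + apply (continuity_2d_pt_mult (fun u v => pot lam u - pot lam v) (fun u v => sqrt (pot lam u - pot lam v))); auto.
    + apply Rgt_not_eq, Rmult_lt_0_compat; auto.
  - unfold outer2. apply (cont2_div (fun u v => 3 / 4 * dpot lam u ^ 2 - / 2 * (pot lam u - pot lam v) * (1 + lam * cos u))
      (fun u v => (pot lam u - pot lam v) ^ 2 * sqrt (pot lam u - pot lam v))).
    + unfold pot, dpot. cont2; lra.
    + apply (continuity_2d_pt_mult (fun u v => (pot lam u - pot lam v) ^ 2) (fun u v => sqrt (pot lam u - pot lam v))); auto.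
      apply (cont2_pow (fun u v => pot lam u - pot lam v)); auto.
    + apply Rgt_not_eq, Rmult_lt_0_compat; auto. apply pow_lt; auto.
Qed.

Definition Tout (c A : R) : R := RInt (outer A) 0 c.

Lemma is_derive_Tout c A : 0 <= c < A -> is_derive (Tout c) A (RInt (outer1 A) 0 c).
Proof.
  intros H. apply (param_derive outer outer1 0 c c A); [lra | | lra].
  intros y t Hy Ht. destruct (outer_regular c y t Hy Ht) as (H0 & H1 & H2 & _). split; auto.
  apply locally_2d_impl with (2 := H0). apply locally_2d_forall. intros u v Hv. apply is_derive_outer; auto.
Qed.

Lemma is_derive_Tout1 c A : 0 <= c < A -> is_derive (fun A => RInt (outer1 A) 0 c) A (RInt (outer2 A) 0 c).
Proof.
  intros H. apply (param_derive outer1 outer2 0 c c A); [lra | | lra].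
  intros y t Hy Ht. destruct (outer_regular c y t Hy Ht) as (H0 & _ & H1 & H2). split; auto.
  apply locally_2d_impl with (2 := H0). apply locally_2d_forall. intros u v Hv. apply is_derive_outer1; auto.
Qed.

Lemma dens_scale c A k v : 0 < c < A -> 0 < k -> k ^ 2 = (A - c) / A -> 0 <= v <= 1 ->
  k * dens lam 0 A (k * v) = dens lam c A v.
Proof.
  intros Hc Hk Ek Hv. assert (Hp := phi_pos lam Hd c A v ltac:(lra) Hv).
  unfold dens. assert (E : phi lam 0 A (k * v) = k ^ 2 * phi lam c A v).
  { unfold phi. replace (mid 0 A (k * v)) with (mid c A v).
    - replace (hdf 0 A (k * v)) with (hdf c A v).
      + rewrite Ek. field. lra.
      + unfold hdf. replace ((k * v) ^ 2) with (k ^ 2 * v ^ 2) by ring. rewrite Ek. field. lra.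
    - unfold mid. replace ((k * v) ^ 2) with (k ^ 2 * v ^ 2) by ring. rewrite Ek. field. lra. }
  rewrite E, sqrt_mult by (try apply pow2_ge_0; lra). rewrite sqrt_pow2 by lra.
  assert (Hs := sqrt_lt_R0 _ Hp). field. lra.
Qed.

Lemma Tin_split c A : 0 < c < A -> Tin lam 0 A = Tout c A + Tin lam c A.
Proof.
  intros Hc. assert (Hr : 0 < (A - c) / A < 1).
  { split; [apply Rdiv_lt_0_compat; lra |]. apply Rmult_lt_reg_r with A; [lra |]. unfold Rdiv; rewrite Rmult_assoc, Rinv_l; lra. }
  (* In the substitution about 0, the point x = c corresponds to u = k. *)
  set (k := sqrt ((A - c) / A)). assert (Hk : 0 < k) by (apply sqrt_lt_R0; lra).
  assert (Ek : k ^ 2 = (A - c) / A) by (unfold k; rewrite <- Rsqr_pow2, Rsqr_sqrt; lra).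
  assert (Hk1 : k < 1) by nra.
  assert (Hcont : forall u, 0 <= u <= 1 -> continuous (dens lam 0 A) u) by (intros; apply dens_continuous; auto; lra).
  assert (Hex : forall a b, 0 <= a <= b -> b <= 1 -> ex_RInt (dens lam 0 A) a b).
  { intros a b Hab Hb. apply ex_RInt_cont; [lra |]. intros; apply Hcont; lra. }
  unfold Tin at 1. rewrite <- (RInt_Chasles (V := R_CompleteNormedModule) (dens lam 0 A) 0 k 1) by (apply Hex; lra).
  unfold plus; simpl. rewrite Rplus_comm. f_equal.
  - unfold Tout.
    assert (Hcomp := RInt_comp (V := R_CompleteNormedModule) (outer A) (fun u => A - A * u ^ 2) (fun u => - (2 * A * u)) k 1).
    rewrite Rmin_left, Rmax_right in Hcomp by lra.
    rewrite Ek in Hcomp. replace (A - A * ((A - c) / A)) with c in Hcomp by (field; lra).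
    replace (A - A * 1 ^ 2) with 0 in Hcomp by ring.
    rewrite <- (opp_RInt_swap (V := R_CompleteNormedModule) (outer A) c 0).
    2:{ apply ex_RInt_swap. apply ex_RInt_cont; [lra |].
        intros t Ht. apply continuity_2d_continuous. apply (outer_regular c A t); lra. }
    rewrite <- Hcomp.
    + rewrite <- (RInt_opp (V := R_CompleteNormedModule)).
      * apply RInt_ext. rewrite Rmin_left, Rmax_right by lra. intros u Hu.
        unfold opp, scal; simpl; unfold mult; simpl.
        assert (Hp := phi_pos lam Hd 0 A u ltac:(lra) ltac:(lra)). assert (Hs := sqrt_lt_R0 _ Hp).
        unfold outer, dens. assert (E := pot_phi lam 0 A u ltac:(lra)). rewrite Rminus_0_r in E.
        replace (u * (u * 1)) with (u ^ 2) by ring. rewrite E.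
        replace (A ^ 2 * u ^ 2) with ((A * u) ^ 2) by ring.
        rewrite sqrt_mult by (try apply pow2_ge_0; lra). rewrite sqrt_pow2 by nra. field. repeat split; nra.
      * apply ex_RInt_cont; [lra |]. intros u Hu.
        apply (continuous_scal (K := R_AbsRing) (V := R_NormedModule) (fun u => - (2 * A * u)) (fun u => outer A (A - A * u ^ 2))).
        -- apply (ex_derive_continuous (fun u => - (2 * A * u))). auto_derive; exact I.
        -- apply (continuous_comp (fun u => A - A * u ^ 2) (outer A)).
           ++ apply (ex_derive_continuous (fun u => A - A * u ^ 2)). auto_derive; exact I.
           ++ apply continuity_2d_continuous. apply (outer_regular c A); [lra |].
              assert (k ^ 2 <= u ^ 2 <= 1 ^ 2) by (split; apply pow_incr; lra). rewrite Ek in H.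
              assert (A * ((A - c) / A) <= A * u ^ 2 <= A * 1 ^ 2) by (split; apply Rmult_le_compat_l; lra).
              replace (A * ((A - c) / A)) with (A - c) in H0 by (field; lra). lra.
    + intros u Hu. apply continuity_2d_continuous. apply (outer_regular c A); [lra |].
      assert (k ^ 2 <= u ^ 2 <= 1 ^ 2) by (split; apply pow_incr; lra). rewrite Ek in H.
      assert (A * ((A - c) / A) <= A * u ^ 2 <= A * 1 ^ 2) by (split; apply Rmult_le_compat_l; lra).
      replace (A * ((A - c) / A)) with (A - c) in H0 by (field; lra). lra.
    + intros u Hu. split; [auto_derive; [exact I | ring] |].
      apply (ex_derive_continuous (fun u => - (2 * A * u))). auto_derive; exact I.
  - unfold Tin. assert (Hl := RInt_comp_lin (V := R_CompleteNormedModule) (dens lam 0 A) k 0 0 1).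
    replace (k * 0 + 0) with 0 in Hl by ring. replace (k * 1 + 0) with k in Hl by ring.
    rewrite <- Hl by (apply Hex; lra). apply RInt_ext. rewrite Rmin_left, Rmax_right by lra. intros v Hv.
    unfold scal; simpl; unfold mult; simpl. rewrite Rplus_0_r. apply dens_scale; lra.
Qed.

(** With c constant near A, the split integral is differentiated at fixed x on [0, c] and by
    dilation on [c, A]; uniqueness of derivatives identifies the results with [Tin1] and [Tin2]. The
    added multiple [k] of T' vanishes as a whole, though not on each piece. *)
Lemma newton_concave A : 0 < A -> newton_split lam A -> Tin1 lam 0 A = 0 -> Tin2 lam 0 A < 0.
Proof.
  intros HA (c & gam & Hc & Hgam & HO & HI) H0.
  assert (E1 : forall B, c < B -> Tin1 lam 0 B = RInt (outer1 B) 0 c + Tin1 lam c B).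
  { intros B HB. assert (H1 := is_derive_Tin lam Hd 0 B ltac:(lra)).
    assert (H2 : is_derive (Tin lam 0) B (RInt (outer1 B) 0 c + Tin1 lam c B)).
    { apply is_derive_ext_loc with (fun B => Tout c B + Tin lam c B).
      - apply filter_imp with (2 := open_gt c B HB). intros t Ht. symmetry. apply Tin_split. change (c < t) in Ht. lra.
      - apply (deriv_plus (Tout c) (Tin lam c)); [apply is_derive_Tout | apply is_derive_Tin]; auto; lra. }
    rewrite <- (is_derive_unique _ _ _ H1). apply (is_derive_unique _ _ _ H2). }
  assert (E2 : Tin2 lam 0 A = RInt (outer2 A) 0 c + Tin2 lam c A).
  { assert (H1 := is_derive_Tin1 lam Hd 0 A ltac:(lra)).
    assert (H2 : is_derive (Tin1 lam 0) A (RInt (outer2 A) 0 c + Tin2 lam c A)).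
    { apply is_derive_ext_loc with (fun B => RInt (outer1 B) 0 c + Tin1 lam c B).
      - apply filter_imp with (2 := open_gt c A (proj2 Hc)). intros t Ht. symmetry. apply E1, Ht.
      - apply (deriv_plus (fun B => RInt (outer1 B) 0 c) (Tin1 lam c)); [apply is_derive_Tout1 | apply is_derive_Tin1]; auto; lra. }
    rewrite <- (is_derive_unique _ _ _ H1). apply (is_derive_unique _ _ _ H2). }
  set (k := gam * / (A - c)).
  assert (Cout1 : forall x, 0 <= x <= c -> continuous (outer1 A) x).
  { intros x Hx. apply continuity_2d_continuous, (outer_regular c A x ltac:(lra) Hx). }
  assert (Cout2 : forall x, 0 <= x <= c -> continuous (outer2 A) x).
  { intros x Hx. apply continuity_2d_continuous, (outer_regular c A x ltac:(lra) Hx). }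
  assert (HOut : RInt (outer2 A) 0 c + k * RInt (outer1 A) 0 c < 0).
  { rewrite <- RInt_lin_comb; [| lra | intros; apply Cout2; lra | intros; apply Cout1; lra].
    apply Ropp_lt_cancel. rewrite Ropp_0.
    assert (HC : forall x, 0 <= x <= c -> continuous (fun x => outer2 A x + k * outer1 A x) x).
    { intros x Hx. apply (continuous_plus (V := R_NormedModule)); [apply Cout2; lra |].
      apply continuous_const_mult. apply Cout1; lra. }
    change (- RInt (fun x => outer2 A x + k * outer1 A x) 0 c) with (opp (RInt (fun x => outer2 A x + k * outer1 A x) 0 c)).
    rewrite <- (RInt_opp (V := R_CompleteNormedModule)).
    2:{ apply ex_RInt_cont; [lra |]. apply HC. }
    apply RInt_gt_0; [lra | |].
    - intros x Hx. unfold opp; simpl. assert (Hp := pot_increasing lam Hd x A ltac:(lra)). assert (Hs := sqrt_lt_R0 _ Hp).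
      specialize (HO x ltac:(lra)). fold k in HO.
      unfold outer1, outer2. set (D := pot lam A - pot lam x) in *.
      set (r := sqrt D) in *.
      replace (- ((3 / 4 * dpot lam A ^ 2 - / 2 * D * (1 + lam * cos A)) / (D ^ 2 * r) + k * (- / 2 * dpot lam A / (D * r)))) with
        (- (3 / 4 * dpot lam A ^ 2 - / 2 * D * (1 + lam * cos A + k * dpot lam A)) / (D ^ 2 * r)) by (field; lra).
      apply Rdiv_lt_0_compat; [lra | apply Rmult_lt_0_compat; auto; apply pow_lt; auto].
    - intros x Hx. apply (continuous_opp (V := R_NormedModule)). apply HC; auto. }
  assert (HIn : Tin2 lam c A + k * Tin1 lam c A <= 0).
  { unfold Tin1, Tin2. rewrite <- RInt_lin_comb; [| lra | intros; apply dens2_continuous; auto; lra | intros; apply dens1_continuous; auto; lra].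
    replace 0 with (RInt (fun _ => 0) 0 1) at 2 by (rewrite RInt_const; unfold scal; simpl; unfold mult; simpl; ring).
    apply RInt_le; [lra | | |].
    - apply ex_RInt_cont; [lra |]. intros u Hu.
      apply (continuous_plus (V := R_NormedModule)); [apply dens2_continuous; auto; lra |].
      apply continuous_const_mult. apply dens1_continuous; auto; lra.
    - apply ex_RInt_const.
    - intros u Hu. apply dens_newton_le; auto; lra. }
  rewrite E1 in H0 by lra. assert (k * (RInt (outer1 A) 0 c + Tin1 lam c A) = 0) by (rewrite H0; ring). lra.
Qed.
End Split.

(** * The periodic orbits *)

(** Inverse function rule on open convex domains: monotonicity of [tau] makes the inverse
    continuous, and the mean value theorem gives its derivative. It yields both the angle as a
    function of time and the amplitude as a function of energy. *)
Lemma derive_inverse (D E : R -> Prop) (tau v Th : R -> R) :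
  (forall a b x, D a -> D b -> a <= x <= b -> D x) ->
  (forall th, D th -> locally th D) -> (forall t, E t -> locally t E) ->
  (forall th, D th -> is_derive tau th (/ v th) /\ 0 < v th /\ continuous v th) ->
  (forall t, E t -> D (Th t) /\ tau (Th t) = t) ->
  forall t, E t -> is_derive Th t (v (Th t)).
Proof.
  intros HDc HDo HEo Htau HTh t0 Ht0. destruct (HTh t0 Ht0) as [HD0 E0]. set (th0 := Th t0) in *.
  assert (Hinc : forall a b, D a -> D b -> a < b -> tau a < tau b).
  { intros a b Ha Hb Hab. apply derive_pos_lt with (df := fun th => / v th); auto.
    - intros x Hx. apply Htau, (HDc a b); auto.
    - intros x Hx. apply Rinv_0_lt_compat, Htau, (HDc a b); auto; lra. }
  assert (Hcont : forall eps : posreal, locally t0 (fun t => Rabs (Th t - th0) < eps)).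
  { intros eps. destruct (HDo th0 HD0) as [e1 He1]. set (e := Rmin (eps / 2) (e1 / 2)).
    assert (He : 0 < e /\ e <= eps / 2 /\ e <= e1 / 2).
    { generalize (cond_pos eps) (cond_pos e1). unfold e. generalize (Rmin_l (eps / 2) (e1 / 2)) (Rmin_r (eps / 2) (e1 / 2)).
      repeat split; try lra. apply Rmin_glb_lt; lra. }
    assert (D1 : D (th0 - e)).
    { apply He1. change (Rabs (th0 - e - th0) < e1). generalize (cond_pos e1). replace (th0 - e - th0) with (- e) by ring. rewrite Rabs_Ropp, Rabs_right; lra. }
    assert (D2 : D (th0 + e)).
    { apply He1. change (Rabs (th0 + e - th0) < e1). generalize (cond_pos e1). replace (th0 + e - th0) with e by ring. rewrite Rabs_right; lra. }
    assert (L1 := Hinc _ _ D1 HD0 ltac:(lra)). assert (L2 := Hinc _ _ HD0 D2 ltac:(lra)). rewrite E0 in L1, L2.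
    apply filter_imp with (2 := filter_and _ _ (HEo t0 Ht0) (filter_and _ _ (open_gt _ _ L1) (open_lt _ _ L2))).
    intros t (Het & Hl & Hr). destruct (HTh t Het) as [Dt Et].
    change (tau (th0 - e) < t) in Hl. change (t < tau (th0 + e)) in Hr.
    assert (th0 - e < Th t).
    { apply Rnot_le_lt; intros Hn. destruct Hn as [Hn | Hn]; [generalize (Hinc _ _ Dt D1 Hn); lra | rewrite <- Hn in Hl; lra]. }
    assert (Th t < th0 + e).
    { apply Rnot_le_lt; intros Hn. destruct Hn as [Hn | Hn]; [generalize (Hinc _ _ D2 Dt Hn); lra | rewrite Hn in Hr; lra]. }
    apply Rabs_def1; generalize (cond_pos eps); lra. }
  apply is_derive_Reals. intros eps Heps.
  destruct (Htau th0 HD0) as (_ & Hv0 & Cv).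
  assert (Cv' := proj1 (continuity_pt_locally v th0) (proj2 (continuity_pt_filterlim v th0) Cv) (mkposreal eps Heps)).
  destruct Cv' as [d1 Hd1]. simpl in Hd1.
  destruct (filter_and _ _ (HEo t0 Ht0) (Hcont d1)) as [d2 Hd2].
  exists d2. intros h Hh0 Hh. destruct (Hd2 (t0 + h)) as [Het Hclose].
  { change (Rabs (t0 + h - t0) < d2). replace (t0 + h - t0) with h by ring. exact Hh. }
  destruct (HTh _ Het) as [Dt Et].
  assert (Hne : Th (t0 + h) <> th0) by (intros Hn; rewrite Hn, E0 in Et; lra).
  destruct (MVT_gen tau th0 (Th (t0 + h)) (fun th => / v th)) as [xi [Hxi Exi]].
  - intros x Hx. apply Htau. unfold Rmin, Rmax in Hx. destruct Rle_dec; [apply (HDc th0 (Th (t0 + h))) | apply (HDc (Th (t0 + h)) th0)]; auto; lra.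
  - intros x Hx. apply derivable_continuous_pt. exists (/ v x). apply is_derive_Reals, Htau.
    unfold Rmin, Rmax in Hx. destruct Rle_dec; [apply (HDc th0 (Th (t0 + h))) | apply (HDc (Th (t0 + h)) th0)]; auto; lra.
  - assert (Dxi : D xi).
    { unfold Rmin, Rmax in Hxi. destruct Rle_dec; [apply (HDc th0 (Th (t0 + h))) | apply (HDc (Th (t0 + h)) th0)]; auto; lra. }
    destruct (Htau xi Dxi) as (_ & Hvx & _). rewrite Et, E0 in Exi.
    assert (Eq : (Th (t0 + h) - th0) / h = v xi).
    { apply Rmult_eq_reg_l with (h * / v xi); [| apply Rmult_integral_contrapositive_currified; [auto | apply Rinv_neq_0_compat; lra]].
      replace (h * / v xi * ((Th (t0 + h) - th0) / h)) with (/ v xi * (Th (t0 + h) - th0)) by (field; split; lra).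
      rewrite <- Exi. field; lra. }
    fold th0. rewrite Eq. apply Hd1. change (Rabs (xi - th0) < d1).
    apply Rle_lt_trans with (2 := Hclose). unfold Rmin, Rmax in Hxi. unfold Rabs. repeat destruct Rcase_abs; destruct Rle_dec; lra.
Qed.

Section Orbit.
Variable lam : R.
Hypothesis Hd : forall y, 0 < y -> 0 < dpot lam y.
Variable A : R.
Hypothesis HA : 0 < A.

Definition mid_th (th : R) : R := A * (1 + sin th) / 2.
Definition hdf_th (th : R) : R := A * (1 - sin th) / 2.
(* squared angular speed of the orbit of amplitude A when x = A sin th *)
Definition speed2 (th : R) : R := 1 + lam * (sinc (mid_th th) * sinc (hdf_th th)).
Definition dspeed2 (th : R) : R :=
  lam * (A * cos th / 2 * sinc1 (mid_th th) * sinc (hdf_th th) - A * cos th / 2 * (sinc (mid_th th) * sinc1 (hdf_th th))).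

Lemma is_derive_speed2 th : is_derive speed2 th (dspeed2 th).
Proof.
  unfold speed2, dspeed2, mid_th, hdf_th. eapply is_derive_val; [rderive; lra |]. field.
Qed.

Lemma pot_even x : pot lam (- x) = pot lam x.
Proof. unfold pot. rewrite cos_neg. field. Qed.

Lemma pot_speed2 th : pot lam A - pot lam (A * sin th) = A ^ 2 * cos th ^ 2 * speed2 th / 2.
Proof.
  unfold speed2. set (m := mid_th th). set (d := hdf_th th).
  assert (E1 : A = m + d) by (unfold m, d, mid_th, hdf_th; field).
  assert (E2 : A * sin th = m - d) by (unfold m, d, mid_th, hdf_th; field).
  assert (E3 : A ^ 2 * cos th ^ 2 = 4 * (m * d)).
  { unfold m, d, mid_th, hdf_th. replace (cos th ^ 2) with (1 - sin th ^ 2) by (generalize (sin2_cos2' th); lra). field. }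
  rewrite E3, E2. rewrite E1 at 1.
  replace (4 * (m * d) * (1 + lam * (sinc m * sinc d)) / 2) with (2 * (m * d) + 2 * lam * ((m * sinc m) * (d * sinc d))) by field.
  rewrite !mul_sinc. unfold pot. rewrite cos_plus, cos_minus. field.
Qed.

Lemma speed2_pole th : cos th = 0 -> speed2 th = dpot lam A / A.
Proof.
  intros Hc. unfold speed2, mid_th, hdf_th. generalize (sin2_cos2' th); rewrite Hc; intros Hs.
  assert (E : dpot lam A / A = 1 + lam * sinc A) by (unfold dpot; rewrite <- mul_sinc; field; lra). rewrite E.
  assert (H : (sin th - 1) * (sin th + 1) = 0) by lra. apply Rmult_integral in H. destruct H.
  - replace (sin th) with 1 by lra. replace (A * (1 + 1) / 2) with A by field. replace (A * (1 - 1) / 2) with 0 by field.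
    rewrite sinc_0. ring.
  - replace (sin th) with (-1) by lra. replace (A * (1 - -1) / 2) with A by field. replace (A * (1 + -1) / 2) with 0 by field.
    rewrite sinc_0. ring.
Qed.

Lemma pot_abs_lt x y : Rabs x < Rabs y -> pot lam x < pot lam y.
Proof.
  intros H. assert (E : forall x, pot lam (Rabs x) = pot lam x).
  { intros z. unfold Rabs; destruct Rcase_abs; [apply pot_even | auto]. }
  rewrite <- (E x), <- (E y). generalize (pot_increasing lam Hd (Rabs x) (Rabs y)) (Rabs_pos x). lra.
Qed.

Lemma speed2_pos th : 0 < speed2 th.
Proof.
  destruct (Req_dec (cos th) 0) as [Hc | Hc].
  - rewrite speed2_pole by auto. apply Rdiv_lt_0_compat; auto.
  - assert (0 < A ^ 2 * cos th ^ 2) by (apply Rmult_lt_0_compat; [apply pow_lt; auto | apply pow2_gt_0; auto]).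
    assert (Hp := pot_speed2 th). assert (pot lam (A * sin th) < pot lam A).
    { apply pot_abs_lt. rewrite Rabs_mult, (Rabs_right A) by lra.
      assert (Rabs (sin th) < 1); [| nra]. generalize (sin2_cos2' th) (pow2_gt_0 _ Hc); intros.
      apply Rabs_def1; nra. }
    apply Rmult_lt_reg_l with (A ^ 2 * cos th ^ 2); lra.
Qed.

(** The second equation of motion in angular form: [pot_speed2] differentiated in th and divided by
    - A cos th. The turning points cos th = 0 are checked directly. *)
Lemma force_speed2 th : dpot lam (A * sin th) = A * sin th * speed2 th - / 2 * (A * cos th) * dspeed2 th.
Proof.
  destruct (Req_dec (cos th) 0) as [Hc | Hc].
  - rewrite Hc, speed2_pole by auto. unfold dpot. generalize (sin2_cos2' th); rewrite Hc; intros Hs.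
    assert (H : (sin th - 1) * (sin th + 1) = 0) by lra. apply Rmult_integral in H. destruct H.
    + replace (sin th) with 1 by lra. rewrite Rmult_1_r. field; lra.
    + replace (sin th) with (- 1) by lra. replace (A * -1) with (- A) by ring. rewrite sin_neg. field; lra.
  - assert (H1 : is_derive (fun th => pot lam A - pot lam (A * sin th)) th (- (A * cos th * dpot lam (A * sin th)))).
    { unfold pot, dpot. eapply is_derive_val; [rderive; lra | simpl INR; simpl pred; field]. }
    assert (H2 : is_derive (fun th => pot lam A - pot lam (A * sin th)) th
        (A ^ 2 * (- 2 * cos th * sin th * speed2 th + cos th ^ 2 * dspeed2 th) / 2)).
    { apply is_derive_ext with (fun th => A ^ 2 * cos th ^ 2 * speed2 th / 2); [intros; symmetry; apply pot_speed2 |].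
      assert (Hw := is_derive_speed2). eapply is_derive_val.
      - apply (deriv_div (fun th => A ^ 2 * cos th ^ 2 * speed2 th) (fun _ => 2)); [| rderive | lra].
        apply (deriv_mult (fun th => A ^ 2 * cos th ^ 2) speed2); [rderive | apply Hw].
      - simpl INR; simpl pred. field. }
    assert (E := is_derive_unique _ _ _ H1). rewrite (is_derive_unique _ _ _ H2) in E.
    apply Rmult_eq_reg_l with (- (A * cos th)); [| apply Ropp_neq_0_compat, Rmult_integral_contrapositive_currified; lra].
    transitivity (- (A * cos th * dpot lam (A * sin th))); [ring |]. rewrite <- E. field.
Qed.

Definition clock (th : R) : R := / sqrt (speed2 th).

Lemma clock_pos th : 0 < clock th.
Proof. apply Rinv_0_lt_compat, sqrt_lt_R0, speed2_pos. Qed.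

Lemma ex_derive_sqrt_speed2 th : is_derive (fun th => sqrt (speed2 th)) th (dspeed2 th / (2 * sqrt (speed2 th))).
Proof. apply deriv_sqrt; [apply is_derive_speed2 | apply speed2_pos]. Qed.

Lemma clock_continuous th : continuous clock th.
Proof.
  apply (ex_derive_continuous clock). eexists. apply (is_derive_inv (fun th => sqrt (speed2 th))).
  - apply ex_derive_sqrt_speed2.
  - apply Rgt_not_eq, sqrt_lt_R0, speed2_pos.
Qed.

Lemma ex_RInt_clock a b : ex_RInt clock a b.
Proof. apply (ex_RInt_continuous (V := R_CompleteNormedModule)). intros; apply clock_continuous. Qed.

Lemma clock_opp th : clock (- th) = clock th.
Proof.
  unfold clock, speed2, mid_th, hdf_th. rewrite sin_neg. do 2 f_equal.
  replace (1 + - sin th) with (1 - sin th) by ring. replace (1 - - sin th) with (1 + sin th) by ring. ring.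
Qed.
Lemma clock_PI th : clock (th + PI) = clock th.
Proof. rewrite <- (clock_opp th). unfold clock, speed2, mid_th, hdf_th. rewrite neg_sin, sin_neg. reflexivity. Qed.

Definition time (th : R) : R := RInt clock 0 th.

Lemma is_derive_time th : is_derive time th (clock th).
Proof.
  apply (is_derive_RInt (V := R_NormedModule) clock time 0 th).
  - apply filter_forall. intros y. apply (RInt_correct (V := R_CompleteNormedModule)). apply ex_RInt_clock.
  - apply clock_continuous.
Qed.

Lemma time_incr a b : a < b -> time a < time b.
Proof. intros H. apply derive_pos_lt with (df := clock); auto; intros; [apply is_derive_time | apply clock_pos]. Qed.

Lemma RInt_clock_shift a b c : (forall th, clock (th + c) = clock th) -> RInt clock (a + c) (b + c) = RInt clock a b.
Proof.
  intros Hc. assert (H := RInt_comp_lin (V := R_CompleteNormedModule) clock 1 c a b).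
  rewrite !Rmult_1_l in H. rewrite <- H by apply ex_RInt_clock. apply RInt_ext. intros x _.
  unfold scal; simpl; unfold mult; simpl. rewrite !Rmult_1_l. apply Hc.
Qed.

Lemma time_shift th : time (th + 2 * PI) = time th + time (2 * PI).
Proof.
  unfold time. rewrite <- (RInt_Chasles (V := R_CompleteNormedModule) clock 0 (2 * PI) (th + 2 * PI)) by apply ex_RInt_clock.
  unfold plus; simpl. rewrite Rplus_comm. f_equal.
  assert (H := RInt_clock_shift 0 th (2 * PI)). rewrite Rplus_0_l in H. apply H.
  intros t. replace (t + 2 * PI) with ((t + PI) + PI) by ring. rewrite !clock_PI. reflexivity.
Qed.

Lemma time_period : time (2 * PI) = 4 * RInt clock 0 (PI / 2).
Proof.
  unfold time. rewrite <- (RInt_Chasles (V := R_CompleteNormedModule) clock 0 PI (2 * PI)) by apply ex_RInt_clock.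
  assert (H := RInt_clock_shift 0 PI PI clock_PI). rewrite Rplus_0_l in H. replace (PI + PI) with (2 * PI) in H by ring. rewrite H.
  rewrite <- (RInt_Chasles (V := R_CompleteNormedModule) clock 0 (PI / 2) PI) by apply ex_RInt_clock.
  assert (E : RInt clock (PI / 2) PI = RInt clock 0 (PI / 2)).
  { assert (Hl := RInt_comp_lin (V := R_CompleteNormedModule) clock (-1) PI 0 (PI / 2)).
    replace (-1 * 0 + PI) with PI in Hl by ring. replace (-1 * (PI / 2) + PI) with (PI / 2) in Hl by field.
    rewrite <- (opp_RInt_swap (V := R_CompleteNormedModule) clock) by apply ex_RInt_clock. rewrite <- Hl by apply ex_RInt_clock.
    rewrite <- (RInt_opp (V := R_CompleteNormedModule)).
    - apply RInt_ext. intros x _. unfold opp, scal; simpl; unfold mult; simpl.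
      rewrite clock_PI. replace (-1 * x) with (- x) by ring. rewrite clock_opp. ring.
    - apply (ex_RInt_comp_lin (V := R_NormedModule) clock). apply ex_RInt_clock. }
  unfold plus; simpl. rewrite E. ring.
Qed.

(** The substitution is u^2 = 1 - sin th, that is x = A sin th; writing u as sqrt 2 sin (PI / 4 - th
    / 2) keeps it smooth at th = PI / 2. *)
Lemma clock_Tin : Tin lam 0 A = sqrt 2 * RInt clock 0 (PI / 2).
Proof.
  generalize PI_bounds; intros HP. assert (Hs2 : 0 < sqrt 2) by (apply sqrt_lt_R0; lra).
  assert (E2 : sqrt 2 * sqrt 2 = 2) by (apply sqrt_sqrt; lra).
  set (g := fun th => sqrt 2 * sin (PI / 4 - th / 2)). set (dg := fun th => - (sqrt 2 / 2) * cos (PI / 4 - th / 2)).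
  assert (Hg2 : forall th, g th ^ 2 = 1 - sin th).
  { intros th. unfold g. replace ((sqrt 2 * sin (PI / 4 - th / 2)) ^ 2) with ((sqrt 2 * sqrt 2) * sin (PI / 4 - th / 2) ^ 2) by ring.
    rewrite E2. assert (H := cos_2a_sin (PI / 4 - th / 2)). replace (2 * (PI / 4 - th / 2)) with (PI / 2 - th) in H by field.
    rewrite cos_shift in H. lra. }
  assert (Hcs : forall th, 0 <= th <= PI / 2 -> 0 < cos (PI / 4 - th / 2) /\ 0 <= g th <= 1 /\ 2 * cos (PI / 4 - th / 2) ^ 2 = 1 + sin th).
  { intros th Hth. assert (0 <= sin (PI / 4 - th / 2)) by (apply sin_ge_0; lra).
    assert (0 < cos (PI / 4 - th / 2)) by (apply cos_gt_0; lra).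
    assert (0 <= g th) by (apply Rmult_le_pos; lra). assert (0 <= sin th) by (apply sin_ge_0; lra).
    generalize (Hg2 th) (sin2_cos2' (PI / 4 - th / 2)); intros. repeat split; auto; [nra |].
    assert (g th ^ 2 = 2 * sin (PI / 4 - th / 2) ^ 2) by (unfold g; replace ((sqrt 2 * sin (PI / 4 - th / 2)) ^ 2) with ((sqrt 2 * sqrt 2) * sin (PI / 4 - th / 2) ^ 2) by ring; rewrite E2; ring).
    lra. }
  assert (Hphi : forall th, phi lam 0 A (g th) = (1 + sin th) / 2 * speed2 th).
  { intros th. unfold phi. replace (mid 0 A (g th)) with (mid_th th) by (unfold mid, mid_th; rewrite Hg2; field).
    replace (hdf 0 A (g th)) with (hdf_th th) by (unfold hdf, hdf_th; rewrite Hg2; field).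
    unfold speed2. rewrite <- (mul_sinc (mid_th th)). unfold mid_th at 1 2. field. lra. }
  assert (Hcd : forall u, 0 <= u <= 1 -> continuous (dens lam 0 A) u) by (intros; apply dens_continuous; auto; lra).
  assert (Hdg : forall th, is_derive g th (dg th) /\ continuous dg th).
  { intros th. split.
    - unfold g, dg. auto_derive; [exact I |]. unfold Rdiv, Rminus. field.
    - apply (ex_derive_continuous dg). unfold dg. auto_derive. exact I. }
  assert (Hc := RInt_comp (V := R_CompleteNormedModule) (dens lam 0 A) g dg 0 (PI / 2)).
  rewrite Rmin_left, Rmax_right in Hc by lra.
  replace (g 0) with 1 in Hc.
  2:{ unfold g. replace (PI / 4 - 0 / 2) with (PI / 4) by field. rewrite sin_PI4. field. lra. }
  replace (g (PI / 2)) with 0 in Hc.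
  2:{ unfold g. replace (PI / 4 - PI / 2 / 2) with 0 by field. rewrite sin_0. ring. }
  unfold Tin. rewrite <- (opp_RInt_swap (V := R_CompleteNormedModule) (dens lam 0 A) 1 0).
  2:{ apply ex_RInt_swap, ex_RInt_cont; [lra |]. auto. }
  rewrite <- Hc.
  - rewrite <- (RInt_opp (V := R_CompleteNormedModule)).
    + rewrite <- (RInt_scal (V := R_CompleteNormedModule) clock); [| apply ex_RInt_clock].
      apply RInt_ext. rewrite Rmin_left, Rmax_right by lra. intros th Hth.
      destruct (Hcs th ltac:(lra)) as (Hc0 & _ & Ec). unfold opp, scal; simpl; unfold mult; simpl.
      unfold dens, clock, dg. rewrite Hphi, <- Ec.
      replace (2 * cos (PI / 4 - th / 2) ^ 2 / 2 * speed2 th) with (cos (PI / 4 - th / 2) ^ 2 * speed2 th) by field.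
      assert (Hw := speed2_pos th). assert (Hsw := sqrt_lt_R0 _ Hw).
      rewrite sqrt_mult by (try apply pow2_ge_0; lra). rewrite sqrt_pow2 by lra. field. split; lra.
    + apply ex_RInt_cont; [lra |]. intros th Hth.
      apply (continuous_scal (K := R_AbsRing) (V := R_NormedModule) dg (fun th => dens lam 0 A (g th))); [apply Hdg |].
      apply (continuous_comp g (dens lam 0 A)).
      * apply (ex_derive_continuous g). eexists. apply Hdg.
      * apply Hcd, Hcs; auto.
  - intros th Hth. apply Hcd, Hcs; auto.
  - intros; apply Hdg.
Qed.
End Orbit.

(** * Level curves as periodic orbits *)

Section Level.
Variable lam : R.
Hypothesis Hd : forall y, 0 < y -> 0 < dpot lam y.

Lemma G_pot x : G lam x = pot lam x.
Proof. apply G_closed_form. Qed.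

Lemma time_surj A : 0 < A -> forall t, exists th, time lam A th = t.
Proof.
  intros HA t. generalize PI_bounds; intros HP. set (P := time lam A (2 * PI)).
  assert (T0 : time lam A 0 = 0) by (apply (RInt_point (V := R_CompleteNormedModule))).
  assert (HP0 : 0 < P) by (rewrite <- T0; apply time_incr; auto; lra).
  assert (Hn : forall n : nat, time lam A (INR n * (2 * PI)) = INR n * P /\ time lam A (- (INR n * (2 * PI))) = - (INR n * P)).
  { induction n as [| n [I1 I2]].
    - simpl INR. rewrite !Rmult_0_l, Ropp_0, T0. lra.
    - rewrite S_INR. split.
      + replace ((INR n + 1) * (2 * PI)) with (INR n * (2 * PI) + 2 * PI) by ring. rewrite time_shift by auto. fold P. rewrite I1. ring.
      + assert (H := time_shift lam Hd A HA (- ((INR n + 1) * (2 * PI)))).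
        replace (- ((INR n + 1) * (2 * PI)) + 2 * PI) with (- (INR n * (2 * PI))) in H by ring. fold P in H. lra. }
  destruct (INR_unbounded (Rabs t / P)) as [n Hb].
  assert (Hb' : Rabs t < INR n * P).
  { replace (Rabs t) with (Rabs t / P * P) by (field; lra). apply Rmult_lt_compat_r; auto. }
  destruct (Hn n) as [H1 H2]. apply Rabs_def2 in Hb'.
  assert (Hc : continuity (fun th => time lam A th - t)).
  { intros x. apply derivable_continuous_pt. exists (clock lam A x - 0). apply is_derive_Reals.
    apply (deriv_minus (time lam A) (fun _ => t)); [apply is_derive_time; auto | apply deriv_const]. }
  assert (Hn0 : 0 < INR n * (2 * PI)).
  { apply Rmult_lt_0_compat; [| lra]. apply Rmult_lt_reg_r with P; auto. lra. }
  destruct (IVT_cor _ (- (INR n * (2 * PI))) (INR n * (2 * PI)) Hc) as [th [_ E]]; [lra | |].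
  - rewrite H1, H2. assert (0 <= (INR n * P + t) * (INR n * P - t)) by (apply Rmult_le_pos; lra). lra.
  - exists th. lra.
Qed.

(** The factor is that of T = 4 times the integral of dx / |y| over [0, A], with |y| = sqrt (2 (G(A)
    - G(x))). The orbit is obtained by inverting time as a function of the angle. *)
Lemma level_period_amp A : 0 < A -> level_period lam (pot lam A) (2 * sqrt 2 * Tin lam 0 A).
Proof.
  intros HA. generalize PI_bounds; intros HP.
  assert (Hs2 : sqrt 2 * sqrt 2 = 2) by (apply sqrt_sqrt; lra).
  set (P := time lam A (2 * PI)).
  replace (2 * sqrt 2 * Tin lam 0 A) with P.
  2:{ unfold P. rewrite (clock_Tin lam Hd A HA), (time_period lam Hd A HA).
      replace (2 * sqrt 2 * (sqrt 2 * RInt (clock lam A) 0 (PI / 2))) with (2 * (sqrt 2 * sqrt 2) * RInt (clock lam A) 0 (PI / 2)) by ring.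
      rewrite Hs2. ring. }
  set (w := fun th => sqrt (speed2 lam A th)).
  assert (Hw : forall th, 0 < w th) by (intros; apply sqrt_lt_R0, speed2_pos; auto).
  assert (Ew : forall th, w th * w th = speed2 lam A th) by (intros; apply sqrt_sqrt, Rlt_le, speed2_pos; auto).
  set (Th := fun t => proj1_sig (constructive_indefinite_description _ (time_surj A HA t))).
  assert (ETh : forall t, time lam A (Th t) = t) by (intros t; unfold Th; destruct constructive_indefinite_description; auto).
  assert (Hinj : forall a b, time lam A a = time lam A b -> a = b).
  { intros a b E. destruct (Rtotal_order a b) as [H | [H | H]]; auto; apply (time_incr lam Hd A HA) in H; lra. }
  assert (HTh : forall t, is_derive Th t (w (Th t))).
  { intros t. apply (derive_inverse (fun _ => True) (fun _ => True) (time lam A) w Th); auto.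
    - intros; apply filter_forall; auto.
    - intros; apply filter_forall; auto.
    - intros th _. split; [apply is_derive_time; auto |]. split; auto.
      apply (ex_derive_continuous w). eexists. apply ex_derive_sqrt_speed2; auto. }
  assert (Hshift : forall t, Th (t + P) = Th t + 2 * PI).
  { intros t. apply Hinj. rewrite ETh, time_shift, ETh by auto. reflexivity. }
  assert (Th0 : Th 0 = 0) by (apply Hinj; rewrite ETh; symmetry; apply (RInt_point (V := R_CompleteNormedModule))).
  exists (fun t => A * sin (Th t)), (fun t => - (A * cos (Th t) * w (Th t))).
  split; [| split; [| split; [| split]]].
  - intros t. assert (H := HTh t). split.
    + apply is_derive_val with (A * (w (Th t) * cos (Th t))); [| ring].
      apply (is_derive_scal (fun t => sin (Th t))). apply deriv_sin; auto.
    + change (A * sin (Th t) + lam * sin (A * sin (Th t))) with (dpot lam (A * sin (Th t))).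
      rewrite (force_speed2 lam A HA), <- Ew.
      assert (Dw : is_derive (fun t => w (Th t)) t (w (Th t) * (dspeed2 lam A (Th t) / (2 * w (Th t))))).
      { apply (is_derive_comp w Th); auto. apply ex_derive_sqrt_speed2; auto. }
      eapply is_derive_val.
      * apply (deriv_opp (fun t => A * cos (Th t) * w (Th t))).
        apply (deriv_mult (fun t => A * cos (Th t)) (fun t => w (Th t))); [| exact Dw].
        apply (is_derive_scal (fun t => cos (Th t)) t A). apply deriv_cos; exact H.
      * specialize (Hw (Th t)). unfold scal; simpl; unfold mult; simpl. field. lra.
  - intros p q. unfold H. rewrite G_pot. split.
    + intros E. assert (Hp : Rabs p <= A).
      { apply Rnot_lt_le; intros Hn. assert (pot lam A < pot lam p); [| generalize (pow2_ge_0 q); lra].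
        apply (pot_abs_lt lam Hd). rewrite (Rabs_right A) by lra. exact Hn. }
      assert (HpA : -1 <= p / A <= 1).
      { assert (- A <= p <= A) by (generalize (Rle_abs p) (Rle_abs (- p)); rewrite Rabs_Ropp; lra).
        split; apply Rmult_le_reg_r with A; auto; unfold Rdiv; rewrite Rmult_assoc, Rinv_l; lra. }
      (* The energy fixes q up to sign; the condition on [- cos th * q] excludes the wrong sign
         unless q = 0. *)
      assert (Hgoal : forall th, A * sin th = p -> 0 <= - cos th * q -> exists t, A * sin (Th t) = p /\ - (A * cos (Th t) * w (Th t)) = q).
      { intros th Esin Hsg. exists (time lam A th). assert (ETt : Th (time lam A th) = th) by (apply Hinj, ETh). rewrite ETt.
        split; [exact Esin |]. assert (Hp2 := pot_speed2 lam A th). rewrite Esin, <- Ew in Hp2.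
        assert (Hsq : q ^ 2 = (A * cos th * w th) ^ 2) by lra.
        assert (Hfac : (q + A * cos th * w th) * (q - A * cos th * w th) = 0) by lra.
        apply Rmult_integral in Hfac. destruct Hfac as [Hf | Hf]; [lra |].
        assert (Eq : q = A * cos th * w th) by lra.
        assert (0 <= (A * w th) * cos th ^ 2) by (apply Rmult_le_pos; [specialize (Hw th); apply Rlt_le, Rmult_lt_0_compat; lra | apply pow2_ge_0]).
        assert (Hz1 : (A * w th) * cos th ^ 2 = 0) by (rewrite Eq in Hsg; lra).
        assert (Hc2 : cos th ^ 2 = 0).
        { apply Rmult_integral in Hz1. destruct Hz1 as [Hz1 | Hz1]; [| exact Hz1]. specialize (Hw th). assert (0 < A * w th) by (apply Rmult_lt_0_compat; lra). lra. }
        assert (Hc0 : cos th = 0) by nra. rewrite Eq, Hc0. ring. }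
      assert (Ea : A * sin (asin (p / A)) = p) by (rewrite sin_asin by auto; field; lra).
      assert (Hca : 0 <= cos (asin (p / A))) by (apply cos_ge_0; generalize (asin_bound (p / A)); lra).
      destruct (Rle_lt_dec q 0) as [Hq | Hq].
      * apply (Hgoal (asin (p / A))); auto. nra.
      * apply (Hgoal (PI - asin (p / A))); [rewrite sin_PI_x; auto |].
        rewrite cos_minus, cos_PI, sin_PI. nra.
    + intros [t [<- <-]]. assert (Hp2 := pot_speed2 lam A (Th t)). rewrite <- Ew in Hp2. lra.
  - assert (T0 : time lam A 0 = 0) by (apply (RInt_point (V := R_CompleteNormedModule))).
    unfold P. rewrite <- T0. apply time_incr; auto; lra.
  - intros t. rewrite Hshift.
    assert (Es : sin (Th t + 2 * PI) = sin (Th t)) by (rewrite sin_plus, sin_2PI, cos_2PI; ring).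
    assert (Ec : cos (Th t + 2 * PI) = cos (Th t)) by (rewrite cos_plus, sin_2PI, cos_2PI; ring).
    unfold w, speed2, mid_th, hdf_th. rewrite Es, Ec. auto.
  - intros Q HQ Hper. destruct (Hper 0) as [H1 H2]. rewrite Rplus_0_l, Th0 in H1, H2.
    assert (Tmono : forall a b, a < b -> Th a < Th b).
    { intros a b Hab. apply Rnot_le_lt; intros [Hn | Hn].
      - apply (time_incr lam Hd A HA) in Hn. rewrite !ETh in Hn. lra.
      - assert (a = b) by (rewrite <- (ETh a), <- (ETh b), Hn; auto). lra. }
    (* An earlier return would have x = 0, hence angle PI, where y has the opposite sign. *)
    assert (B1 := Tmono 0 Q ltac:(lra)). assert (B2 := Tmono Q (0 + P) ltac:(lra)). rewrite Hshift in B2. rewrite Th0 in B1, B2.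
    rewrite sin_0, Rmult_0_r in H1. assert (Hs : sin (Th Q) = 0) by (apply Rmult_integral in H1; destruct H1; lra).
    assert (EQ : Th Q = PI).
    { destruct (Rtotal_order (Th Q) PI) as [Hlt | [He | Hgt]]; [| exact He |].
      - generalize (sin_gt_0 (Th Q) ltac:(lra) ltac:(lra)); lra.
      - generalize (sin_lt_0 (Th Q) ltac:(lra) ltac:(lra)); lra. }
    rewrite EQ, cos_PI, cos_0 in H2. generalize (Hw 0) (Hw PI); intros.
    assert (0 < A * w 0) by (apply Rmult_lt_0_compat; auto). assert (0 < A * w PI) by (apply Rmult_lt_0_compat; auto). lra.
Qed.

Lemma amplitude_exists h : 0 < h -> exists A, 0 < A /\ pot lam A = h.
Proof.
  intros Hh. set (M := 2 * Rabs lam + h + 2).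
  assert (HM : h < pot lam M).
  { generalize (pot_diff_lower lam 0 M). unfold pot at 2. rewrite cos_0. generalize (Rabs_pos lam); intros.
    assert (2 * M <= M ^ 2) by (unfold M; nra). unfold M in *. lra. }
  assert (HM0 : 0 < M) by (unfold M; generalize (Rabs_pos lam); lra).
  assert (Hc : continuity (fun x => pot lam x - h)).
  { intros x. apply derivable_continuous_pt. exists (dpot lam x - 0). apply is_derive_Reals.
    apply (deriv_minus (pot lam) (fun _ => h)); [apply is_derive_pot | apply deriv_const]. }
  destruct (IVT_cor _ 0 M Hc) as [A [HA E]]; [lra | |].
  - unfold pot at 1. rewrite cos_0. nra.
  - exists A. split; [| lra]. destruct (Req_dec A 0) as [-> |]; [| lra].
    unfold pot in E. rewrite cos_0 in E. lra.
Qed.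

Definition amplitude (h : R) : R :=
  match Rlt_dec 0 h with left Hh => proj1_sig (constructive_indefinite_description _ (amplitude_exists h Hh)) | right _ => 0 end.

Lemma amplitude_spec h : 0 < h -> 0 < amplitude h /\ pot lam (amplitude h) = h.
Proof.
  intros Hh. unfold amplitude. destruct Rlt_dec as [H |]; [| lra].
  destruct constructive_indefinite_description as [A HA]; auto.
Qed.

Lemma is_derive_amplitude h : 0 < h -> is_derive amplitude h (/ dpot lam (amplitude h)).
Proof.
  apply (derive_inverse (fun a => 0 < a) (fun h => 0 < h) (pot lam) (fun a => / dpot lam a) amplitude).
  - intros; lra.
  - intros; apply (open_gt 0); auto.
  - intros; apply (open_gt 0); auto.
  - intros a Ha. specialize (Hd a Ha). split; [rewrite Rinv_inv; apply is_derive_pot |]. split; [apply Rinv_0_lt_compat; auto |].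
    apply (ex_derive_continuous (fun a => / dpot lam a)). unfold dpot in *. auto_derive. lra.
  - apply amplitude_spec.
Qed.

Lemma amplitude_mono h k : 0 < h < k -> amplitude h < amplitude k.
Proof.
  intros H. destruct (amplitude_spec h ltac:(lra)) as [A1 E1]. destruct (amplitude_spec k ltac:(lra)) as [A2 E2].
  apply Rnot_le_lt; intros [Hn | Hn].
  - generalize (pot_increasing lam Hd (amplitude k) (amplitude h)); lra.
  - rewrite Hn in E2; lra.
Qed.

Lemma amplitude_pot A : 0 < A -> amplitude (pot lam A) = A.
Proof.
  intros HA. assert (Hp : 0 < pot lam A).
  { generalize (pot_increasing lam Hd 0 A ltac:(lra)). unfold pot at 2. rewrite cos_0. lra. }
  destruct (amplitude_spec _ Hp) as [A1 E1].
  destruct (Rtotal_order (amplitude (pot lam A)) A) as [H | [H | H]]; auto.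
  - generalize (pot_increasing lam Hd (amplitude (pot lam A)) A); lra.
  - generalize (pot_increasing lam Hd A (amplitude (pot lam A))); lra.
Qed.
End Level.

(** * Critical periods *)

Lemma zero_sign_change (F : R -> R) (a l : R) : is_derive F a l -> F a = 0 -> l <> 0 ->
  exists d, 0 < d /\ (forall x : R, a - d < x < a -> 0 < - l * F x) /\ (forall x : R, a < x < a + d -> 0 < l * F x).
Proof.
  intros HF H0 Hl. apply is_derive_Reals in HF.
  destruct (HF (Rabs l)) as [d Hd]; [apply Rabs_pos_lt; auto |].
  exists d. split; [apply cond_pos |].
  assert (Hq : forall x : R, x <> a -> Rabs (x - a) < d -> 0 < l * (F x / (x - a))).
  { intros x Hx Hxd. specialize (Hd (x - a) ltac:(lra) Hxd). replace (a + (x - a)) with x in Hd by ring. rewrite H0, Rminus_0_r in Hd.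
    set (r := F x / (x - a)) in *. apply Rabs_def2 in Hd.
    destruct (Rlt_le_dec 0 l); [rewrite Rabs_right in Hd by lra | rewrite Rabs_left in Hd by lra]; nra. }
  split; intros x Hx.
  - specialize (Hq x ltac:(lra)). rewrite Rabs_left in Hq by lra. specialize (Hq ltac:(lra)).
    replace (- l * F x) with (l * (F x / (x - a)) * (a - x)) by (field; lra). apply Rmult_lt_0_compat; lra.
  - specialize (Hq x ltac:(lra)). rewrite Rabs_right in Hq by lra. specialize (Hq ltac:(lra)).
    replace (l * F x) with (l * (F x / (x - a)) * (x - a)) by (field; lra). apply Rmult_lt_0_compat; lra.
Qed.

Lemma Finite_bounded (U : R -> Prop) : Finite_sets.Finite R U -> exists M, forall x, U x -> x <= M.
Proof.
  induction 1 as [| U HU [M HM] x Hx].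
  - exists 0. intros x [].
  - exists (Rmax M x). intros y [y' Hy | y' Hy].
    + apply Rle_trans with M; [apply HM; auto | apply Rmax_l].
    + destruct Hy. apply Rmax_r.
Qed.

Section Critical.
Variable lam : R.
Hypothesis Hlam : -1 <= lam <= 4.6034.
Hypothesis Hlam0 : lam <> 0.
Hypothesis Hd : forall y, 0 < y -> 0 < dpot lam y.

Lemma Tin1_zero_simple A : 0 < A -> Tin1 lam 0 A = 0 -> Tin2 lam 0 A <> 0.
Proof.
  intros HA H0. destruct (amplitude_cases lam Hlam Hlam0 Hd A HA) as [[sg H] | [(sg & c & H) | H]].
  - generalize (Tin1_sign lam Hd A sg HA H Hlam0). rewrite H0. lra.
  - generalize (Tin2_sign lam Hd A sg c HA H Hlam0). rewrite H0. intros H1 H2. rewrite H2 in H1. lra.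
  - generalize (newton_concave lam Hd A HA H H0). lra.
Qed.

Lemma Tin1_continuous_on A : 0 < A -> continuity_pt (Tin1 lam 0) A.
Proof.
  intros HA. apply derivable_continuous_pt. exists (Tin2 lam 0 A). apply is_derive_Reals, is_derive_Tin1; auto. lra.
Qed.

Lemma Tin1_ivt a b : 0 < a < b -> Tin1 lam 0 a * Tin1 lam 0 b < 0 -> exists c, a < c < b /\ Tin1 lam 0 c = 0.
Proof.
  intros Hab Hs.
  (* Continuity of [Tin1] is known at positive amplitudes; freezing it below a extends it to a
     continuous function on the whole line. *)
  set (F := fun x => Tin1 lam 0 (Rmax a x)).
  assert (HF : continuity F).
  { intros x. apply (continuity_pt_comp (Rmax a) (Tin1 lam 0)); [| apply Tin1_continuous_on; apply Rlt_le_trans with a; [lra | apply Rmax_l]].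
    intros eps He. exists eps. split; auto. intros y [_ Hy]. simpl in *. unfold R_dist in *.
    apply Rle_lt_trans with (2 := Hy). unfold Rmax; repeat destruct Rle_dec; unfold Rabs; repeat destruct Rcase_abs; lra. }
  destruct (IVT_cor F a b HF) as [c [Hc E]]; [lra | unfold F; rewrite !Rmax_right by lra; lra |].
  unfold F in E. rewrite Rmax_right in E by lra. exists c. split; auto.
  assert (c <> a) by (intros ->; rewrite E in Hs; lra). assert (c <> b) by (intros ->; rewrite E in Hs; lra). lra.
Qed.

Lemma jf_zero_sin_pos n : exists z, 2 * PI * INR (S n) < z < 2 * PI * INR (S n) + PI / 2 /\ jf z = 0 /\ 0 < sin z.
Proof.
  generalize PI_bounds; intros HP.
  assert (Hn : 1 <= INR (S n)) by (rewrite S_INR; generalize (pos_INR n); lra).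
  set (N := INR (S n)) in *. assert (HN : 0 < 2 * PI * N) by (apply Rmult_lt_0_compat; lra).
  assert (Hp : forall y, sin (2 * PI * N + y) = sin y /\ cos (2 * PI * N + y) = cos y).
  { intros y. replace (2 * PI * N + y) with (y + 2 * N * PI) by ring. unfold N. rewrite sin_period, cos_period. auto. }
  destruct (jf_ivt (2 * PI * N) (2 * PI * N + PI / 2)) as [z [Hz E]]; [lra | |].
  - unfold jf. destruct (Hp (PI / 2)) as [-> ->]. destruct (Hp 0) as [H1 H2]. rewrite Rplus_0_r in H1, H2.
    rewrite H1, H2, sin_0, cos_0, sin_PI2, cos_PI2. lra.
  - exists z. repeat split; try lra. destruct (Hp (z - 2 * PI * N)) as [H1 _].
    replace (2 * PI * N + (z - 2 * PI * N)) with z in H1 by ring. rewrite H1. apply sin_gt_0; lra.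
Qed.

Lemma jf_zero_sin_neg n : exists z, 2 * PI * INR n + PI < z < 2 * PI * INR n + 3 * (PI / 2) /\ jf z = 0 /\ sin z < 0.
Proof.
  generalize PI_bounds; intros HP. set (N := INR n) in *.
  assert (HN : 0 <= 2 * PI * N) by (apply Rmult_le_pos; [lra | apply pos_INR]).
  assert (Hp : forall y, sin (2 * PI * N + y) = sin y /\ cos (2 * PI * N + y) = cos y).
  { intros y. replace (2 * PI * N + y) with (y + 2 * N * PI) by ring. unfold N. rewrite sin_period, cos_period. auto. }
  destruct (jf_ivt (2 * PI * N + PI) (2 * PI * N + 3 * (PI / 2))) as [z [Hz E]]; [lra | |].
  - unfold jf. destruct (Hp PI) as [-> ->]. destruct (Hp (3 * (PI / 2))) as [-> ->].
    rewrite sin_PI, cos_PI, sin_3PI2, cos_3PI2. lra.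
  - exists z. repeat split; try lra. destruct (Hp (z - 2 * PI * N)) as [H1 _].
    replace (2 * PI * N + (z - 2 * PI * N)) with z in H1 by ring. rewrite H1. apply sin_lt_0; lra.
Qed.

Lemma Tin1_zero_unbounded M : exists A, M < A /\ 0 < A /\ Tin1 lam 0 A = 0.
Proof.
  generalize PI_bounds; intros HP. destruct (INR_unbounded (Rabs M)) as [n Hn].
  assert (HM : M <= Rabs M /\ 0 <= Rabs M) by (split; [apply Rle_abs | apply Rabs_pos]).
  destruct (jf_zero_sin_pos n) as (z & Hz & Ez & Sz).
  destruct (jf_zero_sin_neg (S n)) as (z' & Hz' & Ez' & Sz').
  rewrite S_INR in Hz, Hz'. assert (Hb : 2 * PI * (INR n + 1) > INR n + 5).
  { assert (0 <= (2 * PI - 1) * INR n) by (apply Rmult_le_pos; [lra | apply pos_INR]). lra. }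
  assert (P1 := Tin1_sign lam Hd z (- sin z) ltac:(lra) (fun x Hx => spiral_zero z x ltac:(lra) Ez Hx) Hlam0).
  assert (P2 := Tin1_sign lam Hd z' (- sin z') ltac:(lra) (fun x Hx => spiral_zero z' x ltac:(lra) Ez' Hx) Hlam0).
  destruct (Tin1_ivt z z') as [A [HA E]]; [lra | | exists A; repeat split; auto; lra].
  assert (0 < - sin z * lam * Tin1 lam 0 z * (- sin z' * lam * Tin1 lam 0 z')) by (apply Rmult_lt_0_compat; auto).
  assert (Hss : 0 < (sin z * - sin z') * lam ^ 2) by (apply Rmult_lt_0_compat; [apply Rmult_lt_0_compat; lra | apply pow2_gt_0; auto]).
  apply Ropp_lt_cancel. rewrite Ropp_0. apply Rmult_lt_reg_l with (1 := Hss). lra.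
Qed.

Definition period (h : R) : R := 2 * sqrt 2 * Tin lam 0 (amplitude lam h).
Definition period_factor (h : R) : R := 2 * sqrt 2 * / dpot lam (amplitude lam h).

Lemma period_factor_pos h : 0 < h -> 0 < period_factor h.
Proof.
  intros Hh. unfold period_factor. assert (0 < sqrt 2) by (apply sqrt_lt_R0; lra).
  apply Rmult_lt_0_compat; [lra |]. apply Rinv_0_lt_compat, Hd, amplitude_spec; auto.
Qed.

Lemma is_derive_period h : 0 < h -> is_derive period h (period_factor h * Tin1 lam 0 (amplitude lam h)).
Proof.
  intros Hh. destruct (amplitude_spec lam h Hh) as [HA _]. unfold period.
  apply is_derive_val with (2 * sqrt 2 * (/ dpot lam (amplitude lam h) * Tin1 lam 0 (amplitude lam h))); [| unfold period_factor; ring].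
  apply (is_derive_scal (fun h => Tin lam 0 (amplitude lam h))).
  apply (is_derive_comp (Tin lam 0) (amplitude lam)); [apply is_derive_Tin; auto; lra | apply is_derive_amplitude; auto].
Qed.

Lemma Derive_period h : 0 < h -> Derive period h = period_factor h * Tin1 lam 0 (amplitude lam h).
Proof. intros Hh. apply is_derive_unique, is_derive_period, Hh. Qed.

(** T' without its positive factor: simple zeros of this function suffice, so T itself need not be
    differentiated twice. *)
Definition Tin1_at (h : R) : R := Tin1 lam 0 (amplitude lam h).

Lemma is_derive_Tin1_at h : 0 < h -> is_derive Tin1_at h (/ dpot lam (amplitude lam h) * Tin2 lam 0 (amplitude lam h)).
Proof.
  intros Hh. destruct (amplitude_spec lam h Hh) as [HA _].
  apply (is_derive_comp (Tin1 lam 0) (amplitude lam)); [apply is_derive_Tin1; auto; lra | apply is_derive_amplitude; auto].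
Qed.

Lemma Tin1_at_sign_change h : 0 < h -> Tin1_at h = 0 -> exists s d, 0 < d <= h /\ s <> 0 /\
  (forall x, h - d < x < h -> 0 < - s * Tin1_at x) /\ (forall x, h < x < h + d -> 0 < s * Tin1_at x).
Proof.
  intros Hh H0. destruct (amplitude_spec lam h Hh) as [HA _]. assert (Hp := Hd _ HA).
  assert (Hn : / dpot lam (amplitude lam h) * Tin2 lam 0 (amplitude lam h) <> 0).
  { apply Rmult_integral_contrapositive_currified; [apply Rinv_neq_0_compat; lra | apply Tin1_zero_simple; auto]. }
  destruct (zero_sign_change Tin1_at h _ (is_derive_Tin1_at h Hh) H0 Hn) as (d & Hd0 & H1 & H2).
  exists (/ dpot lam (amplitude lam h) * Tin2 lam 0 (amplitude lam h)), (Rmin d h).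
  assert (Hm := Rmin_l d h). assert (Hm' := Rmin_r d h).
  split; [split; [apply Rmin_glb_lt; auto | auto] |]. split; auto.
  split; intros x Hx; [apply H1 | apply H2]; lra.
Qed.

Lemma period_mono s a b : 0 < a <= b -> (forall x, a <= x <= b -> 0 <= s * Tin1_at x) -> s * period a <= s * period b.
Proof.
  intros Hab H. apply derive_nonneg_le with (f := fun h => s * period h) (df := fun h => s * (period_factor h * Tin1_at h)); [lra | |].
  - intros x Hx. apply (is_derive_scal period), is_derive_period. lra.
  - intros x Hx. specialize (H x Hx). assert (Hp := period_factor_pos x ltac:(lra)).
    replace (s * (period_factor x * Tin1_at x)) with (period_factor x * (s * Tin1_at x)) by ring. apply Rmult_le_pos; lra.
Qed.

Lemma critical_period_iff h : critical_period period h <-> 0 < h /\ Tin1_at h = 0.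
Proof.
  split.
  - intros [Hh [H0 _]]. split; auto. rewrite Derive_period in H0 by auto. assert (Hp := period_factor_pos h Hh).
    apply Rmult_integral in H0. destruct H0 as [H0 | H0]; [lra | exact H0].
  - intros [Hh H0]. split; auto. split.
    + rewrite Derive_period by auto. fold (Tin1_at h). rewrite H0. ring.
    + destruct (Tin1_at_sign_change h Hh H0) as (s & d & Hd0 & Hs & H1 & H2).
      exists (mkposreal d (proj1 Hd0)). intros y Hy Hne. change (Rabs (y - h) < d) in Hy. apply Rabs_def2 in Hy.
      rewrite Derive_period by lra. fold (Tin1_at y). assert (Hp := period_factor_pos y ltac:(lra)).
      apply Rmult_integral_contrapositive_currified; [lra |]. intros E.
      destruct (Rlt_le_dec y h) as [Hlt | Hge].
      * specialize (H1 y ltac:(lra)). rewrite E in H1. lra.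
      * specialize (H2 y ltac:(lra)). rewrite E in H2. lra.
Qed.

Lemma extremum_of_sign_change s h d : 0 < d <= h -> Tin1_at h = 0 ->
  (forall x, h - d < x < h -> 0 < - s * Tin1_at x) -> (forall x, h < x < h + d -> 0 < s * Tin1_at x) ->
  locally h (fun k => s * period h <= s * period k).
Proof.
  intros Hdh H0 H1 H2. exists (mkposreal d (proj1 Hdh)). intros y Hy. change (Rabs (y - h) < d) in Hy. apply Rabs_def2 in Hy.
  destruct (Rle_lt_dec h y) as [Hle | Hlt].
  - apply period_mono; [lra |]. intros x Hx. destruct (Req_dec x h) as [-> |]; [rewrite H0; lra |]. specialize (H2 x ltac:(lra)). lra.
  - assert (- s * period y <= - s * period h); [| lra].
    apply period_mono; [lra |]. intros x Hx. destruct (Req_dec x h) as [-> |]; [rewrite H0; lra |]. specialize (H1 x ltac:(lra)). lra.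
Qed.

Lemma extremum_of_sign s h : s <> 0 -> locally h (fun k => s * period h <= s * period k) ->
  (0 < s -> local_min period h) /\ (s < 0 -> local_max period h).
Proof.
  intros Hs HL. split; intros Hsg; apply filter_imp with (2 := HL); intros k Hk.
  - apply Rmult_le_reg_l with s; auto.
  - apply Rmult_le_reg_l with (- s); lra.
Qed.

Lemma Tin1_at_ivt h k : 0 < h < k -> Tin1_at h * Tin1_at k < 0 -> exists c, h < c < k /\ Tin1_at c = 0.
Proof.
  intros Hhk Hs. destruct (amplitude_spec lam h ltac:(lra)) as [A1 E1]. destruct (amplitude_spec lam k ltac:(lra)) as [A2 E2].
  destruct (Tin1_ivt (amplitude lam h) (amplitude lam k)) as [c [Hc E]].
  - split; auto. apply amplitude_mono; auto.
  - exact Hs.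
  - exists (pot lam c). unfold Tin1_at. rewrite amplitude_pot by (auto; lra). split; [| exact E].
    generalize (pot_increasing lam Hd (amplitude lam h) c ltac:(lra)) (pot_increasing lam Hd c (amplitude lam k) ltac:(lra)). lra.
Qed.

Lemma critical_periods_infinite : ~ Finite_sets.Finite R (critical_period period).
Proof.
  intros HF. destruct (Finite_bounded _ HF) as [M HM].
  set (N := Rmax M 1). assert (HN : 1 <= N /\ M <= N) by (unfold N; generalize (Rmax_l M 1) (Rmax_r M 1); lra).
  destruct (amplitude_spec lam N ltac:(lra)) as [HA EA].
  destruct (Tin1_zero_unbounded (amplitude lam N)) as (A & HNA & HA0 & E).
  assert (Hp := pot_increasing lam Hd (amplitude lam N) A ltac:(lra)). rewrite EA in Hp.
  assert (Hcrit : critical_period period (pot lam A)).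
  { apply critical_period_iff. unfold Tin1_at. rewrite amplitude_pot by auto. split; [lra | exact E]. }
  specialize (HM _ Hcrit). lra.
Qed.

Lemma period_alternates : alternate_max_min period.
Proof.
  split.
  - intros h Hc. apply critical_period_iff in Hc. destruct Hc as [Hh H0].
    destruct (Tin1_at_sign_change h Hh H0) as (s & d & Hdh & Hs & H1 & H2).
    destruct (extremum_of_sign s h Hs (extremum_of_sign_change s h d Hdh H0 H1 H2)) as [Hmin Hmax].
    destruct (Rlt_le_dec s 0); [left; auto | right; apply Hmin; lra].
  - intros h1 h2 Hc1 Hc2 Hlt Hnone. apply critical_period_iff in Hc1, Hc2.
    destruct Hc1 as [Hh1 E1]. destruct Hc2 as [Hh2 E2].
    destruct (Tin1_at_sign_change h1 Hh1 E1) as (s1 & d1 & Hd1 & Hs1 & L1 & R1).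
    destruct (Tin1_at_sign_change h2 Hh2 E2) as (s2 & d2 & Hd2 & Hs2 & L2 & R2).
    destruct (extremum_of_sign s1 h1 Hs1 (extremum_of_sign_change s1 h1 d1 Hd1 E1 L1 R1)) as [Hmin1 Hmax1].
    destruct (extremum_of_sign s2 h2 Hs2 (extremum_of_sign_change s2 h2 d2 Hd2 E2 L2 R2)) as [Hmin2 Hmax2].
    (* Sign changes in the same direction would give T' opposite signs just after h1 and just before
       h2, hence another critical level in between. *)
    assert (Hopp : s1 * s2 < 0).
    { apply Rnot_le_lt; intros Hn.
      assert (Hpos : 0 < s1 * s2) by (destruct Hn as [Hn | Hn]; [auto | symmetry in Hn; apply Rmult_integral in Hn; destruct Hn; contradiction]).
      set (d := Rmin (Rmin d1 d2) (h2 - h1)).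
      assert (Hdd : 0 < d /\ d <= d1 /\ d <= d2 /\ d <= h2 - h1).
      { unfold d. generalize (Rmin_l (Rmin d1 d2) (h2 - h1)) (Rmin_r (Rmin d1 d2) (h2 - h1)) (Rmin_l d1 d2) (Rmin_r d1 d2).
        repeat split; try lra. repeat apply Rmin_glb_lt; lra. }
      assert (B1 := R1 (h1 + d / 3) ltac:(lra)). assert (B2 := L2 (h2 - d / 3) ltac:(lra)).
      destruct (Tin1_at_ivt (h1 + d / 3) (h2 - d / 3)) as [c [Hc Ec]]; [lra | |].
      - assert (Hm := Rmult_lt_0_compat _ _ B1 B2). apply Ropp_lt_cancel. rewrite Ropp_0.
        apply Rmult_lt_reg_l with (1 := Hpos). lra.
      - apply (Hnone c); [lra |]. apply critical_period_iff. split; [lra | exact Ec]. }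
    destruct (Rlt_le_dec s1 0) as [Hn1 | Hp1].
    + left. split; [auto |]. apply Hmin2. nra.
    + right. split; [apply Hmin1; lra |]. apply Hmax2. nra.
Qed.
End Critical.

(** * Positivity of the force and conclusion *)

Lemma dpot_positive lam : (forall x : R, x + lam * sin x = 0 -> x = 0) -> forall y, 0 < y -> 0 < dpot lam y.
Proof.
  intros heq y Hy. apply Rnot_le_lt; intros Hn.
  assert (Hneg : dpot lam y < 0) by (destruct Hn as [Hn | Hn]; [auto | apply heq in Hn; lra]).
  set (M := y + Rabs lam + 1). assert (HM : 0 < dpot lam M).
  { unfold dpot. assert (Rabs (lam * sin M) <= Rabs lam * 1).
    { rewrite Rabs_mult. apply Rmult_le_compat_l; [apply Rabs_pos |]. apply Rabs_le, SIN_bound. }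
    assert (- (lam * sin M) <= Rabs (lam * sin M)) by (rewrite <- Rabs_Ropp; apply Rle_abs). unfold M in *; lra. }
  destruct (IVT_cor (dpot lam) y M) as [x [Hx E]].
  - intros x. apply derivable_continuous_pt. exists (1 + lam * cos x). apply is_derive_Reals.
    unfold dpot. auto_derive; [exact I | ring].
  - unfold M. generalize (Rabs_pos lam); lra.
  - nra.
  - apply heq in E. lra.
Qed.

(** At lam = 0 the system is linear and all orbits have period 2 PI. The decimal bound is -1 / cos z
    rounded to nine places, and [heq], the uniqueness of the equilibrium, expresses that the centre
    is global. *)
Theorem theorem1p1 (lam : R) (hlam : -1 <= lam < 4.603338849)
    (hlam0 : lam <> 0)
    (heq : forall x : R, x + lam * sin x = 0 -> x = 0) :
  exists T : R -> R,
    is_period_function lam T /\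
    (forall h : R, 0 < h -> ex_derive T h) /\
    ~ Finite_sets.Finite R (critical_period T) /\
    alternate_max_min T.
Proof.
  (* The numerical estimates use only lam <= 4.6034; the exact borderline enters through the
     positivity of G'. *)
  assert (Hd := dpot_positive lam heq). assert (Hl : -1 <= lam <= 4.6034) by lra.
  exists (period lam). split; [| split; [| split]].
  - intros h Hh. destruct (amplitude_spec lam h Hh) as [HA E]. rewrite <- E at 1. apply level_period_amp; auto.
  - intros h Hh. eexists. apply is_derive_period; auto.
  - apply critical_periods_infinite; auto.
  - apply period_alternates; auto.
Qed.
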